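(* Assume that the communication graph is strongly connected (with at least one self-loop), that $D_{\mathrm{KL}}(f_k\|L_k(\cdot|\theta))<\infty$ for all $k\in\mathcal N$, $\theta\in\Theta$, that $\theta_1$ is identifiable by the group $\mathcal N_A$ (i.e. $\bigcap_{k\in\mathcal N_A}\Theta_k^\star=\{\theta_1\}$), and that all initial beliefs $\mu_{k,0}(\theta)$ are positive. Consider a combination matrix $A$ with Perron eigenvector $\pi$. Then, for every $k\in\mathcal N$ and every $\theta\in\Theta$, the steady-state log-belief ratio $\widetilde{\lambda}_{k,\infty}(\theta)$ (which depends on the step-size $\delta$) satisfies $$\widetilde{\lambda}_{k,\infty}(\theta)\xrightarrow{\ \delta\to0\ }\mathsf m_{\mathsf{ave}}(\pi,\theta)\quad\text{in probability}.$$ Moreover, if $\mathsf m_{\mathsf{ave}}(\pi,\theta)>0$ for all $\theta\neq\theta_1$, then for every $k\in\mathcal N$: (i) (Consistency of learning) the steady-state error probability $p_k$ converges to $0$ as $\delta\to0$. (ii) (Error exponent) If in addition $\Lambda_k(t;\theta)<\infty$ for all $t\in\mathbb R$, all $k\in\mathcal N$ and all $\theta\neq\theta_1$, then $$\lim_{\delta\to0}\delta\ln p_k=-\Phi(\pi),\qquad \Phi(\pi)=\min_{\theta\neq\theta_1}\Phi(\pi,\theta),$$ where $$\Phi(\pi,\theta)=-\inf_{t\in\mathbb R}\phi(t;\pi,\theta),\qquad \phi(t;\pi,\theta)=\int_0^t\frac{\Lambda_{\mathsf{ave}}(\tau;\pi,\theta)}{\tau}\,d\tau .$$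
   Context: There are $N$ agents $\mathcal N=\{1,\dots,N\}$ connected by a directed graph; $\mathcal N_k$ denotes the set of neighbors of agent $k$. Strong connectivity means that there are paths in both directions between any two distinct agents and that at least one agent has a self-loop. The combination matrix $A=[a_{\ell k}]$ is left-stochastic ($\sum_\ell a_{\ell k}=1$ for each $k$), with $a_{\ell k}>0$ for $\ell\in\mathcal N_k$ and $a_{\ell k}=0$ otherwise; under strong connectivity it is primitive. Its Perron eigenvector $\pi$ is the unique vector with $A\pi=\pi$, $\sum_k\pi_k=1$, $\pi_k>0$ for all $k$. The hypothesis set is $\Theta=\{\theta_1,\dots,\theta_H\}$, with true state $\theta_1$. At each time $i=1,2,\dots$ agent $k$ receives a signal $\xi_{k,i}\in\mathcal X_k$ with distribution $f_k$ (a pdf or pmf); the signals are independent over agents and over time. Each agent has likelihood models $L_k(\cdot|\theta)$, $\theta\in\Theta$ (pdfs or pmfs, of the same type as $f_k$), with the same support $\mathcal X_k$ as $f_k$; $f_k$ need not equal any $L_k(\cdot|\theta)$. $D_{\mathrm{KL}}$ is the Kullback–Leibler divergence. The set of local truths is $\Theta_k^\star=\arg\min_{\theta\in\Theta}D_{\mathrm{KL}}(f_k\|L_k(\cdot|\theta))$, and $\mathcal N_A=\{k\in\mathcal N:\theta_1\in\Theta_k^\star\}$. Adaptive social learning with step-size $\delta\in(0,1)$: each agent holds a belief $\mu_{k,i}$ (a pmf on $\Theta$), updated by $\psi_{k,i}(\theta)\propto\mu_{k,i-1}(\theta)^{1-\delta}L_k(\xi_{k,i}|\theta)^\delta$ and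 $\mu_{k,i}(\theta)\propto\exp\big(\sum_{\ell\in\mathcal N_k}a_{\ell k}\log\psi_{\ell,i}(\theta)\big)$ (normalized over $\theta\in\Theta$). Define $x_{k,i}(\theta)=\log\frac{L_k(\xi_{k,i}|\theta_1)}{L_k(\xi_{k,i}|\theta)}$, and $d_k(\theta)=\mathbb E[x_{k,i}(\theta)]=D_{\mathrm{KL}}(f_k\|L_k(\cdot|\theta))-D_{\mathrm{KL}}(f_k\|L_k(\cdot|\theta_1))$, where expectations and probabilities are with respect to the distributions $f_k$ of the signals. The steady-state log-belief ratio of agent $k$ is the almost surely convergent series $$\widetilde\lambda_{k,\infty}(\theta)=\delta\sum_{m=0}^\infty\sum_{\ell=1}^N(1-\delta)^m[A^{m+1}]_{\ell k}\,x_{\ell,m+1}(\theta),$$ which is the limit in distribution as $i\to\infty$ of $\log\frac{\mu_{k,i}(\theta_1)}{\mu_{k,i}(\theta)}$. The steady-state error probability is $p_k=\mathbb P[\exists\,\theta\neq\theta_1:\widetilde\lambda_{k,\infty}(\theta)\le0]$. Further, $\mathsf m_{\mathsf{ave}}(\pi,\theta)=\sum_{k=1}^N\pi_kd_k(\theta)$, $\Lambda_k(t;\theta)=\log\mathbb E[e^{t x_{k,i}(\theta)}]$ and $\Lambda_{\mathsf{ave}}(t;\pi,\theta)=\sum_{k=1}^N\Lambda_k(\pi_kt;\theta)$. The integrand $\Lambda_{\mathsf{ave}}(\tau;\pi,\theta)/\tau$ is extended by continuity at $\tau=0$. *)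

(* Defs.v *)
From HB Require Import structures.
From mathcomp Require Import all_boot all_order all_algebra.
From mathcomp Require Import all_classical all_reals all_analysis.
Import Order.TTheory GRing.Theory Num.Theory.
Import numFieldNormedType.Exports.

Set Implicit Arguments.
Unset Strict Implicit.
Unset Printing Implicit Defensive.

Local Open Scope classical_set_scope.
Local Open Scope ring_scope.

Section Network.
Context {R : realType} {N : nat}.

(* [nbr k] is the set of the in-neighbors of [k]: the agents [l] whose
   intermediate beliefs are received by [k]. *)
Definition strongly_connected (nbr : 'I_N -> {set 'I_N}) : Prop :=
  (forall l k, l != k -> connect [rel a b | a \in nbr b] l k) /\
  (exists k, k \in nbr k).

Definition combination_matrix (nbr : 'I_N -> {set 'I_N}) (A : 'M[R]_N) : Prop :=
  [/\ forall k, \sum_l A l k = 1,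
      forall l k, l \in nbr k -> 0 < A l k
    & forall l k, l \notin nbr k -> A l k = 0].

Definition perron_eigenvector (A : 'M[R]_N) (v : 'cV[R]_N) : Prop :=
  [/\ A *m v = v, \sum_k v k 0 = 1 & forall k, 0 < v k 0].

End Network.

Section Probability.
Context {R : realType}.

(* A density with respect to a reference measure [nu]: a pdf when [nu] is a
   Lebesgue measure, a pmf when [nu] is a counting measure. Its support [X] is
   the set of the points at which it is nonzero. *)
Definition density_with_support d (T : measurableType d)
    (nu : set T -> \bar R) (X : set T) (g : T -> R) : Prop :=
  [/\ measurable_fun [set: T] g,
      forall s, 0 <= g s,
      (\int[nu]_s (g s)%:E = 1)%E
    & [set s | g s != 0] = X].

(* Since [lne 0 = -oo] and [0 * _ = 0] in [\bar R], the integrand is [0] where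
   [f s = 0], and [+oo] where [f s > 0] and [g s = 0]. *)
Definition KL_divergence d (T : measurableType d) (nu : set T -> \bar R)
    (f g : T -> R) : \bar R :=
  (\int[nu]_s ((f s)%:E * (lne (f s)%:E - lne (g s)%:E)))%E.

(* Mutual independence of the random elements [Y j] with [j] in [D]: product
   rule over all the finite subfamilies, listed without repetition by [J]. *)
Definition mutually_independent d (Omega : measurableType d)
    (P : set Omega -> \bar R) (I : eqType) (D : I -> Prop)
    (d' : I -> measure_display) (T : forall j, measurableType (d' j))
    (Y : forall j, Omega -> T j) : Prop :=
  forall (J : seq I) (B : forall j, set (T j)),
    uniq J -> (forall j, j \in J -> D j) -> (forall j, measurable (B j)) ->
    P (\bigcap_(j in [set` J]) (Y j @^-1` B j)) =
      (\prod_(j <- J) P (Y j @^-1` B j))%E.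

Definition oriented_integral (a b : R) (h : R -> \bar R) : \bar R :=
  (if (a <= b)%R then \int[lebesgue_measure]_(x in `[a, b]) h x
   else - \int[lebesgue_measure]_(x in `[b, a]) h x)%E.

End Probability.

Section AdaptiveSocialLearning.
Context {R : realType} {N : nat} {Theta : finType} (theta1 : Theta).
Context {dT : 'I_N -> measure_display} {T : forall k, measurableType (dT k)}.
Context {dO : measure_display} {Omega : measurableType dO}.
Variables (P : probability Omega R) (nu : forall k, set (T k) -> \bar R).
Variables (f : forall k, T k -> R) (L : forall k, Theta -> T k -> R).
Arguments nu : clear implicits.
Arguments f : clear implicits.
Arguments L : clear implicits.
(* [xi k i] is the signal received by agent [k] at time [i]; only the times
   [i >= 1] are meaningful. *)
Variable xi : forall k, nat -> Omega -> T k.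
Arguments xi : clear implicits.
Variables (nbr : 'I_N -> {set 'I_N}) (A : 'M[R]_N) (v : 'cV[R]_N).

(* Signals with densities [f k], independent over agents and over time. *)
Definition signal_model : Prop :=
  [/\ forall k i, (0 < i)%N -> measurable_fun [set: Omega] (xi k i),
      forall k i, (0 < i)%N -> forall B, measurable B ->
        P (xi k i @^-1` B) = (\int[nu k]_(s in B) (f k s)%:E)%E
    & mutually_independent P (fun j : 'I_N * nat => (0 < j.2)%N)
        (fun j => xi j.1 j.2)].

Definition local_truths (k : 'I_N) : set Theta :=
  [set theta | forall theta',
     (KL_divergence (nu k) (f k) (L k theta) <=
      KL_divergence (nu k) (f k) (L k theta'))%E].

Definition truthful_agents : set 'I_N := [set k | local_truths k theta1].

Definition identifiable : Prop :=
  \bigcap_(k in truthful_agents) local_truths k = [set theta1].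

Definition normalize (g : Theta -> R) (theta : Theta) : R :=
  g theta / \sum_theta' g theta'.

Definition intermediate_belief (delta : R)
    (mu : 'I_N -> nat -> Omega -> Theta -> R) (k : 'I_N) (i : nat)
    (w : Omega) : Theta -> R :=
  normalize (fun theta =>
    mu k i.-1 w theta `^ (1 - delta) * L k theta (xi k i w) `^ delta).

Definition asl_beliefs (delta : R) (mu0 : 'I_N -> Theta -> R)
    (mu : 'I_N -> nat -> Omega -> Theta -> R) : Prop :=
  (forall k w, mu k 0%N w = mu0 k) /\
  (forall k i w, (0 < i)%N ->
     mu k i w = normalize (fun theta =>
       expR (\sum_(l in nbr k)
               A l k * ln (intermediate_belief delta mu l i w theta)))).

Definition llr (k : 'I_N) (i : nat) (theta : Theta) (w : Omega) : R :=
  ln (L k theta1 (xi k i w) / L k theta (xi k i w)).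

(* The law of [llr k i theta] is the same for all times [i >= 1]; its mean and
   its moment generating function are taken at [i = 1]. *)
Definition mean_llr (k : 'I_N) (theta : Theta) : R :=
  fine ('E_P[llr k 1 theta])%E.

Definition m_ave (theta : Theta) : R :=
  \sum_(k < N) v k 0 * mean_llr k theta.

Definition Lambda (k : 'I_N) (t : R) (theta : Theta) : \bar R :=
  lne ('M_P (llr k 1 theta) t).

Definition Lambda_ave (t : R) (theta : Theta) : \bar R :=
  (\sum_(k < N) Lambda k (v k 0 * t)%R theta)%E.

(* On the null event where the series diverges, [limn] is a fixed dummy
   value. *)
Definition steady_state_llr (delta : R) (k : 'I_N) (theta : Theta)
    (w : Omega) : R :=
  delta * limn (series (fun m : nat => \sum_(l < N)
    (1 - delta) ^+ m * (A ^+ m.+1) l k * llr l m.+1 theta w)).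

Definition error_probability (delta : R) (k : 'I_N) : \bar R :=
  P [set w | exists theta, theta != theta1 /\
                           steady_state_llr delta k theta w <= 0].

Definition phi_integrand (theta : Theta) (tau : R) : \bar R :=
  (let h s := Lambda_ave s theta * (s^-1)%:E in
   if tau == 0%R then lim (h s @[s --> 0%R^']) else h tau)%E.

Definition phi (t : R) (theta : Theta) : \bar R :=
  oriented_integral 0 t (phi_integrand theta).

Definition Phi_theta (theta : Theta) : \bar R :=
  (- ereal_inf [set phi t theta | t in [set: R]])%E.

Definition Phi : \bar R :=
  \big[mine/+oo%E]_(theta | theta != theta1) Phi_theta theta.

End AdaptiveSocialLearning.

(* Main.v *)
(** The steady-state log-belief ratio is [delta] times the sum over [m] of
    [(1 - delta)^m] times independent log-likelihood ratios, with weights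
    [A^(m+1)] that converge to the Perron vector (a power of [A] is positive,
    so that [A] contracts the vectors of sum zero).

    Convergence in probability holds under first moments only: for the positive
    and negative parts of the ratios, the Laplace transform of the series is an
    infinite product that converges to the transform of the mean at every
    [s > 0], and [s = 1, 2] suffice to bound [E (e^(-lambda) - e^(-m))^2].

    For the exponent, [delta] times the logarithm of [E e^(t lambda / delta)] is
    a Riemann sum of [Lambda_ave] for the points [(1 - delta)^m t] and the
    measure [d tau / tau], so that it tends to [phi t]. The upper bound is the
    Chernoff bound at the minimizer [ts < 0] of [phi]. For the lower bound, take
    [t] slightly below [ts]: comparing the transform at [t] with those at
    [t - h] and [t + h], most of [E e^(t lambda / delta)] comes from the event
    [b <= lambda <= 0], for a small [b < 0]. The minimizer exists since
    [Lambda_ave] tends to [+oo] at [-oo]: a log-likelihood ratio that is almost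
    surely nonnegative vanishes, two densities with the same support having the
    same mass. *)

Require Import Defs.
From HB Require Import structures.
From mathcomp Require Import all_boot all_order all_algebra.
From mathcomp Require Import all_classical all_reals all_analysis.
From mathcomp Require Import measurable_realfun ring lra.
Import Order.TTheory GRing.Theory Num.Theory.
Import numFieldNormedType.Exports.
Set Implicit Arguments.
Unset Strict Implicit.
Unset Printing Implicit Defensive.
Local Open Scope classical_set_scope.
Local Open Scope ring_scope.

(** * Powers of the combination matrix *)

Section Perron.
Context {R : realType} {N : nat}.
Implicit Types (A : 'M[R]_N).

(** Finite divergences give the log-likelihood ratios a mean but no variance, so Chebyshev's
    inequality is out of reach for the series itself; it is applied to [exp (- lambda)] instead,
    which is bounded only for nonnegative variables, whence the split into positive and negative
    parts. Two limits are nested. The transforms are computed for the sum truncated at [n], with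
    bounds valid for all [n] or for all large [n]; then [n] goes to infinity at fixed [delta], by
    dominated convergence, and only then does [delta] go to 0. The lower bound on the error
    probability involves neither a tilted measure nor the derivative of [phi]. It compares three
    values of the transform, and [phi] enters through chords alone: since [F s / s] is nondecreasing
    for convex [F] with [F 0 = 0], each increment of [phi] lies between the slopes at the two ends.
    The same two-sided bound controls the Riemann sums and locates the minimizer at the negative
    zero of [F]. *)

Lemma mulmx_l1_le (B : 'M[R]_N) (x : 'cV[R]_N) (c : R) :
  (forall l k, 0 <= B l k) -> (forall k, \sum_l B l k = c) ->
  \sum_l `|(B *m x) l 0| <= c * \sum_l `|x l 0|.
Proof.
move=> B0 Bc.
apply: (@le_trans _ _ (\sum_l \sum_k B l k * `|x k 0|)).
  apply: ler_sum => l _; rewrite mxE.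
  apply: (le_trans (ler_norm_sum _ _ _)).
  by apply: ler_sum => k _; rewrite normrM ger0_norm.
rewrite exchange_big /= mulr_sumr; apply: ler_sum => k _.
by rewrite -mulr_suml Bc.
Qed.

Lemma mulmx_colsum (B : 'M[R]_N) (x : 'cV[R]_N) (c : R) :
  (forall k, \sum_l B l k = c) -> \sum_l (B *m x) l 0 = c * \sum_l x l 0.
Proof.
move=> Bc; under eq_bigr do rewrite mxE.
rewrite exchange_big /= mulr_sumr; apply: eq_bigr => k _.
by rewrite -mulr_suml Bc.
Qed.

Variables (nbr : 'I_N -> {set 'I_N}) (A : 'M[R]_N) (v : 'cV[R]_N).
Hypotheses (hgraph : strongly_connected nbr) (hA : combination_matrix nbr A).
Hypothesis hv : perron_eigenvector A v.

Lemma combination_ge0 l k : 0 <= A l k.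
Proof.
case: hA => _ Apos Azero; have [/Apos/ltW//|/Azero ->//] := boolP (l \in nbr k).
Qed.

Lemma combination_exp_ge0 n l k : 0 <= (A ^+ n) l k.
Proof.
elim: n l k => [|n IH] l k; first by rewrite expr0 mxE; case: eqP.
rewrite exprS mxE; apply: sumr_ge0 => j _.
by rewrite mulr_ge0 ?combination_ge0.
Qed.

Lemma combination_exp_colsum n k : \sum_l (A ^+ n) l k = 1.
Proof.
case: hA => A1 _ _; elim: n k => [|n IH] k.
  rewrite (bigD1 k) //= big1 ?addr0; last first.
    by move=> j /negPf jk; rewrite expr0 mxE jk.
  by rewrite expr0 mxE eqxx.
under eq_bigr do rewrite exprSr mxE.
rewrite exchange_big /= -[RHS](A1 k); apply: eq_bigr => j _.
by rewrite -mulr_suml IH mul1r.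
Qed.

Lemma combination_exp_le1 n l k : (A ^+ n) l k <= 1.
Proof.
rewrite -[leRHS](combination_exp_colsum n k) (bigD1 l) //= lerDl.
by apply: sumr_ge0 => j _; apply: combination_exp_ge0.
Qed.

Lemma combination_exp_gt0D m n i j k :
  0 < (A ^+ m) i j -> 0 < (A ^+ n) j k -> 0 < (A ^+ (m + n)) i k.
Proof.
move=> Aij Ajk; rewrite exprD mxE (bigD1 j) //=.
apply: (lt_le_trans (mulr_gt0 Aij Ajk)); rewrite lerDl.
by apply: sumr_ge0 => l _; rewrite mulr_ge0 ?combination_exp_ge0.
Qed.

Lemma combination_walk l k : exists n, 0 < (A ^+ n) l k.
Proof.
case: hgraph => hconn _; case: hA => _ Apos _.
have [->|lk] := eqVneq l k; first by exists 0%N; rewrite expr0 mxE eqxx.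
have /connectP[p pp ->] := hconn _ _ lk.
elim: p {lk} l pp => [|j p IH] l /=; first by exists 0%N; rewrite expr0 mxE eqxx.
move=> /andP[lj /IH[n An]]; exists (1 + n)%N.
by apply: combination_exp_gt0D An; rewrite expr1 Apos.
Qed.

(** Every pair is joined by a walk through the agent [s] with a self-loop. The exponent adds the
    lengths of all the walks to and from [s], so that it is the same for every pair; the surplus
    length is spent in the loop. *)
Lemma combination_primitive : exists n, forall l k, 0 < (A ^+ n) l k.
Proof.
case: hgraph => _ [s sl]; case: hA => _ Apos _.
have loop n : 0 < (A ^+ n) s s.
  elim: n => [|n IH]; first by rewrite expr0 mxE eqxx.
  by rewrite -addn1; apply: combination_exp_gt0D IH _; rewrite expr1 Apos.
pose a l := projT1 (cid (combination_walk l s)).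
pose b k := projT1 (cid (combination_walk s k)).
have ha l : 0 < (A ^+ a l) l s by rewrite /a; case: cid.
have hb l : 0 < (A ^+ b l) s l by rewrite /b; case: cid.
exists (\sum_l a l + \sum_l b l)%N => l k.
rewrite (bigD1 l) //= [X in (_ + X)%N](bigD1 k) //=.
set x := (\sum_(i < N | i != l) a i)%N; set y := (\sum_(i < N | i != k) b i)%N.
rewrite (_ : (a l + x + (b k + y) = a l + (x + y) + b k)%N); last first.
  by rewrite -!addnA; congr addn; congr addn; rewrite addnC.
by apply: combination_exp_gt0D (hb k); apply: combination_exp_gt0D (ha l) (loop _).
Qed.

(** Doeblin's argument: with [m] the least entry of a positive power (capped at 1), subtracting
    [m * v l] from every entry of row [l] does not change the action on vectors of sum zero, keeps
    the entries nonnegative since [v l 0 <= 1], and lowers the column sums to [1 - m]. *)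
Lemma combination_contraction : exists n (r : R), 0 <= r < 1 /\
  forall x : 'cV[R]_N, \sum_l x l 0 = 0 ->
    \sum_l `|(A ^+ n *m x) l 0| <= r * \sum_l `|x l 0|.
Proof.
case: hv => _ v1 vpos; case: combination_primitive => n An.
case: hgraph => _ [s _].
pose m := \big[Num.min/1]_l \big[Num.min/1]_k (A ^+ n) l k.
have m0 : 0 < m.
  rewrite /m; apply: (big_ind (fun x : R => 0 < x)) => // [x y x0 y0|l _].
    by rewrite lt_min x0.
  by apply: (big_ind (fun x : R => 0 < x)) => // x y x0 y0; rewrite lt_min x0.
have mA l k : m <= (A ^+ n) l k.
  by apply: (bigmin_inf l) => //; exact: (bigmin_inf k).
have vle1 l : v l 0 <= 1.
  by rewrite -v1 (bigD1 l) //= lerDl sumr_ge0 // => j _; exact: ltW.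
have m1 : m <= 1 by apply: bigmin_le_id.
exists n, (1 - m); split; first by rewrite subr_ge0 m1 ltrBlDr ltrDl.
move=> x x0.
pose B : 'M[R]_N := \matrix_(l, k) ((A ^+ n) l k - m * v l 0).
have -> : A ^+ n *m x = B *m x.
  apply/colP => l; rewrite !mxE.
  under [RHS]eq_bigr do rewrite mxE mulrBl.
  by rewrite big_split /= -[LHS]addr0; congr +%R; rewrite sumrN -mulr_sumr x0 mulr0 oppr0.
apply: mulmx_l1_le => [l k|k].
  rewrite mxE subr_ge0; apply: le_trans (mA l k).
  by rewrite ler_piMr // ltW.
under eq_bigr do rewrite mxE.
by rewrite big_split /= combination_exp_colsum sumrN -mulr_sumr v1 mulr1.
Qed.

(** The contraction applies to [x], the difference of the [k]-th basis vector and [v], which has sum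
    zero. Decay along the multiples of [n0] is enough, because the l1 norm never increases under a
    stochastic matrix. *)
Lemma combination_exp_cvg l k : (fun n => (A ^+ n) l k) @ \oo --> v l 0.
Proof.
case: hv => Av v1 _; case: combination_contraction => n0 [r [/andP[r0 r1] hr]].
pose x : 'cV[R]_N := \col_j ((j == k)%:R - v j 0).
have x0 : \sum_j x j 0 = 0.
  under eq_bigr do rewrite mxE.
  rewrite big_split /= sumrN v1 (bigD1 k) //= eqxx big1 ?addr0 ?subrr //.
  by move=> j /negPf ->.
have Anv n : A ^+ n *m v = v.
  elim: n => [|n IH]; first by rewrite expr0 mul1mx.
  by rewrite exprS -mulmxA IH.
have xE n j : (A ^+ n *m x) j 0 = (A ^+ n) j k - v j 0.
  rewrite -[in RHS](Anv n) !mxE -sumrN.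
  rewrite [X in _ = X + _](_ : _ = \sum_i (A ^+ n) j i * (i == k)%:R).
    by rewrite -big_split; apply: eq_bigr => i _; rewrite mxE mulrBr.
  rewrite (bigD1 k) //= eqxx mulr1 big1 ?addr0 // => i /negPf ->.
  by rewrite mulr0.
pose e n := \sum_j `|(A ^+ n *m x) j 0|.
have sum0 n : \sum_j (A ^+ n *m x) j 0 = 0.
  by rewrite (mulmx_colsum _ (combination_exp_colsum n)) x0 mulr0.
have en m n : e (m + n)%N <= e n.
  rewrite /e exprD -mulmxE -mulmxA -[leRHS]mul1r.
  by apply: mulmx_l1_le; [exact: combination_exp_ge0|exact: combination_exp_colsum].
have er m : e (m * n0)%N <= r ^+ m * e 0%N.
  elim: m => [|m IH]; first by rewrite expr0 mul1r.
  rewrite mulSn /e exprD -mulmxE -mulmxA; apply: (le_trans (hr _ (sum0 _))).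
  by rewrite exprS -mulrA ler_wpM2l.
apply/cvgrPdist_le => eps eps0.
have /cvgrPdist_le /(_ _ eps0) : (fun m => r ^+ m * e 0%N) @ \oo --> 0 * e 0%N.
  by apply: cvgMl; apply: cvg_expr; rewrite ger0_norm.
rewrite mul0r => -[M _ /(_ M (leqnn M))] /=; rewrite sub0r normrN => hM.
exists (M * n0)%N => // n /= Mn.
rewrite distrC -xE; apply: (@le_trans _ _ (e n)).
  by rewrite /e (bigD1 l) //= lerDl sumr_ge0.
rewrite -(subnK Mn); apply: (le_trans (en _ _)); apply: (le_trans (er _)).
exact: le_trans (ler_norm _) hM.
Qed.

End Perron.

(** * Convex functions of a real variable *)

Section ConvexReal.
Context {R : realType}.
Implicit Types (F G phi : R -> R).

Definition convex_on_line F := forall a s t, 0 <= a -> a <= 1 ->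
  F (a * s + (1 - a) * t) <= a * F s + (1 - a) * F t.

Lemma convex_on_line_opp F :
  convex_on_line F -> convex_on_line (fun x => F (- x)).
Proof.
move=> cF a s t a0 a1 /=; rewrite (_ : - _ = a * (- s) + (1 - a) * (- t)).
  exact: cF.
by ring.
Qed.

Lemma convex_on_line_sum (I : finType) (F : I -> R -> R) (c : I -> R) :
  (forall i, convex_on_line (F i)) ->
  convex_on_line (fun t => \sum_i F i (c i * t)).
Proof.
move=> cF a s t a0 a1; rewrite !mulr_sumr -big_split; apply: ler_sum => i _ /=.
rewrite (_ : c i * _ = a * (c i * s) + (1 - a) * (c i * t)); last by ring.
exact: cF.
Qed.

Lemma convex_between F s m t : convex_on_line F -> s < m -> m < t ->
  (t - s) * F m <= (t - m) * F s + (m - s) * F t.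
Proof.
move=> cF sm mt; have st : 0 < t - s by lra.
have := cF ((t - m) / (t - s)) s t.
rewrite (_ : _ * s + _ = m); last by field; rewrite gt_eqF.
rewrite divr_ge0 ?ler_pdivrMr ?mul1r; [|lra..].
have -> : t - m <= t - s by lra.
move=> /(_ isT isT) h; rewrite -ler_pdivlMl //; apply: (le_trans h).
rewrite le_eqVlt; apply/orP; left; apply/eqP; field; rewrite gt_eqF //.
Qed.

(** The endpoints bound [F] from above; reflection then bounds it from below, as
    [2 * F 0 <= F s + F (- s)]. *)
Lemma convex_bounded F (T : R) : convex_on_line F -> 0 < T ->
  exists2 B, 0 <= B & forall s, - T <= s <= T -> `|F s| <= B.
Proof.
move=> cF T0.
exists (`|F T| + `|F (- T)| + 2 * `|F 0|) => [|s /andP[s1 s2]].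
  by rewrite !addr_ge0 ?mulr_ge0.
have up x : - T <= x <= T -> F x <= `|F T| + `|F (- T)|.
  move=> /andP[x1 x2].
  have hT := ler_norm (F T); have hT' := ler_norm (F (-T)).
  have h0 := normr_ge0 (F T); have h0' := normr_ge0 (F (-T)).
  have := cF ((T - x) / (2 * T)) (- T) T.
  have TT : 0 < 2 * T by lra.
  rewrite (_ : _ * (-T) + _ = x); last by field; rewrite gt_eqF.
  rewrite divr_ge0 ?ler_pdivrMr ?mul1r; [|lra..].
  have -> : T - x <= 2 * T by lra.
  set a := (T - x) / (2 * T).
  have a0 : 0 <= a by apply: divr_ge0; lra.
  have a1 : a <= 1 by rewrite ler_pdivrMr //; lra.
  move=> /(_ isT isT) h; apply: (le_trans h).
  have := ler_piMl h0' a1; have := ler_wpM2l a0 hT'.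
  have a2 : 0 <= 1 - a by lra.
  have a3 : 1 - a <= 1 by lra.
  have := ler_piMl h0 a3; have := ler_wpM2l a2 hT; lra.
have u1 : F s <= _ := up s _; have u2 : F (-s) <= _ := up (- s) _.
have {}u1 := u1 ltac:(apply/andP; split; lra).
have {}u2 := u2 ltac:(apply/andP; split; lra).
have := cF 2^-1 s (- s) ltac:(lra) ltac:(lra).
rewrite (_ : _ * s + _ = 0); last by field.
have := ler_norm (F 0); have := ler_norm (- F 0); rewrite normrN.
rewrite ler_norml => h1 h2 h3; apply/andP; split; lra.
Qed.

(** The slope from [s] to [u] is at most the slope from [s] to [T + 1], a chord of length at least 1
    whose ends take values in [[- B, B]]. The opposite bound is the same one for the reflected
    function. *)
Lemma convex_lipschitz F (T : R) : convex_on_line F -> 0 < T ->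
  exists2 C, 0 <= C & forall s u, - T <= s <= T -> - T <= u <= T ->
    `|F s - F u| <= C * `|s - u|.
Proof.
move=> cF T0; have T1 : 0 < T + 1 by lra.
have [B B0 hB] := convex_bounded cF T1.
have half G : convex_on_line G -> (forall s, - (T+1) <= s <= T + 1 -> `|G s| <= B) ->
    forall s u, - T <= s <= T -> - T <= u <= T -> s < u ->
    G u - G s <= 2 * B * (u - s).
  move=> cG hG s u /andP[s1 s2] /andP[u1 u2] su.
  have uT : u < T + 1 by lra.
  have := convex_between cG su uT.
  have := hG s ltac:(apply/andP; split; lra); rewrite ler_norml => /andP[_ g1].
  have := hG s ltac:(apply/andP; split; lra); rewrite ler_norml => /andP[g1' _].
  have := hG (T + 1) ltac:(apply/andP; split; lra).
  rewrite ler_norml => /andP[_ g2] h.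
  have {}h : (T + 1 - s) * (G u - G s) <= (u - s) * (G (T + 1) - G s).
    apply: le_trans (_ : _ <= (T + 1 - u) * G s + (u - s) * G (T + 1) - (T + 1 - s) * G s) _; lra.
  have us : 0 <= u - s by lra.
  have [gu|gu] := leP (G u) (G s).
    by apply: (@le_trans _ _ 0); [lra|rewrite !mulr_ge0].
  have d0 : 0 <= G u - G s by lra.
  have : 1 * (G u - G s) <= (T + 1 - s) * (G u - G s) by apply: ler_wpM2r; lra.
  have : (u - s) * (G (T + 1) - G s) <= (u - s) * (2 * B) by apply: ler_wpM2l; lra.
  by lra.
exists (2 * B) => [|s u]; first by rewrite mulr_ge0.
have hN s' : - (T + 1) <= s' <= T + 1 -> `|F (- s')| <= B.
  by move=> h; apply: hB; lra.
wlog su : s u / s <= u => [hw s1 u1|].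
  have [su|us] := leP s u; first exact: hw.
  by rewrite distrC (distrC s); apply: hw => //; exact: ltW.
move: su; rewrite le_eqVlt => /predU1P[->|su] s1 u1; first by rewrite !subrr !normr0 mulr0.
have h1 := half _ cF hB _ _ s1 u1 su.
have := half _ (convex_on_line_opp cF) hN (- u) (- s) ltac:(lra) ltac:(lra) ltac:(lra).
rewrite !opprK => h2.
rewrite (distrC s) (gtr0_norm (_ : 0 < u - s)); last by lra.
by rewrite ler_norml; apply/andP; split; lra.
Qed.

Lemma convex_slope_nondecr F s u : convex_on_line F -> F 0 = 0 ->
  s <= u -> u < 0 -> F s / s <= F u / u.
Proof.
move=> cF F0; rewrite le_eqVlt => /predU1P[->//|su u0].
have := convex_between cF su u0; rewrite F0 mulr0 addr0 !sub0r => h.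
have s0 : s < 0 by lra.
by rewrite ler_ndivrMr // mulrAC ler_ndivrMr //; lra.
Qed.

(** * Abel means and Riemann sums on a geometric grid *)

Lemma abel_geometric_sum_le (delta : R) n : 0 < delta -> delta <= 1 ->
  delta * \sum_(m < n) (1 - delta) ^+ m = 1 - (1 - delta) ^+ n.
Proof.
move=> d0 d1; elim: n => [|n IH]; first by rewrite big_ord0 expr0 mulr0 subrr.
rewrite big_ord_recr /= mulrDr IH exprS; ring.
Qed.

(** Regularity of Abel summation, uniformly in the truncation [n]: the first [M] terms weigh at most
    [delta * M * B], and the later ones, below [eps / 2], have total weight at most 1. *)
Lemma abel_mean_small (e : R ^nat) (B eps : R) :
  (forall m, 0 <= e m <= B) -> e @ \oo --> 0 -> 0 < eps ->
  \forall delta \near (0 : R)^'+, forall n,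
    delta * \sum_(m < n) (1 - delta) ^+ m * e m <= eps.
Proof.
move=> eB /cvgrPdist_le e0 eps0.
have eps2 : 0 < eps / 2 by lra.
have [M _ hM] := e0 _ eps2.
have B0 : 0 <= B by have /andP[] := eB 0%N; apply: le_trans.
pose d0 := (eps / 2) / (M%:R * B + 1).
have MB : 0 < M%:R * B + 1 by rewrite ltr_wpDl // mulr_ge0.
have d0p : 0 < d0 by rewrite divr_gt0.
near=> delta => n.
have dp : 0 < delta by near: delta; exact: nbhs_right_gt.
have d1 : delta <= 1 by near: delta; apply: nbhs_right_le.
have dd : delta <= d0 by near: delta; apply: nbhs_right_le.
have pw m : 0 <= (1 - delta) ^+ m <= 1.
  by rewrite exprn_ge0 ?exprn_ile1 //; lra.
have bnd m : (1 - delta) ^+ m * e m <= (m < M)%:R * B + (1 - delta) ^+ m * (eps / 2).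
  have /andP[p0 p1] := pw m; have /andP[em0 emB] := eB m.
  have [mM|Mm] := ltnP m M.
    apply: (@le_trans _ _ B); last by rewrite mul1r lerDl mulr_ge0 // ltW.
    by apply: le_trans emB; rewrite ler_piMl.
  rewrite mul0r add0r ler_wpM2l //.
  by have := hM m Mm; rewrite sub0r normrN ger0_norm.
apply: (@le_trans _ _ (delta * (\sum_(m < n) (m < M)%:R * B +
    \sum_(m < n) (1 - delta) ^+ m * (eps / 2)))).
  by rewrite ler_pM2l // -big_split; apply: ler_sum => m _; exact: bnd.
rewrite mulrDr -mulr_suml -mulr_suml [X in _ + X]mulrA abel_geometric_sum_le //.
have h1 : \sum_(m < n) (m < M)%:R <= M%:R :> R.
  rewrite -natr_sum ler_nat -(big_mkord xpredT (fun m => nat_of_bool (m < M)%N)).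
  apply: (@leq_trans (\sum_(0 <= m < n + M) (m < M)%N)%N).
    by rewrite [leqRHS](big_cat_nat _ (n := n)) //= ?leq_addr // leq_addr.
  rewrite (big_cat_nat _ (n := M)) ?leq_addl //= [X in (_ + X)%N]big_nat_cond.
  rewrite [X in (_ + X)%N]big1 ?addn0; last first.
    by move=> i /andP[/andP[Mi _] _]; rewrite ltnNge Mi.
  rewrite big_nat_cond (eq_bigr (fun=> 1%N)); last first.
    by move=> i /andP[/andP[_ ->]].
  by rewrite -big_nat_cond sum_nat_const_nat subn0 muln1.
have h2 : delta * (M%:R * B) <= eps / 2.
  apply: (@le_trans _ _ (d0 * (M%:R * B))).
    by rewrite ler_wpM2r // mulr_ge0.
  rewrite /d0 mulrAC ler_pdivrMr // ler_pM2l //; lra.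
have h3 : delta * ((\sum_(m < n) (m < M)%:R) * B) <= eps / 2.
  by apply: le_trans h2; rewrite ler_pM2l // ler_wpM2r.
have /andP[h4 h5] := pw n.
have : (1 - (1 - delta) ^+ n) * (eps / 2) <= eps / 2.
  by rewrite ler_piMl; lra.
lra.
Unshelve. all: end_near. Qed.

(** For [tau m = (1 - delta) ^+ m * t] the mesh is [- delta * tau m], so [delta * F (tau m)] is
    minus a left-endpoint term for the slope [G s = F s / s]. Since [G] is nondecreasing, the sum
    errs on one side only, and its error telescopes: mesh at most [delta * |t|] times a total
    increase of [G] of at most [2 * C]. *)
Lemma abel_riemann_sum F phi C t :
  convex_on_line F -> F 0 = 0 -> t < 0 ->
  (forall s, t <= s < 0 -> `|F s| <= C * `|s|) ->
  (forall s u, s < u -> u < 0 ->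
    F s / s * (u - s) <= phi u - phi s <= F u / u * (u - s)) ->
  forall delta n, 0 < delta -> delta < 1 ->
  phi t - phi ((1 - delta) ^+ n * t) <=
    delta * \sum_(m < n) F ((1 - delta) ^+ m * t) <=
  phi t - phi ((1 - delta) ^+ n * t) + delta * (2 * C * `|t|).
Proof.
move=> cF F0 t0 hC hphi delta n d0 d1.
pose tau m := (1 - delta) ^+ m * t.
have p0 m : 0 < (1 - delta) ^+ m by rewrite exprn_gt0 // subr_gt0.
have p1 m : (1 - delta) ^+ m <= 1 by rewrite exprn_ile1 //; lra.
have tau0 m : tau m < 0 by rewrite /tau pmulr_rlt0.
have taut m : t <= tau m by rewrite /tau; have := p1 m; nra.
have tauS m : tau m.+1 - tau m = - delta * tau m by rewrite /tau exprS; ring.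
have tauI m : tau m < tau m.+1 by rewrite -subr_gt0 tauS; have := tau0 m; nra.
pose G s := F s / s.
have GF m : delta * F (tau m) = - (G (tau m) * (tau m.+1 - tau m)).
  by rewrite tauS /G; field; rewrite lt_eqF.
have G1 m : - C <= G (tau m) <= C.
  rewrite -ler_norml /G normrM normfV ler_pdivrMr ?normr_gt0 ?lt_eqF //.
  by apply: hC; rewrite taut tau0.
have dG m : G (tau m) <= G (tau m.+1).
  by apply: convex_slope_nondecr => //; exact: ltW.
have tele (f : nat -> R) k : \sum_(m < k) (f m.+1 - f m) = f k - f 0%N.
  by rewrite -(big_mkord xpredT (fun m => f m.+1 - f m)) telescope_sumr.
rewrite mulr_sumr.
have e0 : t = tau 0%N by rewrite /tau expr0 mul1r.
have -> : phi t - phi (tau n) = \sum_(m < n) - (phi (tau m.+1) - phi (tau m)).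
  by rewrite sumrN (tele (phi \o tau)) /= -e0 opprB.
apply/andP; split.
  apply: ler_sum => m _; rewrite GF lerN2.
  by have /andP[] := hphi _ _ (tauI m) (tau0 m.+1).
apply: (@le_trans _ _ (\sum_(m < n) (- (phi (tau m.+1) - phi (tau m)) +
   delta * `|t| * (G (tau m.+1) - G (tau m))))).
  apply: ler_sum => m _; rewrite GF.
  have /andP[_ h] := hphi _ _ (tauI m) (tau0 m.+1); rewrite -/(G _) in h.
  have : (G (tau m.+1) - G (tau m)) * (tau m.+1 - tau m) <=
      (G (tau m.+1) - G (tau m)) * (delta * `|t|).
    apply: ler_wpM2l; first by have := dG m; lra.
    rewrite tauS (ltr0_norm t0); have := taut m; nra.
  lra.
rewrite big_split /= lerD2l -mulr_sumr (tele (G \o tau)) /=.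
rewrite mulrA -[in leRHS]mulrA [in leRHS]mulrAC -!mulrA; rewrite ler_pM2l //.
have := G1 n; have := G1 0%N; have := normr_ge0 t.
move=> q0 /andP[q1 _] /andP[_ q2].
rewrite [leRHS](_ : _ = `|t| * (2 * C)); last by ring.
by apply: ler_wpM2l => //; lra.
Qed.

(** * The negative zero of a convex function and the antiderivative of its slope *)

Lemma convex_continuous F : convex_on_line F -> continuous F.
Proof.
move=> cF x.
have T0 : 0 < `|x| + 1 by rewrite ltr_wpDl.
have [C C0 hC] := convex_lipschitz cF T0.
apply/cvgrPdist_le => eps eps0.
near=> y.
have xy1 : `|x - y| <= 1.
  by near: y; apply: cvgr_dist_le => //; exact: cvg_id.
have xy2 : `|x - y| <= eps / (C + 1).
  near: y; apply: cvgr_dist_le; first exact: cvg_id.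
  by rewrite divr_gt0 // ltr_wpDl.
apply: (@le_trans _ _ (C * `|x - y|)).
  apply: hC; rewrite -ler_norml; first by rewrite lerDl.
  by have := ler_normB x (x - y); rewrite opprB addrC subrK; lra.
move: xy2; rewrite ler_pdivlMr ?ltr_wpDl // => xy2.
have := normr_ge0 (x - y); lra.
Unshelve. all: end_near. Qed.

(** Convexity makes [F] nonpositive between [u] and 0, which forces [s < u]; the zero is then found
    on [[s, u]], and chords through it fix the signs on both sides. *)
Lemma convex_negative_root F u s : convex_on_line F -> F 0 = 0 ->
  u < 0 -> F u < 0 -> s < 0 -> 0 < F s ->
  exists ts, [/\ ts < 0, F ts = 0, forall t, t < ts -> 0 < F t
    & forall t, ts < t -> t < 0 -> F t <= 0].
Proof.
move=> cF F0 u0 Fu s0 Fs.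
have su : s < u.
  rewrite ltNge; apply/negP; rewrite le_eqVlt => /predU1P[us|us].
    by move: Fs; rewrite -us; lra.
  by have := convex_between cF us s0; rewrite F0; nra.
have [ts] : exists2 c, c \in `[s, u] & F c = 0.
  apply: IVT; first exact: ltW.
    exact/continuous_subspaceT/convex_continuous.
  by rewrite ge_min le_max (ltW Fu) (ltW Fs) orbT.
rewrite in_itv /= => /andP[sts tsu] Fts.
have tsu' : ts < u.
  by rewrite lt_neqAle tsu andbT; apply/eqP => e; move: Fu; rewrite -e Fts ltxx.
exists ts; split => //; first by lra.
- by move=> t tts; have := convex_between cF tts tsu'; rewrite Fts; nra.
- by move=> t tst t0; have := convex_between cF tst t0; rewrite F0 Fts; nra.
Qed.

Section AntiderivativeOfSlope.
Variables (F phi : R -> R).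
Hypotheses (cF : convex_on_line F) (F0 : F 0 = 0).
Hypothesis hphi : forall s u, s < u -> u < 0 ->
  F s / s * (u - s) <= phi u - phi s <= F u / u * (u - s).
Variable ts : R.
Hypotheses (ts0 : ts < 0) (Fts : F ts = 0).

Lemma slope_antiderivative_min t : t < 0 -> phi ts <= phi t.
Proof.
move=> t0; have [tts|tst|->//] := ltgtP t ts.
- by have /andP[_] := hphi tts ts0; rewrite Fts !mul0r subr_le0.
- by have /andP[+ _] := hphi tst t0; rewrite Fts !mul0r subr_ge0.
Qed.

(* [t] is slightly below the minimizer [ts], and [a] is slightly below the
   derivative of [phi] at [t]. *)
Lemma slope_antiderivative_tilt eps : (forall t, t < ts -> 0 < F t) -> 0 < eps ->
  exists t h a, [/\ 0 < h, t + h < 0, phi (t + h) < phi t,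
    h * a + phi (t - h) < phi t & phi ts - eps <= phi t - t * a].
Proof.
move=> Fpos eps0; have tsN := ts0.
have T0 : 0 < 1 - ts by lra.
have [C C0 hC] := convex_lipschitz cF T0.
(* The bound [1 / 3] keeps [ts - 3 * h] where the Lipschitz constant [C] is valid; the other bound
   yields [t * a <= 2 * F (ts - 3 * h) <= 6 * C * h <= eps]. *)
pose h := Num.min (1 / 3) (eps / (6 * C + 1)).
have C6 : 0 < 6 * C + 1 by lra.
have h0 : 0 < h by rewrite lt_min divr_gt0 //= divr_gt0.
have h1 : 3 * h <= 1.
  have : h <= 1 / 3 by rewrite ge_min lexx.
  by lra.
have h2 : 6 * C * h <= eps.
  have : h <= eps / (6 * C + 1) by rewrite ge_min lexx orbT.
  by rewrite ler_pdivlMr //; nra.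
have slope t : t < ts -> F t / t < 0.
  by move=> tts; rewrite pmulr_rlt0 ?Fpos // invr_lt0; lra.
(* The slope at [ts - 3 * h] is negative and, times [h], bounds [phi t - phi (t - h)] from below;
   doubling it makes the inequality with [a] strict. *)
exists (ts - 2 * h), h, (2 * (F (ts - 3 * h) / (ts - 3 * h))).
have e1 : ts - 2 * h + h = ts - h by ring.
have e2 : ts - 2 * h - h = ts - 3 * h by ring.
rewrite e1 e2; split => //; first by lra.
- have /andP[_ hh] := @hphi (ts - 2 * h) (ts - h) ltac:(lra) ltac:(lra).
  have := slope (ts - h) ltac:(lra); move: hh.
  rewrite (_ : ts - h - _ = h); last by ring.
  by set g := F _ / _ => hh g0; have := nmulr_rlt0 h g0; rewrite h0; lra.
- have /andP[hh _] := @hphi (ts - 3 * h) (ts - 2 * h) ltac:(lra) ltac:(lra).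
  have := slope (ts - 3 * h) ltac:(lra).
  move: hh; rewrite (_ : ts - 2 * h - _ = h); last by ring.
  set g := F _ / _ => hh g0; have : h * g < 0 by rewrite pmulr_rlt0.
  by lra.
- have := @slope_antiderivative_min (ts - 2 * h) ltac:(lra).
  suff : (ts - 2 * h) * (2 * (F (ts - 3 * h) / (ts - 3 * h))) <= eps by lra.
  have := Fpos (ts - 3 * h) ltac:(lra).
  have := hC (ts - 3 * h) ts ltac:(lra) ltac:(lra).
  rewrite Fts subr0 (_ : ts - 3 * h - ts = - (3 * h)); last by ring.
  rewrite normrN (gtr0_norm (_ : 0 < 3 * h)); last by lra.
  move=> hF Fp; rewrite (gtr0_norm Fp) in hF.
  apply: (@le_trans _ _ (2 * F (ts - 3 * h))); last by lra.
  rewrite (_ : _ * _ = (ts - 2 * h) / (ts - 3 * h) * (2 * F (ts - 3 * h))); last first.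
    by field; rewrite lt_eqF //; lra.
  rewrite ler_piMl //; first by lra.
  by rewrite ler_ndivrMr; lra.
Qed.

End AntiderivativeOfSlope.

End ConvexReal.

(** * Integrals and independence *)

Section Transfer.
Import HBNNSimple.
Local Open Scope ereal_scope.
Context {R : realType}.

(** In the limit on the right, [Y] and [W] occur only through the integrals of [W] over preimages
    under [Y]: the left side depends on nothing but the image under [Y] of the measure with density
    [W]. *)
Lemma ge0_integral_comp_mul_approx d (S : measurableType d) (m : {measure set S -> \bar R})
    d' (T : measurableType d') (Y : S -> T) (W : S -> R) (g : T -> \bar R)
    (mg : measurable_fun [set: T] g) :
  measurable_fun [set: S] Y -> measurable_fun [set: S] W ->
  (forall x, 0 <= W x)%R -> (forall x, 0 <= g x) ->
  let h := nnsfun_approx measurableT mg in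
  \int[m]_x (g (Y x) * (W x)%:E) =
  lim ((\sum_(r \in range (h n))
    (r%:E * \int[m]_(x in Y @^-1` (h n @^-1` [set r])) (W x)%:E)) @[n --> \oo]).
Proof.
move=> mY mW W0 g0 h.
have mEW : measurable_fun [set: S] (EFin \o W) by exact/measurable_EFinP.
have -> : \int[m]_x (g (Y x) * (W x)%:E) =
    lim (\int[m]_x ((EFin \o h n) (Y x) * (W x)%:E) @[n --> \oo]).
  have fg x : g (Y x) * (W x)%:E = lim (((EFin \o h n) (Y x) * (W x)%:E) @[n --> \oo]).
    apply/esym/cvg_lim => //; apply: cvgeZr => //.
    by apply: cvg_nnsfun_approx.
  under eq_integral do rewrite fg.
  apply: monotone_convergence => [//| | |].
  - move=> n; apply/emeasurable_funM => //; apply/measurable_EFinP.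
    exact: measurableT_comp.
  - by move=> n x _ /=; rewrite mule_ge0 ?lee_fin.
  - move=> x _ a b ab/=; rewrite lee_wpmul2r ?lee_fin//.
    exact/lefP/nd_nnsfun_approx.
congr (lim (_ @ \oo)); apply/funext => n.
have mi r : measurable_fun [set: T] (\1_(h n @^-1` [set r]) : T -> R).
  exact: measurable_indic.
have indich r : measurable_fun [set: S] (fun x => (r * \1_(h n @^-1` [set r]) (Y x))%:E).
  apply/measurable_EFinP; apply: measurable_funM => //.
  exact: (measurableT_comp (mi r) mY).
transitivity (\int[m]_x (\sum_(y \in range (h n))
    (y * \1_(h n @^-1` [set y]) (Y x))%:E * (W x)%:E)).
  apply: eq_integral => x _.
  rewrite -ge0_mule_fsuml => [|y]; last exact: nnfun_muleindic_ge0.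
  by rewrite fsumEFin // -(fimfunE _ (Y x)).
rewrite ge0_integral_fsum//; last 2 first.
  - by move=> y; apply: emeasurable_funM.
  - by move=> i x _; rewrite mule_ge0 ?lee_fin // ; exact: nnfun_muleindic_ge0.
apply: eq_fsbigr => r rhn.
under eq_integral do rewrite EFinM -muleA.
rewrite ge0_integralZl//; last 3 first.
- apply: emeasurable_funM => //; apply/measurable_EFinP.
  exact: (measurableT_comp (mi r) mY).
- by move=> x _; rewrite mule_ge0 ?lee_fin.
- by move: rhn; rewrite inE => -[t _ <-]; rewrite lee_fin.
congr (_ * _); rewrite [RHS]integral_mkcond; apply: eq_integral => x _.
rewrite patchE indicE; case: (boolP (Y x \in _)) => hx.
  rewrite mul1e ifT //; move: hx; rewrite !inE //.
rewrite mul0e ifF //; apply/negbTE; apply: contra hx; rewrite !inE //.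
Qed.

(** This serves three times: to factor an expectation (one space, [W1] the product of the other
    factors, [W2] a constant), to identify the laws of the signals at different times (both weights
    1), and to pass from [P] to the density [f] (weights 1 and [f]). *)
Lemma ge0_integral_transfer
    d1 (S1 : measurableType d1) (m1 : {measure set S1 -> \bar R})
    d2 (S2 : measurableType d2) (m2 : {measure set S2 -> \bar R})
    d (T : measurableType d) (Y1 : S1 -> T) (Y2 : S2 -> T)
    (W1 : S1 -> R) (W2 : S2 -> R) (g : T -> \bar R) :
  measurable_fun [set: S1] Y1 -> measurable_fun [set: S2] Y2 ->
  measurable_fun [set: S1] W1 -> measurable_fun [set: S2] W2 ->
  (forall x, 0 <= W1 x)%R -> (forall x, 0 <= W2 x)%R ->
  (forall B, measurable B ->
     \int[m1]_(x in Y1 @^-1` B) (W1 x)%:E = \int[m2]_(x in Y2 @^-1` B) (W2 x)%:E) ->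
  measurable_fun [set: T] g -> (forall x, 0 <= g x) ->
  \int[m1]_x (g (Y1 x) * (W1 x)%:E) = \int[m2]_x (g (Y2 x) * (W2 x)%:E).
Proof.
move=> mY1 mY2 mW1 mW2 W10 W20 h mg g0.
rewrite !(ge0_integral_comp_mul_approx _ mg) //.
congr (lim (_ @ \oo)); apply/funext => n; apply: eq_fsbigr => r _.
by rewrite h.
Qed.

End Transfer.

Section IndependentProduct.
Context {R : realType} d (Omega : measurableType d) (P : probability Omega R).
Context (I : choiceType) (D : I -> Prop).
Context (d' : I -> measure_display) (T : forall j, measurableType (d' j)).
Variables (Y : forall j, Omega -> T j) (g : forall j, T j -> R).
Arguments Y : clear implicits.
Arguments g : clear implicits.
Hypothesis indY : mutually_independent P D Y.
Hypothesis mY : forall j, D j -> measurable_fun [set: Omega] (Y j).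
Hypothesis mg : forall j, measurable_fun [set: T j] (g j).
Hypothesis g0 : forall j x, 0 <= g j x.
Hypothesis gfin : forall j, D j -> (\int[P]_w (g j (Y j w))%:E < +oo)%E.

Let cyl (J : seq I) (B : forall j, set (T j)) :=
  \bigcap_(j in [set` J]) (Y j @^-1` B j).

Let cyl_cons j J B : cyl (j :: J) B = Y j @^-1` B j `&` cyl J B.
Proof. by rewrite /cyl !bigcap_seq big_cons. Qed.

Let cyl_measurable J B : (forall j, j \in J -> D j) ->
  (forall j, measurable (B j)) -> measurable (cyl J B).
Proof.
move=> JD mB; apply: fin_bigcap_measurable => // j /JD Dj.
by rewrite -[X in measurable X]setTI; apply: mY.
Qed.

Lemma independent_expectation_prod_cyl J1 J2 (B : forall j, set (T j)) :
  uniq (J1 ++ J2) -> (forall j, j \in J1 ++ J2 -> D j) ->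
  (forall j, measurable (B j)) ->
  (\int[P]_w ((\prod_(j <- J1) g j (Y j w)) * \1_(cyl J2 B) w)%:E =
   (\prod_(j <- J1) fine (\int[P]_w (g j (Y j w))%:E) * fine (P (cyl J2 B)))%:E)%E.
Proof.
elim: J1 J2 B => [|j J1 IH] J2 B uJ JD mB.
  have mC : measurable (cyl J2 B) by exact: cyl_measurable.
  rewrite big_nil mul1r fineK ?fin_num_measure //.
  under eq_integral do rewrite big_nil mul1r.
  by rewrite integral_indic // setIT.
have [Dj jJ1 jJ2] : [/\ D j, j \notin J1 & j \notin J2].
  move: uJ => /= /andP[]; rewrite mem_cat negb_or => /andP[-> ->] _.
  by split => //; apply: JD; rewrite mem_head.
have D1 i : i \in J1 -> D i.
  by move=> iJ; apply: JD; rewrite inE mem_cat iJ orbT.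
have D2 i : i \in J2 -> D i.
  by move=> iJ; apply: JD; rewrite inE mem_cat iJ !orbT.
have mC : measurable (cyl J2 B) by exact: cyl_measurable.
pose W w := (\prod_(i <- J1) g i (Y i w)) * \1_(cyl J2 B) w.
pose c := \prod_(i <- J1) fine (\int[P]_w (g i (Y i w))%:E)%E * fine (P (cyl J2 B)).
have c0 : 0 <= c.
  rewrite /c mulr_ge0 ?fine_ge0 // prodr_ge0 // => i _.
  by rewrite fine_ge0 // integral_ge0 // => x _; rewrite lee_fin.
have mgY i : D i -> measurable_fun [set: Omega] (fun w => g i (Y i w)).
  by move=> Di; exact: (measurableT_comp (@mg i) (mY Di)).
have mW : measurable_fun [set: Omega] W.
  apply: measurable_funM; last exact: measurable_indic.
  by apply: measurable_prod => i iJ; exact: mgY (D1 _ iJ).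
have W0 w : 0 <= W w by rewrite mulr_ge0 // prodr_ge0.
have key A : measurable A ->
    (\int[P]_(w in Y j @^-1` A) (W w)%:E = \int[P]_(w in Y j @^-1` A) c%:E)%E.
  move=> mA; have mYA : measurable (Y j @^-1` A).
    by rewrite -[X in measurable X]setTI; apply: mY.
  rewrite integral_cst // integral_mkcond.
  (* As [j] is not in [J2], changing the set at [j] to [A] leaves the cylinder over [J2]
     unchanged. *)
  pose B' : forall i, set (T i) := eqtype.dfwith B A.
  have B'j : B' j = A by rewrite /B' dfwith_in.
  have B'i i : i != j -> B' i = B i.
    by move=> ij; rewrite /B' eqtype.dfwith_out // eq_sym.
  have mB' i : measurable (B' i).
    by have [->|/B'i ->//] := eqVneq i j; rewrite B'j.
  have cJ2 : cyl J2 B' = cyl J2 B.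
    apply: eq_bigcapr => i /= iJ; rewrite B'i //.
    by apply: contraNneq jJ2 => <-.
  transitivity (\int[P]_w ((\prod_(i <- J1) g i (Y i w)) * \1_(cyl (j :: J2) B') w)%:E)%E.
    apply: eq_integral => w _; rewrite cyl_cons cJ2 B'j indicI /W patchE /=.
    rewrite (_ : \1_(Y j @^-1` A) w = (w \in Y j @^-1` A)%:R); last by rewrite indicE.
    case: (w \in _); first by rewrite mul1r.
    by rewrite mul0r mulr0.
  rewrite IH //; first last.
  - by move=> i; rewrite mem_cat inE => h; apply: JD; rewrite inE mem_cat orbCA.
  - by rewrite (uniq_catCA J1 [:: j] J2).
  have -> : P (cyl (j :: J2) B') = (P (Y j @^-1` A) * P (cyl J2 B))%E.
    rewrite indY //; first last.
    - by move=> i; rewrite inE => /predU1P[->//|/D2].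
    - by move: uJ => /= /andP[_]; rewrite cat_uniq => /and3P[_ _ ->]; rewrite jJ2.
    rewrite big_cons B'j -cJ2 indY //.
    by move: uJ => /= /andP[_]; rewrite cat_uniq => /and3P[].
  by rewrite fineM ?fin_num_measure // !EFinM !fineK ?fin_num_measure // muleCA muleC.
have mgj : measurable_fun [set: T j] (EFin \o g j) by exact/measurable_EFinP.
have gj0 x : (0 <= (EFin \o g j) x)%E by rewrite lee_fin.
have h := ge0_integral_transfer (mY Dj) (mY Dj) mW (measurable_cst c) W0
  (fun=> c0) key mgj gj0.
under eq_integral do rewrite big_cons -mulrA EFinM.
rewrite [LHS]h.
have gf : (\int[P]_w (g j (Y j w))%:E)%E \is a fin_num.
  by rewrite ge0_fin_numE ?gfin // integral_ge0 // => x _; rewrite lee_fin.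
transitivity (\int[P]_w ((g j (Y j w))%:E * c%:E))%E; first by [].
rewrite ge0_integralZr //.
- by rewrite big_cons -mulrA EFinM fineK.
- by apply/measurable_EFinP; exact: mgY.
- by move=> x _; rewrite lee_fin.
Qed.

Lemma independent_expectation_prod J : uniq J -> (forall j, j \in J -> D j) ->
  (\int[P]_w (\prod_(j <- J) g j (Y j w))%:E =
   (\prod_(j <- J) fine (\int[P]_w (g j (Y j w))%:E))%:E)%E.
Proof.
move=> uJ JD; have := @independent_expectation_prod_cyl J [::] (fun=> setT).
rewrite cats0 => /(_ uJ JD (fun j => measurableT)).
have -> : cyl [::] (fun=> setT) = setT by rewrite /cyl set_nil bigcap_set0.
rewrite probability_setT /= mulr1 => <-.
by apply: eq_integral => w _; rewrite indicT mulr1.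
Qed.

End IndependentProduct.

(** * Sums over an array of independent rows *)

Section MeasurableLimit.
Context {R : realType} d (Omega : measurableType d).

Lemma cvgn_cauchyP (u : R ^nat) : cvgn u <->
  forall j, exists N, forall n, `|u (N + n)%N - u N| <= j.+1%:R^-1.
Proof.
split => [/cvg_ex[l /cvgrPdist_le ul] j|H].
  have e0 : (0 : R) < j.+1%:R^-1 / 2 by rewrite divr_gt0.
  have [N _ hN] := ul _ e0; exists N => n.
  have h1 := hN (N + n)%N (leq_addr _ _); have h2 := hN N (leqnn N).
  rewrite (_ : _ - _ = (l - u N) - (l - u (N + n)%N)); last by ring.
  by apply: (le_trans (ler_normB _ _)); rewrite [leRHS]splitr lerD.
apply/cauchy_cvgP; apply: cauchy_exP => e e0.
have [j hj] : exists j : nat, j.+1%:R^-1 < e.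
  have := near_infty_natSinv_lt (PosNum e0) => -[j _ /(_ j (leqnn j))] /= hj.
  by exists j.
have [N hN] := H j; exists (u N); exists N => // n /= Nn.
rewrite /ball /= distrC; apply: le_lt_trans hj.
by have := hN (n - N)%N; rewrite subnKC.
Qed.

(** [limn] is a total function, so the divergence set counts as well: there it is the constant
    [point]. The convergence set is measurable because the Cauchy criterion, in the form of
    [cvgn_cauchyP], involves countable unions and intersections only. *)
Lemma measurable_fun_limn (h : nat -> Omega -> R) :
  (forall n, measurable_fun [set: Omega] (h n)) ->
  measurable_fun [set: Omega] (fun w => limn (h ^~ w)).
Proof.
move=> mh; pose C := [set w | cvgn (h ^~ w)].
have CE : C = \bigcap_j \bigcup_N \bigcap_n
    [set w | `|h (N + n)%N w - h N w| <= j.+1%:R^-1].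
  apply/seteqP; split => w /=.
    by move=> /cvgn_cauchyP Hw j _; have [N HN] := Hw j; exists N => // n _; exact: HN.
  move=> Hw; apply/cvgn_cauchyP => j; have [N _ HN] := Hw j I.
  by exists N => n; exact: HN.
have mC : measurable C.
  rewrite CE; apply: bigcapT_measurable => j; apply: bigcupT_measurable => N.
  apply: bigcapT_measurable => n.
  rewrite -[X in measurable X]setTI.
  apply: (measurable_fun_le (f := fun w => `|h (N + n)%N w - h N w|) (g := cst j.+1%:R^-1)) => //.
  apply: measurableT_comp => //; exact: measurable_funB.
rewrite -(setUv C); apply/measurable_funU => //; first exact: measurableC.
split.
  apply: (measurable_fun_cvg (h := h)) => [m|x Cx]; last exact: Cx.
  exact: measurable_funTS.
apply: (eq_measurable_fun (cst point)) => [x|]; last exact: measurable_cst.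
by rewrite inE => nCx /=; rewrite dvgP.
Qed.

End MeasurableLimit.

Section IidRows.
Context {R : realType} d (Omega : measurableType d) (P : probability Omega R).
Context {N : nat}.
Implicit Types X : 'I_N -> nat -> Omega -> R.

(** Independence and equality of laws are expressed through integrals of nonnegative functions, so
    that they pass directly to absolute values and to positive and negative parts. The law may vary
    with the row [l] but not with the time [m]. *)
Definition iid_rows X : Prop :=
  [/\ forall l m, measurable_fun [set: Omega] (X l m),
      forall g : 'I_N -> nat -> R -> R,
        (forall l m, measurable_fun [set: R] (g l m)) ->
        (forall l m x, 0 <= g l m x) ->
        (forall l m, \int[P]_w (g l m (X l m w))%:E < +oo)%E ->
        forall n, (\int[P]_w (\prod_(m < n) \prod_l g l m (X l m w))%:E =
          (\prod_(m < n) \prod_l fine (\int[P]_w (g l m (X l m w))%:E))%:E)%E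
    & forall l m (g : R -> \bar R), measurable_fun [set: R] g ->
        (forall x, (0 <= g x)%E) ->
        (\int[P]_w g (X l m w) = \int[P]_w g (X l 0%N w))%E].

Lemma iid_rows_comp X (r : R -> R) : measurable_fun [set: R] r ->
  iid_rows X -> iid_rows (fun l m w => r (X l m w)).
Proof.
move=> mr [mX pX iX]; split.
- by move=> l m; exact: measurableT_comp.
- move=> g mg g0 gfin n; apply: (pX (fun l m x => g l m (r x))) => // l m.
  exact: measurableT_comp.
- move=> l m g mg g0; apply: (iX l m (fun x => g (r x))) => //.
  exact: measurableT_comp.
Qed.

Lemma iid_rows_of_independent (d' : 'I_N -> measure_display)
    (T : forall l, measurableType (d' l)) (xi : forall l, nat -> Omega -> T l)
    (r : forall l, T l -> R) :
  (forall l i, (0 < i)%N -> measurable_fun [set: Omega] (xi l i)) ->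
  (forall l i B, (0 < i)%N -> measurable B -> P (xi l i @^-1` B) = P (xi l 1%N @^-1` B)) ->
  mutually_independent P (fun j : 'I_N * nat => (0 < j.2)%N) (fun j => xi j.1 j.2) ->
  (forall l, measurable_fun [set: T l] (r l)) ->
  iid_rows (fun l m w => r l (xi l m.+1 w)).
Proof.
move=> mxi idxi ind mr; split.
- by move=> l m; apply: measurableT_comp => //; exact: mxi.
- move=> g mg g0 gfin n.
  (* Signals start at time 1, whereas the columns of the array start at 0. *)
  pose J := [seq (l, m.+1) | m <- index_iota 0 n, l <- index_enum 'I_N].
  pose Y (j : 'I_N * nat) := xi j.1 j.2.
  pose h (j : 'I_N * nat) := g j.1 j.2.-1 \o r j.1.
  have uJ : uniq J.
    apply: allpairs_uniq; [exact: iota_uniq|exact: index_enum_uniq|].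
    by move=> [m l] [m' l'] _ _ /= [-> ->].
  have JD j : j \in J -> (0 < j.2)%N by move=> /allpairsP[[m l] [_ _ ->]].
  have mh j : measurable_fun [set: T j.1] (h j).
    exact: (measurableT_comp (mg _ _) (mr _)).
  have h0 j x : 0 <= h j x by exact: g0.
  have hfin j : (0 < j.2)%N -> (\int[P]_w (h j (Y j w))%:E < +oo)%E.
    by case: j => l [//|m] _; exact: gfin.
  have := @independent_expectation_prod _ _ _ P _ _ _ _ Y h ind _ mh h0 hfin J uJ JD.
  move=> /(_ (fun j => mxi j.1 j.2)).
  have bigJ (F : 'I_N * nat -> R) : \prod_(j <- J) F j = \prod_(m < n) \prod_l F (l, m.+1).
    by rewrite big_allpairs_dep big_mkord.
  rewrite bigJ => <-; apply: eq_integral => w _; by rewrite bigJ.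
- move=> l m g mg g0.
  have mgr : measurable_fun [set: T l] (g \o r l) by exact: measurableT_comp.
  have h := @ge0_integral_transfer R _ Omega P _ Omega P _ (T l) (xi l m.+1) (xi l 1%N)
    (cst 1) (cst 1) (g \o r l) (mxi l m.+1 isT) (mxi l 1%N isT) _ _ _ _ _ mgr.
  transitivity (\int[P]_x ((g \o r l) (xi l m.+1 x) * (cst 1%R x)%:E))%E.
    by apply: eq_integral => w _ /=; rewrite mule1.
  rewrite h => //.
    by apply: eq_integral => w _ /=; rewrite mule1.
  2: by move=> x; exact: g0.
  move=> B mB.
  have mB' i : (0 < i)%N -> measurable (xi l i @^-1` B).
    by move=> i0; rewrite -[X in measurable X]setTI; exact: mxi.
  have cE A : measurable A -> (\int[P]_(w in A) (cst (1 : R) w)%:E = P A)%E.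
    by move=> mA; rewrite -[RHS]mul1e -integral_cst.
  by rewrite !cE ?idxi //; exact: mB'.
Qed.

End IidRows.

Section ArraySums.
Context {R : realType} d (Omega : measurableType d) (P : probability Omega R).
Context {N : nat}.
Implicit Types (X : 'I_N -> nat -> Omega -> R) (c : nat -> 'I_N -> R).

Definition array_sum X c (n : nat) (w : Omega) : R :=
  series (fun m => \sum_l c m l * X l m w) n.

Definition array_lim X c (w : Omega) : R :=
  limn (fun n => array_sum X c n w).

Lemma array_sumE X c n w :
  array_sum X c n w = \sum_(m < n) \sum_l c m l * X l m w.
Proof. by rewrite /array_sum /series /= big_mkord. Qed.

Lemma measurable_array_sum X c n :
  (forall l m, measurable_fun [set: Omega] (X l m)) ->
  measurable_fun [set: Omega] (array_sum X c n).
Proof.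
move=> mX; rewrite (_ : array_sum X c n = fun w => \sum_(m < n) \sum_l c m l * X l m w).
  apply: measurable_sum => m; apply: measurable_sum => l.
  exact: measurable_funM.
by apply/funext => w; rewrite array_sumE.
Qed.

Lemma measurable_array_lim X c :
  (forall l m, measurable_fun [set: Omega] (X l m)) ->
  measurable_fun [set: Omega] (array_lim X c).
Proof.
by move=> mX; apply: measurable_fun_limn => n; exact: measurable_array_sum.
Qed.

Lemma expectation_expR_array_sum X c n (u : R) : iid_rows P X ->
  (forall l m, \int[P]_w (expR (u * c m l * X l 0%N w))%:E < +oo)%E ->
  (\int[P]_w (expR (u * array_sum X c n w))%:E =
   (\prod_(m < n) \prod_l
      fine (\int[P]_w (expR (u * c m l * X l 0%N w))%:E))%:E)%E.
Proof.
move=> [mX pX iX] fin.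
pose g (l : 'I_N) m (x : R) := expR (u * c m l * x).
have mg l m : measurable_fun [set: R] (g l m).
  by apply: measurableT_comp => //; exact: measurable_funM.
have gid l m : (\int[P]_w (g l m (X l m w))%:E = \int[P]_w (g l m (X l 0%N w))%:E)%E.
  apply: (iX l m (EFin \o g l m)); last by move=> x; rewrite lee_fin expR_ge0.
  exact/measurable_EFinP.
have := pX g mg (fun _ _ _ => expR_ge0 _) (fun l m => _) n.
have {}fin l m : (\int[P]_w (g l m (X l m w))%:E < +oo)%E by rewrite gid fin.
move=> /(_ fin) h.
transitivity (\int[P]_w (\prod_(m < n) \prod_l g l m (X l m w))%:E)%E.
  apply: eq_integral => w _; congr EFin.
  rewrite array_sumE mulr_sumr expR_sum; apply: eq_bigr => m _.
  by rewrite mulr_sumr expR_sum; apply: eq_bigr => l _; rewrite mulrA.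
rewrite h; congr EFin; apply: eq_bigr => m _; apply: eq_bigr => l _.
by rewrite gid.
Qed.

Lemma cvg_expectation_abs_array_sum X c : iid_rows P X ->
  (\int[P]_w (array_sum (fun l m w => `|X l m w|) (fun m l => `|c m l|) n w)%:E
     @[n --> \oo] -->
   \int[P]_w limn (fun n => (array_sum (fun l m w => `|X l m w|)
      (fun m l => `|c m l|) n w)%:E))%E.
Proof.
move=> [mX pX iX].
apply: cvg_monotone_convergence => //.
- move=> n; apply/measurable_EFinP; apply: measurable_array_sum => l m.
  exact: measurableT_comp.
- move=> n w _; rewrite lee_fin array_sumE; apply: sumr_ge0 => m _.
  by apply: sumr_ge0 => l _; rewrite mulr_ge0.
- move=> w _ n m nm; rewrite lee_fin /array_sum.
  apply: nondecreasing_series => // k _ _.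
  by apply: sumr_ge0 => l _; rewrite mulr_ge0.
Qed.

Lemma cvgn_array_sum_le X c w (B : R) :
  (forall n, array_sum (fun l m w => `|X l m w|) (fun m l => `|c m l|) n w <= B) ->
  cvgn (fun n => array_sum X c n w).
Proof.
move=> hB; apply: normed_cvg; apply: nondecreasing_is_cvgn.
  by apply: nondecreasing_series => k _ _ /=; exact: normr_ge0.
exists B => _ [n _ <-]; apply: le_trans (hB n).
rewrite array_sumE /= /series /= big_mkord; apply: ler_sum => m _.
apply: (le_trans (ler_norm_sum _ _ _)); apply: ler_sum => l _.
by rewrite normrM.
Qed.

(** The series of absolute values has expectation at most [K * B] by monotone convergence, hence it
    is finite almost everywhere, and absolute convergence follows. *)
Lemma ae_cvgn_array_sum X c (K : R) : iid_rows P X ->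
  (forall l, \int[P]_w `|X l 0%N w|%:E < +oo)%E ->
  (forall n, \sum_(m < n) \sum_l `|c m l| <= K) ->
  \forall w \ae P, cvgn (fun n => array_sum X c n w).
Proof.
move=> iidX finX hK; have [mX pX iX] := iidX.
pose a l := fine (\int[P]_w `|X l 0%N w|%:E)%E.
have aE l m : (\int[P]_w `|X l m w|%:E = (a l)%:E)%E.
  rewrite (iX l m (fun x => `|x|%:E)) //.
    by rewrite fineK // ge0_fin_numE // integral_ge0 // => x _; rewrite lee_fin.
  by apply/measurable_EFinP; exact: normr_measurable.
have a0 l : 0 <= a l by rewrite fine_ge0 // integral_ge0 // => x _; rewrite lee_fin.
pose B := \sum_l a l.
have aB l : a l <= B by rewrite /B (bigD1 l) //= lerDl sumr_ge0.
pose Y n w := array_sum (fun l m w => `|X l m w|) (fun m l => `|c m l|) n w.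
have Y0 n w : 0 <= Y n w.
  rewrite /Y array_sumE; apply: sumr_ge0 => m _.
  by apply: sumr_ge0 => l _; rewrite mulr_ge0.
have mY n : measurable_fun [set: Omega] (fun w => (Y n w)%:E).
  apply/measurable_EFinP; apply: measurable_array_sum => l m.
  exact: measurableT_comp.
have ndY w : {homo (fun n => (Y n w)%:E) : n m / (n <= m)%N >-> (n <= m)%E}.
  move=> n m nm; rewrite lee_fin /Y /array_sum.
  apply: nondecreasing_series => // k _ _.
  by apply: sumr_ge0 => l _; rewrite mulr_ge0.
have cY w : cvgn (fun n => (Y n w)%:E) by exact: ereal_nondecreasing_is_cvgn.
have EY n : (\int[P]_w (Y n w)%:E <= (K * B)%:E)%E.
  have -> : (\int[P]_w (Y n w)%:E = (\sum_(m < n) \sum_l `|c m l| * a l)%:E)%E.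
    transitivity (\int[P]_w (\sum_(m < n) \sum_l (`|c m l| * `|X l m w|)%:E))%E.
      apply: eq_integral => w _; rewrite /Y array_sumE -sumEFin.
      by apply: eq_bigr => m _; rewrite sumEFin.
    have mcX m l : measurable_fun [set: Omega] (fun w => (`|c m l| * `|X l m w|)%:E).
      apply/measurable_EFinP; apply: measurable_funM => //.
      exact: measurableT_comp.
    rewrite ge0_integral_sum //; last 2 first.
    - by move=> m; exact: emeasurable_sum.
    - by move=> m w _; apply: sume_ge0 => l _; rewrite lee_fin mulr_ge0.
    rewrite -sumEFin; apply: eq_bigr => m _.
    rewrite ge0_integral_sum //.
    rewrite -sumEFin; apply: eq_bigr => l _.
    under eq_integral do rewrite EFinM.
    rewrite ge0_integralZl //; last first.
      by apply/measurable_EFinP; exact: measurableT_comp.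
    by rewrite aE EFinM.
  rewrite lee_fin; apply: (@le_trans _ _ (\sum_(m < n) (\sum_l `|c m l|) * B)).
    apply: ler_sum => m _; rewrite mulr_suml; apply: ler_sum => l _.
    by rewrite ler_wpM2l.
  by rewrite -mulr_suml ler_wpM2r // sumr_ge0.
pose L w := limn (fun n => (Y n w)%:E).
have mL : measurable_fun [set: Omega] L.
  apply: (emeasurable_fun_cvg (fun n w => (Y n w)%:E)) => [n|w _].
    exact: mY.
  exact: (cY w).
have L0 w : (0 <= L w)%E.
  by apply: lime_ge => //; apply: nearW => n; rewrite lee_fin.
have EL : (\int[P]_w L w <= (K * B)%:E)%E.
  have h := @cvg_expectation_abs_array_sum X c iidX.
  rewrite -(cvg_lim _ h) //; apply: lime_le.
    by apply/cvg_ex; eexists; exact: h.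
  by apply: nearW => n; exact: EY.
have iL : P.-integrable [set: Omega] L.
  apply/integrableP; split => //.
  under eq_integral do rewrite gee0_abs //.
  by rewrite (le_lt_trans EL) // ltry.
have := integrable_ae measurableT iL.
apply: filterS => w /(_ I) Lfin.
apply: (@cvgn_array_sum_le _ _ _ (fine (L w))) => n.
rewrite -lee_fin fineK //; apply: lime_ge => //.
by exists n => // m /= nm; exact: ndY.
Qed.

End ArraySums.

(** * Laplace transforms *)

Section RealExpectation.
Context {R : realType} d (Omega : measurableType d) (P : probability Omega R).
Implicit Types f g Y : Omega -> R.

Definition real_integrable f := P.-integrable [set: Omega] (EFin \o f).

Lemma real_integrable_measurable f :
  real_integrable f -> measurable_fun [set: Omega] f.
Proof. by move=> /measurable_int /measurable_EFinP. Qed.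

Lemma real_integrableE f : real_integrable f ->
  (\int[P]_w (f w)%:E)%E = (\int[P]_w f w)%:E.
Proof. by move=> /(integrable_fin_num measurableT) ff; rewrite fineK. Qed.

Lemma real_integrable_ge0 f : measurable_fun [set: Omega] f ->
  (forall w, 0 <= f w) -> (\int[P]_w (f w)%:E < +oo)%E -> real_integrable f.
Proof.
move=> mf f0 fin; apply/integrableP; split; first exact/measurable_EFinP.
by under eq_integral do rewrite /= ger0_norm //.
Qed.

Lemma real_integrable_norm f : measurable_fun [set: Omega] f ->
  (\int[P]_w `|f w|%:E < +oo)%E -> real_integrable f.
Proof.
by move=> mf fin; apply/integrableP; split => //; exact/measurable_EFinP.
Qed.

Lemma le_real_integrable f g : measurable_fun [set: Omega] f ->
  (forall w, `|f w| <= `|g w|) -> real_integrable g -> real_integrable f.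
Proof.
move=> mf fg; apply: le_integrable => //; first exact/measurable_EFinP.
by move=> w _ /=; rewrite lee_fin.
Qed.

Lemma real_integrable_cst a : real_integrable (fun=> a).
Proof. exact: finite_measure_integrable_cst. Qed.

Lemma real_integrable_bounded f B : measurable_fun [set: Omega] f ->
  (forall w, `|f w| <= B) -> real_integrable f.
Proof.
move=> mf fB; apply: le_real_integrable (real_integrable_cst B) => // w.
exact: le_trans (fB w) (ler_norm _).
Qed.

Lemma real_integrableD f g : real_integrable f -> real_integrable g ->
  real_integrable (fun w => f w + g w).
Proof. by move=> fi gi; apply: eq_integrable (integrableD _ fi gi). Qed.

Lemma real_integrableZ a f : real_integrable f ->
  real_integrable (fun w => a * f w).
Proof. by move=> fi; apply: eq_integrable (integrableZl _ a fi). Qed.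

Lemma expectation_affine a b f : real_integrable f ->
  \int[P]_w (a + b * f w) = a + b * \int[P]_w f w.
Proof.
move=> fi; rewrite (RintegralD measurableT (real_integrable_cst a)
  (real_integrableZ b fi)) RintegralZl // Rintegral_cst //.
by rewrite [X in fine X]probability_setT mulr1.
Qed.

Lemma expectation_le_affine a b f g : real_integrable f -> real_integrable g ->
  (forall w, f w <= a + b * g w) -> \int[P]_w f w <= a + b * \int[P]_w g w.
Proof.
move=> fi gi h; rewrite -expectation_affine //; apply: le_Rintegral => //.
by apply: real_integrableD (real_integrableZ _ _) => //; exact: real_integrable_cst.
Qed.

Lemma affine_le_expectation a b f g : real_integrable f -> real_integrable g ->
  (forall w, a + b * f w <= g w) -> a + b * \int[P]_w f w <= \int[P]_w g w.
Proof.
move=> fi gi h; rewrite -expectation_affine //; apply: le_Rintegral => //.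
by apply: real_integrableD (real_integrableZ _ _) => //; exact: real_integrable_cst.
Qed.

Lemma expR_tangent (x y : R) : expR x * (1 - x) + expR x * y <= expR y.
Proof.
have -> : expR y = expR x * expR (y - x) by rewrite -expRD addrC subrK.
rewrite -mulrDr ler_wpM2l ?expR_ge0 //.
by have := expR_ge1Dx (y - x); lra.
Qed.

Lemma expR_convex (a x y : R) : 0 <= a -> a <= 1 ->
  expR (a * x + (1 - a) * y) <= a * expR x + (1 - a) * expR y.
Proof.
move=> a0 a1; set z := a * x + _.
have h1 := expR_tangent z x; have h2 := expR_tangent z y.
have a1' : 0 <= 1 - a by lra.
rewrite [leLHS](_ : _ = a * (expR z * (1 - z) + expR z * x) +
   (1 - a) * (expR z * (1 - z) + expR z * y)); last by rewrite /z; ring.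
by apply: lerD; apply: ler_wpM2l.
Qed.

(** Jensen's inequality: integrate the tangent line of the exponential at the mean [u * E Y]. *)
Lemma expectation_expR_ge Y u : real_integrable Y ->
  real_integrable (fun w => expR (u * Y w)) ->
  expR (u * \int[P]_w Y w) <= \int[P]_w expR (u * Y w).
Proof.
move=> Yi ei; set x := u * _.
rewrite (_ : expR x = expR x * (1 - x) + (expR x * u) * \int[P]_w Y w); last first.
  by rewrite /x; ring.
apply: affine_le_expectation => // w.
by rewrite -mulrA; exact: expR_tangent.
Qed.

(** By convexity the quotient lies between its value at [u = 1] and its limit [y] as [u] tends to 0,
    which gives a dominating function independent of [u]. *)
Lemma expR_slope_bounds (u y : R) : 0 < u -> u <= 1 ->
  `|(1 - expR (- (u * y))) / u| <= `|y| + (1 + expR (- y)).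
Proof.
move=> u0 u1; have ey := expR_gt0 (- y).
have h1 : (1 - expR (- (u * y))) / u <= y.
  by rewrite ler_pdivrMr //; have := expR_ge1Dx (- (u * y)); lra.
have h2 : 1 - expR (- y) <= (1 - expR (- (u * y))) / u.
  rewrite ler_pdivlMr //; have := @expR_convex u (- y) 0 (ltW u0) u1.
  by rewrite mulr0 addr0 mulrN expR0; lra.
rewrite ler_norml; apply/andP; split; have := ler_norm y; have := normr_ge0 y; lra.
Qed.

Lemma expR_slope_cvg (y : R) :
  (1 - expR (- (n.+1%:R^-1 * y))) / n.+1%:R^-1 @[n --> \oo] --> y.
Proof.
have h0 : n.+1%:R^-1 * y @[n --> \oo] --> 0 * y.
  by apply: cvgMl; exact: cvg_harmonic.
rewrite mul0r in h0.
apply: (squeeze_cvgr (f := fun n => y / (1 + n.+1%:R^-1 * y)) (h := cst y)); last 2 first.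
- rewrite -[X in _ --> X]divr1; apply: cvgM; first exact: cvg_cst.
  apply: cvgV; first exact: oner_neq0.
  rewrite -[X in _ --> X]addr0; apply: cvgD => //; exact: cvg_cst.
- exact: cvg_cst.
have e0 : (0 : R) < 1 / 2 by [].
move/cvgrPdist_le: h0 => /(_ _ e0); apply: filterS => n; rewrite sub0r normrN.
set u := n.+1%:R^-1; have u0 : 0 < u by rewrite /u invr_gt0.
rewrite ler_norml => /andP[hu _].
have p1 : 0 < 1 + u * y by lra.
have x1 := expR_ge1Dx (- (u * y)); have x2 := expR_ge1Dx (u * y).
apply/andP; split; last by rewrite /= ler_pdivrMr //; lra.
rewrite ler_pdivlMr // mulrAC ler_pdivrMr //.
have : expR (- (u * y)) * (1 + u * y) <= 1.
  apply: (@le_trans _ _ (expR (- (u * y)) * expR (u * y))).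
    by rewrite ler_pM2l // expR_gt0.
  by rewrite -expRD addNr expR0.
lra.
Qed.

(** The one-sided derivative at 0 of the Laplace transform is minus the mean. Dominated convergence
    gives the bound at a single [u = 1 / (n + 1)], and convexity in [u] extends it to all smaller
    ones. *)
Lemma expectation_expR_slope Y eps : real_integrable Y ->
  real_integrable (fun w => expR (- Y w)) -> 0 < eps ->
  exists u0, [/\ 0 < u0, u0 <= 1 & forall u, 0 < u -> u <= u0 ->
    real_integrable (fun w => expR (- (u * Y w))) /\
    \int[P]_w expR (- (u * Y w)) <= 1 - u * (\int[P]_w Y w - eps)].
Proof.
move=> Yi ei eps0; have mY := real_integrable_measurable Yi.
have meu u : measurable_fun [set: Omega] (fun w => expR (- (u * Y w))).
  apply: measurableT_comp => //; apply: measurable_funN; exact: measurable_funM.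
have eui u : 0 <= u -> u <= 1 -> real_integrable (fun w => expR (- (u * Y w))).
  move=> u0 u1; apply: (@le_real_integrable _ (fun w => 1 + 1 * expR (- Y w))) => [//|w|].
    rewrite !ger0_norm ?addr_ge0 ?mulr_ge0 ?expR_ge0 //.
    have := @expR_convex u (- Y w) 0 u0 u1; rewrite mulr0 addr0 mulrN expR0.
    have := expR_gt0 (- Y w); nra.
  by apply: real_integrableD (real_integrableZ _ _) => //; exact: real_integrable_cst.
pose q n w := (1 - expR (- (n.+1%:R^-1 * Y w))) / n.+1%:R^-1.
have un (n : nat) : (0 < n.+1%:R^-1 :> R) /\ (n.+1%:R^-1 <= 1 :> R).
  by rewrite invr_gt0 invf_le1 ?ler1n // ltr0n.
have qcvg : (\int[P]_w (q n w)%:E @[n --> \oo] --> \int[P]_w (Y w)%:E)%E.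
  apply: (@dominated_cvg _ _ _ _ _ measurableT (fun n w => (q n w)%:E) (EFin \o Y)
    (EFin \o (fun w => `|Y w| + (1 + 1 * expR (- Y w))))) => //.
  - move=> n; apply/measurable_EFinP; apply: measurable_funM => //.
    exact: measurable_funB.
  - by move=> w _; apply: cvg_EFin; [exact: nearW|exact: expR_slope_cvg].
  - apply: real_integrableD; first exact: integrable_norm.
    by apply: real_integrableD (real_integrableZ _ _) => //; exact: real_integrable_cst.
  - move=> n w _ /=; rewrite lee_fin mul1r; apply: expR_slope_bounds; by case: (un n).
have qi n : \int[P]_w q n w = (1 - \int[P]_w expR (- (n.+1%:R^-1 * Y w))) / n.+1%:R^-1.
  have [u0 u1] := un n.
  rewrite (_ : (fun w => q n w) = fun w => n.+1%:R + (- n.+1%:R) * expR (- (n.+1%:R^-1 * Y w))).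
    by rewrite expectation_affine ?invrK; [ring|exact: eui (ltW u0) u1].
  by apply/funext => w; rewrite /q invrK; ring.
have qint n : real_integrable (q n).
  have [u0 u1] := un n.
  rewrite (_ : q n = fun w => n.+1%:R + (- n.+1%:R) * expR (- (n.+1%:R^-1 * Y w))).
    apply: real_integrableD (real_integrableZ _ _) => //; first exact: real_integrable_cst.
    exact: eui (ltW u0) u1.
  by apply/funext => w; rewrite /q invrK; ring.
have : \int[P]_w q n w @[n --> \oo] --> \int[P]_w Y w.
  by move: qcvg; rewrite (real_integrableE Yi) => /fine_cvg.
move=> /cvgrPdist_le /(_ _ eps0) [n _ /(_ n (leqnn n))] /=.
have [u0 u1] := un n; set u1' := n.+1%:R^-1 in u0 u1 *.
rewrite qi -/u1' => hn; have {}hn : \int[P]_w Y w - eps <=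
    (1 - \int[P]_w expR (- (u1' * Y w))) / u1'.
  by move: hn; rewrite ler_norml => /andP[_]; lra.
exists u1'; split => // u up uu; split; first by apply: eui; lra.
(* Convexity of the exponential between 0 and [u1']: the transform at [u] lies below the chord,
   whose slope is already controlled. *)
have au : 0 <= u / u1' by rewrite divr_ge0 // ltW.
have au1 : u / u1' <= 1 by rewrite ler_pdivrMr // mul1r.
apply: (@le_trans _ _ ((1 - u / u1') + (u / u1') * \int[P]_w expR (- (u1' * Y w)))).
  apply: expectation_le_affine; [by apply: eui; lra|by apply: eui; lra|move=> w].
  have := @expR_convex (u / u1') (- (u1' * Y w)) 0 au au1.
  rewrite mulr0 addr0 expR0 mulr1.
  rewrite (_ : u / u1' * - (u1' * Y w) = - (u * Y w)); first by lra.
  by field; rewrite gt_eqF.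
have : u * (\int[P]_w Y w - eps) <= u * ((1 - \int[P]_w expR (- (u1' * Y w))) / u1').
  by rewrite ler_pM2l.
rewrite mulrCA mulrA => h; move: h; set m := \int[P]_w _; set z := \int[P]_w _.
lra.
Qed.

End RealExpectation.

(** * The weak law of large numbers *)

Definition geometric_weight {R : realType} {N : nat} (a : nat -> 'I_N -> R)
  (delta : R) (m : nat) (l : 'I_N) : R := (1 - delta) ^+ m * a m l.

Section GeometricArray.
Context {R : realType} d (Omega : measurableType d) (P : probability Omega R).
Context {N : nat}.
Implicit Types (X : 'I_N -> nat -> Omega -> R) (c : nat -> 'I_N -> R).

Lemma expectation_expR_array_lim X c u (D : Omega -> \bar R) :
  (forall l m, measurable_fun [set: Omega] (X l m)) ->
  (\forall w \ae P, cvgn (fun n => array_sum X c n w)) ->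
  P.-integrable [set: Omega] D ->
  (forall n w, ((expR (u * array_sum X c n w))%:E <= D w)%E) ->
  real_integrable P (fun w => expR (u * array_lim X c w)) /\
  \int[P]_w expR (u * array_sum X c n w) @[n --> \oo] -->
    \int[P]_w expR (u * array_lim X c w).
Proof.
move=> mX cX iD hD.
have mS n : measurable_fun [set: Omega] (fun w => expR (u * array_sum X c n w)).
  by apply: measurableT_comp => //; apply: measurable_funM => //; exact: measurable_array_sum.
have mL : measurable_fun [set: Omega] (fun w => expR (u * array_lim X c w)).
  by apply: measurableT_comp => //; apply: measurable_funM => //; exact: measurable_array_lim.
have [] := @dominated_convergence _ _ _ P _ measurableT
  (fun n w => (expR (u * array_sum X c n w))%:E)
  (fun w => (expR (u * array_lim X c w))%:E) D _ _ _ iD _.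
- by move=> n; exact/measurable_EFinP.
- exact/measurable_EFinP.
- apply: filterS cX => w cw _; apply: cvg_EFin; first exact: nearW.
  apply: (cvg_comp _ expR) (@continuous_expR R _).
  by apply: cvgMr; exact: cw.
- by apply: nearW => w n _; rewrite gee0_abs ?lee_fin ?expR_ge0.
move=> iL _ hcv; split => //.
by move: hcv; rewrite (real_integrableE iL) => /fine_cvg.
Qed.

Variables (a : nat -> 'I_N -> R) (p : 'I_N -> R).
Hypothesis a01 : forall m l, 0 <= a m l <= 1.
Hypothesis acvg : forall l, a m l @[m --> \oo] --> p l.

Local Notation wt := (geometric_weight a).

Let p01 l : 0 <= p l <= 1.
Proof.
have ca : cvgn (fun m => a m l) by apply/cvg_ex; exists (p l); exact: acvg.
rewrite -(cvg_lim (@Rhausdorff R) (@acvg l)); apply/andP; split.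
  by apply: limr_ge => //; apply: nearW => m; have /andP[] := a01 m l.
by apply: limr_le => //; apply: nearW => m; have /andP[] := a01 m l.
Qed.

Lemma geometric_weight_bounds delta m l : 0 < delta -> delta < 1 ->
  0 <= wt delta m l <= 1.
Proof.
move=> d0 d1; have /andP[a0 a1] := a01 m l.
have h0 : 0 <= 1 - delta by lra.
have h1 : 1 - delta <= 1 by lra.
by rewrite /geometric_weight mulr_ge0 ?exprn_ge0 // mulr_ile1 ?exprn_ge0 ?exprn_ile1.
Qed.

Lemma geometric_weight_sum delta n : 0 < delta -> delta < 1 ->
  \sum_(m < n) \sum_l `|wt delta m l| <= N%:R / delta.
Proof.
move=> d0 d1; rewrite ler_pdivlMr // mulrC.
apply: (@le_trans _ _ (delta * \sum_(m < n) (1 - delta) ^+ m * N%:R)).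
  rewrite ler_pM2l //; apply: ler_sum => m _.
  rewrite -[N in N%:R]card_ord -sum1_card natr_sum mulr_sumr; apply: ler_sum => l _.
  have /andP[a0 a1] := a01 m l.
  have h0 : 0 <= 1 - delta by lra.
  by rewrite /geometric_weight normrM !ger0_norm ?exprn_ge0 // ler_wpM2l ?exprn_ge0.
rewrite -mulr_suml mulrA abel_geometric_sum_le //; last exact: ltW.
rewrite ler_piMl // lerBlDr lerDl exprn_ge0 //; lra.
Qed.

Lemma ae_cvgn_geometric X delta : iid_rows P X ->
  (forall l, real_integrable P (X l 0%N)) -> 0 < delta -> delta < 1 ->
  \forall w \ae P, cvgn (fun n => array_sum X (wt delta) n w).
Proof.
move=> iidX Xi d0 d1; apply: (ae_cvgn_array_sum (K := N%:R / delta)) => //.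
  by move=> l; have /integrableP[] := Xi l.
by move=> n; exact: geometric_weight_sum.
Qed.

(** The truncation factor [1 - (1 - delta) ^+ n] stays explicit, so that the bound is uniform in [n]
    and [n] can tend to infinity at fixed [delta]. *)
Lemma geometric_weight_mean eps : 0 < eps ->
  \forall delta \near (0 : R)^'+, forall l n,
    `|delta * \sum_(m < n) wt delta m l - p l * (1 - (1 - delta) ^+ n)| <= eps.
Proof.
move=> eps0.
have key l : \forall delta \near (0 : R)^'+, forall n,
    delta * \sum_(m < n) (1 - delta) ^+ m * `|a m l - p l| <= eps.
  apply: (@abel_mean_small _ (fun m => `|a m l - p l|) 2) => // [m|].
    have /andP[? ?] := a01 m l; have /andP[? ?] := p01 l.
    by rewrite normr_ge0 ler_norml; apply/andP; split; lra.
  rewrite -[X in _ --> X](normr0 R) -(subrr (p l)).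
  by apply: cvg_norm; apply: cvgB => //; exact: cvg_cst.
have {}key : \forall delta \near (0 : R)^'+, forall l n,
    delta * \sum_(m < n) (1 - delta) ^+ m * `|a m l - p l| <= eps.
  by apply: filter_forall => l; exact: key.
near=> delta => l n.
have d0 : 0 < delta by near: delta; exact: nbhs_right_gt.
have d1 : delta <= 1 by near: delta; exact: nbhs_right_le.
apply: (@le_trans _ _ (delta * \sum_(m < n) (1 - delta) ^+ m * `|a m l - p l|)); last first.
  by move: l n; near: delta; exact: key.
rewrite -abel_geometric_sum_le // mulrCA -mulrBr normrM gtr0_norm // ler_pM2l //.
rewrite mulr_sumr -sumrB; apply: (le_trans (ler_norm_sum _ _ _)).
apply: ler_sum => m _.
have h0 : 0 <= 1 - delta by lra.
by rewrite /geometric_weight (mulrC (p l)) -mulrBr normrM ger0_norm ?exprn_ge0.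
Unshelve. all: end_near. Qed.

Lemma array_sum_ge0 X c n w : (forall l m w, 0 <= X l m w) ->
  (forall m l, 0 <= c m l) -> 0 <= array_sum X c n w.
Proof.
move=> X0 c0; rewrite array_sumE; apply: sumr_ge0 => m _.
by apply: sumr_ge0 => l _; rewrite mulr_ge0.
Qed.

Section NonnegativeRows.
Variable X : 'I_N -> nat -> Omega -> R.
Hypotheses (iidX : iid_rows P X) (X0 : forall l m w, 0 <= X l m w).
Hypothesis Xi : forall l, real_integrable P (X l 0%N).

Let mean := \sum_l p l * \int[P]_w X l 0%N w.

(** Each factor of the product is bounded below by Jensen's inequality and above by its slope at 0,
    whose arguments are at most [s * delta]. The exponents then add up to [- s] times a combination
    of the means with coefficients [T l n], which are close to [p l]. *)
Lemma laplace_geometric_array s eps : 0 < s -> 0 < eps ->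
  \forall delta \near (0 : R)^'+,
    real_integrable P (fun w => expR (- (s * delta) * array_lim X (wt delta) w)) /\
    expR (- s * (mean + eps)) <=
      \int[P]_w expR (- (s * delta) * array_lim X (wt delta) w) <=
    expR (- s * (mean - eps)).
Proof.
move=> s0 eps0; have [mX _ _] := iidX; have pp := p01; have aa := a01.
pose e l := \int[P]_w X l 0%N w.
have e0 l : 0 <= e l by apply: Rintegral_ge0 => w _; exact: X0.
pose E := \sum_l e l; have E0 : 0 <= E by apply: sumr_ge0.
(* [eta] is the error of the slope bound, paid once per row; [eps1] is the error on the weights,
   paid twice against the total mean [E]. Together they stay below [eps], by [hE]. *)
pose eta := eps / (2 * (N%:R + 1)).
have N1 : 0 < N%:R + 1 :> R by rewrite ltr_wpDl.
have eta0 : 0 < eta by rewrite divr_gt0 // mulr_gt0.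
pose eps1 := eps / (4 * (E + 1)).
have E1 : 0 < E + 1 by lra.
have eps10 : 0 < eps1 by rewrite divr_gt0 // mulr_gt0.
have hE : 2 * eps1 * E + N%:R * eta <= eps.
  have h1 : eps1 * (E + 1) = eps / 4 by rewrite /eps1; field; rewrite gt_eqF.
  have h2 : eta * (N%:R + 1) = eps / 2 by rewrite /eta; field; rewrite gt_eqF.
  nra.
have bnd (u : R) l : 0 <= u -> real_integrable P (fun w => expR (- (u * X l 0%N w))).
  move=> u0; apply: (@real_integrable_bounded _ _ _ _ _ 1) => [|w].
    by apply: measurableT_comp => //; apply: measurable_funN; exact: measurable_funM.
  by rewrite ger0_norm ?expR_ge0 // expR_le1 oppr_le0 mulr_ge0.
have bnd1 l : real_integrable P (fun w => expR (- X l 0%N w)).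
  by rewrite (_ : (fun _ => _) = fun w => expR (- (1 * X l 0%N w)));
    [exact: bnd|apply/funext => w; rewrite mul1r].
have [u0 [u00 hu0]] : exists u0, 0 < u0 /\ forall l u, 0 <= u -> u <= u0 ->
    \int[P]_w expR (- (u * X l 0%N w)) <= 1 - u * (e l - eta).
  have key l := expectation_expR_slope (Xi l) (bnd1 l) eta0.
  pose f l := projT1 (cid (key l)).
  exists (\big[Num.min/1]_l f l); split.
    apply: (big_ind (fun x : R => 0 < x)) => // [x y x0 y0|l _].
      by rewrite lt_min x0.
    by rewrite /f; case: cid => ? [].
  move=> l u up ul.
  have : u <= f l by apply: (le_trans ul); exact: (bigmin_inf l).
  rewrite /f; case: cid => /= v [v0 v1 hv] uv.
  move: up; rewrite le_eqVlt => /predU1P[<-|up]; last by case: (hv _ up uv).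
  rewrite mul0r subr0 (_ : (fun _ => _) = fun=> 1); last first.
    by apply/funext => w; rewrite mul0r oppr0 expR0.
  by rewrite Rintegral_cst // [X in fine X]probability_setT mulr1.
have near_mean := geometric_weight_mean eps10.
near=> delta.
have d0 : 0 < delta by near: delta; exact: nbhs_right_gt.
have d1 : delta < 1 by near: delta; exact: nbhs_right_lt.
have du : delta <= u0 / s by near: delta; apply: nbhs_right_le; rewrite divr_gt0.
have hT l n : `|delta * \sum_(m < n) wt delta m l - p l * (1 - (1 - delta) ^+ n)| <= eps1.
  by move: l n; near: delta; exact: near_mean.
have wt01 m l := geometric_weight_bounds m l d0 d1.
have wt0 m l : 0 <= wt delta m l by case/andP: (wt01 m l).
set u := - (s * delta).
have [iL cL] : real_integrable P (fun w => expR (u * array_lim X (wt delta) w)) /\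
  \int[P]_w expR (u * array_sum X (wt delta) n w) @[n --> \oo] -->
    \int[P]_w expR (u * array_lim X (wt delta) w).
  apply: (expectation_expR_array_lim (D := fun=> 1%E)) => //.
  - exact: ae_cvgn_geometric.
  - exact: (real_integrable_cst P 1).
  - move=> n w; rewrite lee_fin expR_le1 /u mulNr oppr_le0 mulr_ge0 //.
      by rewrite mulr_ge0 // ltW.
    exact: array_sum_ge0.
split => //.
have sw m l : 0 <= s * delta * wt delta m l by rewrite mulr_ge0 // mulr_ge0 // ltW.
have sumE n : \int[P]_w expR (u * array_sum X (wt delta) n w) =
    \prod_(m < n) \prod_l \int[P]_w expR (- (s * delta * wt delta m l * X l 0%N w)).
  have := @expectation_expR_array_sum _ _ _ P _ X (wt delta) n u iidX.
  have uE m l : (fun w => (expR (u * wt delta m l * X l 0%N w))%:E) =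
      (fun w => (expR (- (s * delta * wt delta m l * X l 0%N w)))%:E).
    by apply/funext => w; rewrite /u !mulNr.
  have -> : (\int[P]_w (expR (u * array_sum X (wt delta) n w))%:E)%E =
      (\int[P]_w expR (u * array_sum X (wt delta) n w))%:E.
    apply: real_integrableE; apply: (@real_integrable_bounded _ _ _ _ _ 1) => [|w].
      by apply: measurableT_comp => //; apply: measurable_funM => //; exact: measurable_array_sum.
    rewrite ger0_norm ?expR_ge0 // expR_le1 /u mulNr oppr_le0 mulr_ge0 //.
      by rewrite mulr_ge0 // ltW.
    exact: array_sum_ge0.
  move=> h; apply: EFin_inj; rewrite h => [|l m].
    by congr EFin; apply: eq_bigr => m _; apply: eq_bigr => l _; rewrite uE.
  by rewrite uE (real_integrableE (bnd _ l (sw m l))) ltry.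
pose T l n := delta * \sum_(m < n) wt delta m l.
have lowE n : expR (- s * \sum_l T l n * e l) <=
    \int[P]_w expR (u * array_sum X (wt delta) n w).
  rewrite sumE (_ : - s * _ = \sum_(m < n) \sum_l (- (s * delta * wt delta m l)) * e l); last first.
    rewrite exchange_big /= mulr_sumr; apply: eq_bigr => l _.
    by rewrite /T mulr_sumr !mulr_suml mulr_sumr; apply: eq_bigr => m _; ring.
  rewrite expR_sum; apply: ler_prod => m _.
  rewrite expR_sum prodr_ge0 /=; last by move=> l _; exact: expR_ge0.
  apply: ler_prod => l _; rewrite expR_ge0 /=.
  have eq1 : (fun w => expR (- (s * delta * wt delta m l * X l 0%N w))) =
    (fun w => expR (- (s * delta * wt delta m l) * X l 0%N w)).
    by apply/funext => w; rewrite mulNr.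
  by rewrite eq1; apply: expectation_expR_ge => //; rewrite -eq1; exact: bnd.
have uppE n : \int[P]_w expR (u * array_sum X (wt delta) n w) <=
    expR (- s * \sum_l T l n * (e l - eta)).
  rewrite sumE (_ : - s * _ = \sum_(m < n) \sum_l (- (s * delta * wt delta m l * (e l - eta)))); last first.
    rewrite exchange_big /= mulr_sumr; apply: eq_bigr => l _.
    by rewrite /T mulr_sumr !mulr_suml mulr_sumr; apply: eq_bigr => m _; ring.
  rewrite expR_sum; apply: ler_prod => m _.
  have i0 l : 0 <= \int[P]_w expR (- (s * delta * wt delta m l * X l 0%N w)).
    by apply: Rintegral_ge0 => w _; exact: expR_ge0.
  rewrite expR_sum prodr_ge0 //=.
  apply: ler_prod => l _; rewrite i0 /=.
  apply: le_trans (expR_ge1Dx _); apply: hu0 => //.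
  have /andP[_ w1] := wt01 m l.
  move: du; rewrite ler_pdivlMr // mulrC; apply: le_trans.
  by rewrite ler_piMr // mulr_ge0 // ltW.
have pw n : 0 <= (1 - delta) ^+ n <= 1.
  by rewrite exprn_ge0 ?exprn_ile1 //; lra.
have T1 l n : T l n <= p l + eps1.
  have := hT l n; rewrite ler_norml => /andP[_].
  have /andP[q0 q1] := pw n; have /andP[p0 p1] := pp l; rewrite -/(T l n); nra.
have Tle1 l n : T l n <= 1.
  rewrite /T; apply: (@le_trans _ _ (delta * \sum_(m < n) (1 - delta) ^+ m)).
    rewrite ler_pM2l //; apply: ler_sum => m _.
    by have /andP[q0 q1] := pw m; have /andP[? ?] := aa m l; rewrite /geometric_weight ler_piMr.
  rewrite abel_geometric_sum_le //; last exact: ltW.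
  by have /andP[q0 q1] := pw n; lra.
(* [n0] depends on [delta], which is harmless: [n] tends to infinity first. *)
have [n0 hn0] : exists n0, forall l n, (n0 <= n)%N -> p l - 2 * eps1 <= T l n.
  have : (1 - delta) ^+ n @[n --> \oo] --> 0 by apply: cvg_expr; rewrite ger0_norm; lra.
  move=> /cvgrPdist_le /(_ _ eps10) [n0 _ h]; exists n0 => l n /h /=.
  rewrite sub0r normrN => hq; have {}hq := le_trans (ler_norm _) hq.
  have := hT l n; rewrite ler_norml => /andP[+ _].
  have /andP[q0 q1] := pw n; have /andP[p0 p1] := pp l; rewrite -/(T l n); nra.
rewrite -(cvg_lim (@Rhausdorff R) cL); apply/andP; split.
  apply: limr_ge; first by apply/cvg_ex; eexists; exact: cL.
  apply: nearW => n; apply: le_trans (lowE n).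
  rewrite ler_expR !mulNr lerN2 ler_pM2l //.
  apply: (@le_trans _ _ (\sum_l (p l * e l + eps1 * e l))).
    apply: ler_sum => l _; rewrite -mulrDl; apply: ler_wpM2r => //; exact: T1.
  rewrite big_split /= -mulr_sumr -/E -/mean lerD2l.
  by have := mulr_ge0 (ler0n R N) (ltW eta0); have := mulr_ge0 (ltW eps10) E0; lra.
apply: limr_le; first by apply/cvg_ex; eexists; exact: cL.
exists n0 => // n /= hn; apply: (le_trans (uppE n)).
rewrite ler_expR !mulNr lerN2 ler_pM2l //.
apply: (@le_trans _ _ (\sum_l (p l * e l - (2 * eps1 * e l + eta)))).
  rewrite sumrB big_split /= -mulr_sumr -/E sumr_const card_ord -/mean.
  by rewrite -mulr_natl; lra.
apply: ler_sum => l _; have := hn0 l n hn; have := Tle1 l n; have := e0 l.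
move=> h1 h2 h3; have := ler_wpM2r h1 h3; have := ler_wpM2r (ltW eta0) h2; lra.
Unshelve. all: end_near. Qed.

End NonnegativeRows.

End GeometricArray.

Section WeakLaw.
Context {R : realType} d (Omega : measurableType d) (P : probability Omega R).
Context {N : nat}.

(** The worse side is [x > m], where the exponential decreases by at least
    [exp (- m) * (1 - exp (- eps))]; on the other side its increase exceeds
    [exp (- m) * (exp eps - 1)], which is larger. *)
Lemma expR_dist_ge (x m eps : R) : 0 < eps -> eps < `|x - m| ->
  (expR (- m) * (1 - expR (- eps))) ^+ 2 <= (expR (- x) - expR (- m)) ^+ 2.
Proof.
move=> e0 h; set c := expR (- m); set b := expR (- eps).
have c0 : 0 < c by exact: expR_gt0.
have b0 : 0 < b by exact: expR_gt0.
have b1 : b < 1 by rewrite /b expR_lt1 oppr_lt0.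
have cb : 0 <= c * (1 - b) by rewrite mulr_ge0 ?subr_ge0 ?ltW.
rewrite -[X in _ <= X]real_normK ?num_real //.
rewrite ler_sqr ?nnegrE //.
have [xm|mx] := leP m x.
  have {}h : m + eps < x by move: h; rewrite ger0_norm ?subr_ge0 //; lra.
  have : expR (- x) <= c * b by rewrite /c /b -expRD ler_expR; lra.
  by rewrite distrC => h1; apply: le_trans (ler_norm _); lra.
have {}h : x < m - eps by move: h; rewrite ltr0_norm ?subr_lt0 //; lra.
have h2 : c <= expR (- x) * b by rewrite /c /b -expRD ler_expR; lra.
have xc : 0 < expR (- x) by exact: expR_gt0.
apply: le_trans (ler_norm _).
have h3 : 0 <= (expR (- x) - c) * b by rewrite mulr_ge0 ?ltW // subr_gt0; nra.
have h4 : (expR (- x) - c) * (1 - b) >= 0.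
  by rewrite mulr_ge0 // ltW // subr_gt0; nra.
nra.
Qed.

Lemma markov_real (Y : Omega -> R) (A : set Omega) (b : R) : 0 < b ->
  measurable A -> real_integrable P Y -> (forall w, 0 <= Y w) ->
  (forall w, A w -> b <= Y w) -> (P A <= (b^-1 * \int[P]_w Y w)%:E)%E.
Proof.
move=> b0 mA Yi Y0 AY.
have iA : real_integrable P (\1_A) by exact: integrable_indic.
have -> : P A = (\int[P]_w \1_A w)%:E.
  by rewrite -(real_integrableE iA) integral_indic // setIT.
rewrite lee_fin -[leRHS]add0r; apply: expectation_le_affine => // w.
rewrite add0r indicE; case: (boolP (w \in A)) => [|_]; last first.
  by rewrite mulr_ge0 ?invr_ge0 // ltW.
rewrite inE => /AY h; by rewrite ler_pdivlMl // mulr1.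
Qed.

Lemma measurable_set_dist_gt (Y : Omega -> R) (m eps : R) :
  measurable_fun [set: Omega] Y -> measurable [set w | eps < `|Y w - m|].
Proof.
move=> mY; rewrite (_ : [set w | _] = ~` ([set: Omega] `&` [set w | `|Y w - m| <= eps])).
  apply: measurableC.
  apply: (measurable_fun_le (f := fun w => `|Y w - m|) (g := cst eps)) => //.
  apply: measurableT_comp => //; exact: measurable_funB.
by rewrite setTI; apply/seteqP; split => w /=; rewrite real_ltNge ?num_real // => /negP.
Qed.

Lemma near_step_size (K : realType) : \forall delta \near (0 : K)^'+, 0 < delta < 1.
Proof.
near=> delta; apply/andP; split; near: delta; first exact: nbhs_right_gt.
exact: nbhs_right_lt.
Unshelve. all: end_near. Qed.

Variables (a : nat -> 'I_N -> R) (p : 'I_N -> R).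
Hypothesis a01 : forall m l, 0 <= a m l <= 1.
Hypothesis acvg : forall l, a m l @[m --> \oo] --> p l.
Local Notation wt := (geometric_weight a).

Lemma weak_law_nonneg (X : 'I_N -> nat -> Omega -> R) : iid_rows P X ->
  (forall l m w, 0 <= X l m w) -> (forall l, real_integrable P (X l 0%N)) ->
  forall eps eta : R, 0 < eps -> 0 < eta ->
  \forall delta \near (0 : R)^'+,
    (P [set w | (eps < `|delta * array_lim X (wt delta) w -
       \sum_l p l * \int[P]_w X l 0%N w|)%R] <= eta%:E)%E.
Proof.
move=> iidX X0 Xi eps eta eps0 eta0; have [mX _ _] := iidX.
set m := (\sum_l p l * _)%R.
pose b := (expR (- m) * (1 - expR (- eps))) ^+ 2.
have b0 : 0 < b.
  by rewrite exprn_gt0 // mulr_gt0 ?expR_gt0 // subr_gt0 expR_lt1 oppr_lt0.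
pose C := expR (- 2 * m) ; have C0 : 0 < C by exact: expR_gt0.
(* If the transforms at 1 and 2 match those of the constant [m] up to a shift of the exponent by [r]
   per unit, the second moment of [exp (- lambda) - exp (- m)] is at most this expression, which
   vanishes at [r = 0]. *)
have [r [r0 hr]] : exists r, 0 < r /\ C * (expR (2 * r) - 2 * expR (- r) + 1) <= b * eta.
  have cv : (fun r : R => C * (expR (2 * r) - 2 * expR (- r) + 1)) @ 0 --> (0 : R).
    rewrite [X in _ --> X](_ : 0 = C * (expR (2 * 0) - 2 * expR (- 0) + 1)); last first.
      by rewrite mulr0 oppr0 expR0; ring.
    apply: cvgMr; apply: cvgD; last exact: cvg_cst.
    apply: cvgB.
      apply: (cvg_comp (fun r : R => 2 * r) expR); last exact: continuous_expR.
      by apply: cvgMr; exact: cvg_id.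
    apply: cvgMr; apply: (cvg_comp (fun r : R => - r) expR); last exact: continuous_expR.
    by apply: cvgN; exact: cvg_id.
  have be0 : 0 < b * eta by rewrite mulr_gt0.
  move/cvgrPdist_le : cv => /(_ _ be0) /nbhs_ballP [r /= r0 h].
  exists (r / 2); split; first by rewrite divr_gt0.
  have := h (r / 2); rewrite /ball /= !sub0r !normrN => h1.
  apply: le_trans (h1 _); first exact: ler_norm.
  by rewrite gtr0_norm ?divr_gt0 //; lra.
have h1 := laplace_geometric_array a01 acvg iidX X0 Xi ltr01 r0.
have h2 := laplace_geometric_array a01 acvg iidX X0 Xi (ltr0Sn R 1) r0.
apply: filterS2 h1 h2 => delta [i1 /andP[l1 _]] [i2 /andP[_ u2]].
rewrite -/m mulNr mul1r in l1; rewrite -/m in u2.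
set L := array_lim X (wt delta) in i1 i2 l1 u2 *.
have mL : measurable_fun [set: Omega] L by exact: measurable_array_lim.
pose Y w := (expR (- (delta * L w)) - expR (- m)) ^+ 2.
have YE w : Y w = (expR (- (2 * delta) * L w) + (- 2 * expR (- m)) * expR (- (1 * delta) * L w)) + 1 * C.
  rewrite /Y /C.
  have -> : expR (- (2 * delta) * L w) = expR (- (delta * L w)) ^+ 2.
    by rewrite expr2 -expRD; congr expR; ring.
  have -> : expR (- 2 * m) = expR (- m) ^+ 2.
    by rewrite expr2 -expRD; congr expR; ring.
  have -> : expR (- (1 * delta) * L w) = expR (- (delta * L w)) by congr expR; ring.
  ring.
have i1' : real_integrable P (fun w => (- 2 * expR (- m)) * expR (- (1 * delta) * L w)).
  exact: real_integrableZ.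
have i12 := real_integrableD i2 i1'.
have ic : real_integrable P (fun w => 1 * C) by exact: real_integrable_cst.
have Yi : real_integrable P Y.
  have := real_integrableD i12 ic; congr real_integrable.
  by apply/funext => w; rewrite YE.
apply: (le_trans (@markov_real Y _ b b0 _ Yi _ _)).
- by apply: measurable_set_dist_gt; exact: measurable_funM.
- by move=> w; exact: sqr_ge0.
- by move=> w /= h; exact: expR_dist_ge.
rewrite lee_fin ler_pdivrMl //; apply: le_trans hr.
rewrite (_ : Y = fun w => C + 1 *
  (expR (- (2 * delta) * L w) + (- 2 * expR (- m)) * expR (- (1 * delta) * L w))); last first.
  by apply/funext => w; rewrite YE; ring.
rewrite expectation_affine // mul1r RintegralD // RintegralZl //.
set I2 := \int[P]_w _ in u2 *; set I1 := \int[P]_w _ in l1 *.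
have l1' : C * expR (- r) <= expR (- m) * I1.
  apply: (@le_trans _ _ (expR (- m) * expR (- (m + r)))).
    by rewrite -!expRD ler_expR; lra.
  by rewrite ler_wpM2l // expR_ge0.
have u2' : I2 <= C * expR (2 * r).
  by apply: (le_trans u2); rewrite -expRD ler_expR; lra.
lra.
Qed.

Lemma weak_law (X : 'I_N -> nat -> Omega -> R) : iid_rows P X ->
  (forall l, real_integrable P (X l 0%N)) ->
  forall eps eta : R, 0 < eps -> 0 < eta ->
  \forall delta \near (0 : R)^'+,
    (P [set w | (eps < `|delta * array_lim X (wt delta) w -
       \sum_l p l * \int[P]_w X l 0%N w|)%R] <= eta%:E)%E.
Proof.
move=> iidX Xi eps eta eps0 eta0; have [mX _ _] := iidX.
pose pos (x : R) := Num.max x 0; pose neg (x : R) := Num.max (- x) 0.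
have mpos : measurable_fun [set: R] pos by exact: measurable_maxr.
have mneg : measurable_fun [set: R] neg.
  by apply: measurable_maxr => //; exact: measurable_funN.
have posneg x : x = pos x - neg x.
  by rewrite /pos /neg; case: (leP x 0) => x0; case: (leP (-x) 0) => ?; lra.
have pos0 x : 0 <= pos x by rewrite /pos le_max lexx orbT.
have neg0 x : 0 <= neg x by rewrite /neg le_max lexx orbT.
have posle x : `|pos x| <= `|x|.
  by rewrite ger0_norm // /pos ge_max ler_norm normr_ge0.
have negle x : `|neg x| <= `|x|.
  by rewrite ger0_norm // /neg ge_max -normrN ler_norm normr_ge0.
pose Xp l m w := pos (X l m w); pose Xn l m w := neg (X l m w).
have iidp : iid_rows P Xp := iid_rows_comp mpos iidX.
have iidn : iid_rows P Xn := iid_rows_comp mneg iidX.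
have Xpi l : real_integrable P (Xp l 0%N).
  by apply: le_real_integrable (Xi l); [exact: (measurableT_comp mpos (mX l 0%N))|
    move=> w; exact: posle].
have Xni l : real_integrable P (Xn l 0%N).
  by apply: le_real_integrable (Xi l); [exact: (measurableT_comp mneg (mX l 0%N))|
    move=> w; exact: negle].
have eps2 : 0 < eps / 2 by rewrite divr_gt0.
have eta2 : 0 < eta / 2 by rewrite divr_gt0.
have hp := weak_law_nonneg iidp (fun _ _ _ => pos0 _) Xpi eps2 eta2.
have hn := weak_law_nonneg iidn (fun _ _ _ => neg0 _) Xni eps2 eta2.
apply: filterS3 (near_step_size R) hp hn => delta /andP[d0 d1] h1 h2.
have cp := ae_cvgn_geometric a01 iidp Xpi d0 d1.
have cn := ae_cvgn_geometric a01 iidn Xni d0 d1.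
(* Limits can be subtracted only where both series converge; the null set [Z] joins the two
   deviation events in the union bound. *)
have [Z [mZ PZ hZ]] : \forall w \ae P,
    array_lim X (wt delta) w = array_lim Xp (wt delta) w - array_lim Xn (wt delta) w.
  apply: filterS2 cp cn => w cpw cnw; apply/cvg_lim => //.
  rewrite (_ : (fun n => _) = fun n => array_sum Xp (wt delta) n w - array_sum Xn (wt delta) n w).
    by apply: cvgB.
  apply/funext => n; rewrite !array_sumE -sumrB; apply: eq_bigr => m _.
  rewrite -sumrB; apply: eq_bigr => l _.
  by rewrite -mulrBr -posneg.
set A := [set w | _]; set A1 := [set w | _] in h1; set A2 := [set w | _] in h2.
have mL Y : (forall l m, measurable_fun [set: Omega] (Y l m)) ->
    measurable_fun [set: Omega] (fun w => delta * array_lim Y (wt delta) w).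
  by move=> mY; apply: measurable_funM => //; exact: measurable_array_lim.
have [mXp _ _] := iidp; have [mXn _ _] := iidn.
have mA : measurable A by apply: measurable_set_dist_gt; exact: mL.
have mA1 : measurable A1 by apply: measurable_set_dist_gt; exact: mL.
have mA2 : measurable A2 by apply: measurable_set_dist_gt; exact: mL.
apply: (@le_trans _ _ (P (A1 `|` A2 `|` Z))).
  have mU : measurable (A1 `|` A2 `|` Z).
    by apply: measurableU => //; exact: measurableU.
  apply: le_measure; rewrite ?inE //.
  move=> w Aw; have [Zw|nZw] := pselect (Z w); [by right|left].
  have {}hZ : array_lim X (wt delta) w = array_lim Xp (wt delta) w - array_lim Xn (wt delta) w.
    by apply: contrapT => h; apply: nZw; apply: hZ.
  move: Aw; rewrite /A /= hZ.
  have -> : \sum_l p l * \int[P]_w X l 0%N w =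
      \sum_l p l * \int[P]_w Xp l 0%N w - \sum_l p l * \int[P]_w Xn l 0%N w.
    rewrite -sumrB; apply: eq_bigr => l _; rewrite -mulrBr -(RintegralB measurableT (Xpi l) (Xni l)).
    by congr (_ * _); apply: eq_Rintegral => w' _; rewrite -posneg.
  set x := array_lim Xp _ _; set y := array_lim Xn _ _; set u := \sum_l _; set v := \sum_l _.
  move=> h; rewrite /A1 /A2 /=.
  have [?|g1] := ltP (eps / 2) `|delta * x - u|; first by left.
  have [?|g2] := ltP (eps / 2) `|delta * y - v|; first by right.
  have := ler_normB (delta * x - u) (delta * y - v).
  rewrite (_ : _ - _ - _ = delta * (x - y) - (u - v)); last by ring.
  lra.
apply: (le_trans (measureU2 _ _ _)) => //; first exact: measurableU.
rewrite [X in (_ + X)%E]PZ adde0; apply: (le_trans (measureU2 _ _ _)) => //.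
by rewrite (splitr eta) EFinD leeD.
Qed.

End WeakLaw.

(** * Logarithmic moment generating functions *)

Section LogMomentGenerating.
Context {R : realType} d (Omega : measurableType d) (P : probability Omega R).
Variable Y : Omega -> R.
Hypothesis Yi : real_integrable P Y.
Hypothesis Ye : forall t, real_integrable P (fun w => expR (t * Y w)).

Definition log_mgf (t : R) : R := ln (\int[P]_w expR (t * Y w)).

Lemma mgf_gt0 t : 0 < \int[P]_w expR (t * Y w).
Proof. exact: lt_le_trans (expR_gt0 _) (expectation_expR_ge Yi (Ye t)). Qed.

Lemma log_mgfK t : expR (log_mgf t) = \int[P]_w expR (t * Y w).
Proof. by rewrite lnK // posrE mgf_gt0. Qed.

Lemma log_mgf_ge_mean t : t * \int[P]_w Y w <= log_mgf t.
Proof. by rewrite -ler_expR log_mgfK; exact: expectation_expR_ge. Qed.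

Lemma log_mgf0 : log_mgf 0 = 0.
Proof.
rewrite /log_mgf (_ : (fun w => _) = fun=> 1); last first.
  by apply/funext => w; rewrite mul0r expR0.
by rewrite Rintegral_cst // [X in fine X]probability_setT mulr1 ln1.
Qed.

(** Hölder's inequality by normalization: subtracting [x] and [y] from the exponents gives both
    exponentials mean 1, and the pointwise convexity of the exponential is then integrated. *)
Lemma log_mgf_convex : convex_on_line log_mgf.
Proof.
move=> b s t b0 b1.
rewrite -ler_expR log_mgfK.
have [x xE] : exists x, x = log_mgf s := ex_intro _ _ erefl.
have [y yE] : exists y, y = log_mgf t := ex_intro _ _ erefl.
rewrite -xE -yE; set z := b * x + (1 - b) * y.
have h := @expectation_le_affine _ _ _ P 0 1
  (fun w => expR ((b * s + (1 - b) * t) * Y w))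
  (fun w => (expR z * b * expR (- x)) * expR (s * Y w) +
            (expR z * (1 - b) * expR (- y)) * expR (t * Y w)) (Ye _).
have i1 := real_integrableZ (expR z * b * expR (- x)) (Ye s).
have i2 := real_integrableZ (expR z * (1 - b) * expR (- y)) (Ye t).
apply: (le_trans (h (real_integrableD i1 i2) _)) => [w|].
  rewrite add0r mul1r.
  rewrite (_ : (b * s + (1 - b) * t) * Y w =
    z + (b * (s * Y w - x) + (1 - b) * (t * Y w - y))); last by rewrite /z; ring.
  rewrite expRD.
  have := expR_convex (s * Y w - x) (t * Y w - y) b0 b1.
  move=> /(ler_wpM2l (expR_ge0 z)) hh; apply: (le_trans hh).
  rewrite !expRD; move: (expR z) (expR (s * Y w)) (expR (t * Y w)) (expR (- x)) (expR (- y)).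
  by move=> ez es et ex ey; rewrite le_eqVlt; apply/orP; left; apply/eqP; ring.
rewrite add0r mul1r (RintegralD measurableT i1 i2).
rewrite (RintegralZl _ measurableT (Ye s)) (RintegralZl _ measurableT (Ye t)).
rewrite -!log_mgfK -xE -yE -!(mulrA _ (expR (- _))) -!expRD !addNr expR0 !mulr1.
by rewrite -mulrDr (_ : b + (1 - b) = 1) ?mulr1 //; ring.
Qed.

Lemma log_mgf_slope eps : 0 < eps -> exists2 u0, 0 < u0 & forall u, 0 <= u ->
  u <= u0 -> log_mgf (- u) <= - u * (\int[P]_w Y w - eps).
Proof.
move=> eps0.
have e1 : real_integrable P (fun w => expR (- Y w)).
  by have := Ye (- 1); congr real_integrable; apply/funext => w; rewrite mulN1r.
have [u0 [u00 _ h]] := expectation_expR_slope Yi e1 eps0.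
exists u0 => // u; rewrite le_eqVlt => /predU1P[<- _|up uu].
  by rewrite oppr0 log_mgf0 mul0r.
rewrite -ler_expR log_mgfK.
have [_ hu] := h u up uu; apply: le_trans (expR_ge1Dx _).
rewrite (_ : (fun w => expR (- u * Y w)) = fun w => expR (- (u * Y w))).
  by rewrite mulNr.
by apply/funext => w; rewrite mulNr.
Qed.

(** For [t < 0], [exp (t * Y)] dominates [- t] times the negative part of [Y], so a nontrivial
    negative part pushes the transform above 1 far to the left. *)
Lemma log_mgf_gt0 t : real_integrable P (fun w => Num.max (- Y w) 0) ->
  t < 0 -> 1 < - t * \int[P]_w Num.max (- Y w) 0 -> 0 < log_mgf t.
Proof.
move=> ni t0 h; apply: ln_gt0; apply: (lt_le_trans h).
rewrite -[leLHS]add0r; apply: affine_le_expectation => // w.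
rewrite add0r; case: (leP (- Y w) 0) => yw; first by rewrite mulr0 expR_ge0.
rewrite mulrNN; have := expR_ge1Dx (t * Y w); lra.
Qed.

(** The point is the exponent linear in [u]: a product of such bounds depends only on the sum of the
    weights. It comes from the chord of [u] to [exp (u * |Y|)] between 0 and [U]. *)
Lemma expectation_expR_abs_le (U : R) : 0 < U -> exists2 K, 0 <= K &
  forall u, 0 <= u -> u <= U -> real_integrable P (fun w => expR (u * `|Y w|)) /\
    \int[P]_w expR (u * `|Y w|) <= expR (u * K).
Proof.
move=> U0; have mY := real_integrable_measurable Yi.
have iU : real_integrable P (fun w => expR (U * `|Y w|)).
  have := real_integrableD (Ye U) (Ye (- U)); apply: le_real_integrable.
    apply: measurableT_comp => //; apply: measurable_funM => //.
    exact: measurableT_comp.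
  move=> w; rewrite (ger0_norm (expR_ge0 _)) (ger0_norm (addr_ge0 (expR_ge0 _) (expR_ge0 _))).
  have [y0|y0] := leP 0 (Y w); first by rewrite (ger0_norm y0) lerDl expR_ge0.
  by rewrite (ltr0_norm y0) mulrN mulNr lerDr expR_ge0.
pose K := (\int[P]_w expR (U * `|Y w|) - 1) / U.
have K0 : 0 <= K.
  apply: divr_ge0; last exact: ltW.
  rewrite subr_ge0.
  have h := @affine_le_expectation _ _ _ P 1 0 _ _ Yi iU.
  rewrite mul0r addr0 in h; apply: h => w; rewrite mul0r addr0.
  by rewrite -expR0 ler_expR mulr_ge0 // ltW.
exists K => // u u0 uU.
have mu : measurable_fun [set: Omega] (fun w => expR (u * `|Y w|)).
  apply: measurableT_comp => //; apply: measurable_funM => //.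
  exact: measurableT_comp.
have iu : real_integrable P (fun w => expR (u * `|Y w|)).
  apply: le_real_integrable iU => // w; rewrite !(ger0_norm (expR_ge0 _)).
  by rewrite ler_expR ler_wpM2r.
split => //; apply: le_trans (expR_ge1Dx _).
rewrite (_ : 1 + u * K = (1 - u / U) + (u / U) * \int[P]_w expR (U * `|Y w|)); last first.
  by rewrite /K; field; rewrite gt_eqF.
apply: expectation_le_affine => // w.
have au : 0 <= u / U by rewrite divr_ge0 // ltW.
have au1 : u / U <= 1 by rewrite ler_pdivrMr // mul1r.
have := expR_convex (U * `|Y w|) 0 au au1.
rewrite mulr0 addr0 expR0 mulr1 (_ : u / U * (U * _) = u * `|Y w|); last first.
  by field; rewrite gt_eqF.
lra.
Qed.

End LogMomentGenerating.

(** * Exponential moments of the geometric series *)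

Section GeometricArrayMgf.
Context {R : realType} d (Omega : measurableType d) (P : probability Omega R).
Context {N : nat}.
Variable X : 'I_N -> nat -> Omega -> R.
Hypothesis iidX : iid_rows P X.
Hypothesis Xi : forall l, real_integrable P (X l 0%N).
Hypothesis Xe : forall l t, real_integrable P (fun w => expR (t * X l 0%N w)).
Variables (a : nat -> 'I_N -> R) (p : 'I_N -> R).
Hypothesis a01 : forall m l, 0 <= a m l <= 1.
Hypothesis acvg : forall l, a m l @[m --> \oo] --> p l.
Hypothesis p01 : forall l, 0 <= p l <= 1.
Local Notation wt := (geometric_weight a).
Local Notation Lambda l := (log_mgf P (X l 0%N)).

(** The terms have no sign, so the partial sums are dominated through the series of absolute values:
    [exp (|t| * Y n)] increases with [n] to [D], whose expectation is finite because the weights sum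
    to at most [N / delta]. *)
Lemma geometric_array_mgf t delta : 0 < delta -> delta < 1 ->
  real_integrable P (fun w => expR (t * array_lim X (wt delta) w)) /\
  expR (\sum_(m < n) \sum_l Lambda l (t * wt delta m l)) @[n --> \oo] -->
    \int[P]_w expR (t * array_lim X (wt delta) w).
Proof.
move=> d0 d1; have [mX _ _] := iidX; have aa := a01.
pose Y n w := array_sum (fun l m w => `|X l m w|) (fun m l => `|wt delta m l|) n w.
have iidN : iid_rows P (fun l m w => `|X l m w|).
  exact: (iid_rows_comp (@normr_measurable _ setT) iidX).
have [mN _ _] := iidN.
have U0 : 0 < `|t| + 1 by rewrite ltr_wpDl.
have wt01 m l := geometric_weight_bounds a01 m l d0 d1.
have [K K0 hK] : exists2 K, 0 <= K & forall l u, 0 <= u -> u <= `|t| + 1 ->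
    real_integrable P (fun w => expR (u * `|X l 0%N w|)) /\
    \int[P]_w expR (u * `|X l 0%N w|) <= expR (u * K).
  have key l := expectation_expR_abs_le (Xi l) (Xe l) U0.
  pose k l := projT1 (cid2 (key l)).
  have hk l : 0 <= k l /\ forall u, 0 <= u -> u <= `|t| + 1 ->
    real_integrable P (fun w => expR (u * `|X l 0%N w|)) /\
    \int[P]_w expR (u * `|X l 0%N w|) <= expR (u * k l).
    by rewrite /k; case: cid2.
  exists (\sum_l k l); first by apply: sumr_ge0 => l _; exact: (hk l).1.
  move=> l u u0 uU; have [k0 /(_ u u0 uU)[iu hu]] := hk l.
  split => //; apply: (le_trans hu); rewrite ler_expR ler_wpM2l //.
  rewrite (bigD1 l isT) /= lerDl; apply: sumr_ge0 => j _; exact: (hk j).1.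
have tw m l : 0 <= `|t| * `|wt delta m l| <= `|t| + 1.
  rewrite mulr_ge0 //=; have /andP[w0 w1] := wt01 m l; rewrite (ger0_norm w0).
  by apply: (@le_trans _ _ `|t|); [rewrite ler_piMr|rewrite lerDl].
have EY n : (\int[P]_w (expR (`|t| * Y n w))%:E <= (expR (`|t| * K * (N%:R / delta)))%:E)%E.
  rewrite (@expectation_expR_array_sum _ _ _ P _ _ (fun m l => `|wt delta m l|) n `|t| iidN); last first.
    move=> l m; have /andP[t0 t1] := tw m l.
    by have [/real_integrableE -> _] := hK l _ t0 t1; rewrite ltry.
  rewrite lee_fin.
  apply: (@le_trans _ _ (expR (\sum_(m < n) \sum_l `|t| * `|wt delta m l| * K))).
    rewrite expR_sum; apply: ler_prod => m _.
    have i0 l : 0 <= \int[P]_w expR (`|t| * `|wt delta m l| * `|X l 0%N w|).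
      by apply: Rintegral_ge0 => w _; exact: expR_ge0.
    rewrite expR_sum; apply/andP; split; first by apply: prodr_ge0 => l _; exact: i0.
    apply: ler_prod => l _; apply/andP; split; first exact: i0.
    by have /andP[t0 t1] := tw m l; have [_] := hK l _ t0 t1.
  rewrite ler_expR; apply: (@le_trans _ _ (`|t| * K * \sum_(m < n) \sum_l `|wt delta m l|)).
    rewrite mulr_sumr; apply: ler_sum => m _; rewrite mulr_sumr.
    by apply: ler_sum => l _; rewrite mulrAC.
  by apply: ler_wpM2l; [exact: mulr_ge0|exact: geometric_weight_sum].
have YS n w : expR (t * array_sum X (wt delta) n w) <= expR (`|t| * Y n w).
  rewrite ler_expR; apply: (le_trans (ler_norm _)); rewrite normrM ler_wpM2l //.
  rewrite /Y !array_sumE; apply: (le_trans (ler_norm_sum _ _ _)).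
  apply: ler_sum => m _; apply: (le_trans (ler_norm_sum _ _ _)).
  by apply: ler_sum => l _; rewrite normrM.
have ndY w : {homo (fun n => (expR (`|t| * Y n w))%:E) : n m / (n <= m)%N >-> (n <= m)%E}.
  move=> n m nm; rewrite lee_fin ler_expR ler_wpM2l // /Y /array_sum.
  apply: nondecreasing_series => // k _ _.
  by apply: sumr_ge0 => l _; rewrite mulr_ge0.
have mEY n : measurable_fun [set: Omega] (fun w => (expR (`|t| * Y n w))%:E).
  apply/measurable_EFinP; apply: measurableT_comp => //; apply: measurable_funM => //.
  exact: measurable_array_sum.
have cY w : cvgn (fun n => (expR (`|t| * Y n w))%:E) by exact: ereal_nondecreasing_is_cvgn.
pose D w := limn (fun n => (expR (`|t| * Y n w))%:E).
have D0 w : (0 <= D w)%E.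
  by apply: lime_ge => //; apply: nearW => n; rewrite lee_fin expR_ge0.
have mD : measurable_fun [set: Omega] D.
  apply: (emeasurable_fun_cvg (fun n w => (expR (`|t| * Y n w))%:E)) => [n|w _].
    exact: mEY.
  exact: (cY w).
have iD : P.-integrable [set: Omega] D.
  apply/integrableP; split => //.
  under eq_integral do rewrite gee0_abs //.
  apply: (@le_lt_trans _ _ (expR (`|t| * K * (N%:R / delta)))%:E); last by rewrite ltry.
  have h := @cvg_monotone_convergence _ _ _ P _ measurableT
    (fun n w => (expR (`|t| * Y n w))%:E) mEY.
  have {}h := h (fun n w _ => expR_ge0 _) (fun w _ => ndY w).
  rewrite -(cvg_lim _ h) //; apply: lime_le.
    by apply/cvg_ex; eexists; exact: h.
  by apply: nearW => n; exact: EY.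
have YD n w : ((expR (t * array_sum X (wt delta) n w))%:E <= D w)%E.
  apply: (@le_trans _ _ (expR (`|t| * Y n w))%:E); first by rewrite lee_fin.
  by apply: lime_ge => //; exists n => // m /= nm; exact: ndY.
have cX := ae_cvgn_geometric a01 iidX Xi d0 d1.
have [iL cL] := expectation_expR_array_lim mX cX iD YD.
split => //; rewrite (_ : (fun n => expR _) =
    fun n => \int[P]_w expR (t * array_sum X (wt delta) n w)) //.
apply/funext => n; apply: EFin_inj.
rewrite -real_integrableE; last first.
  apply: real_integrable_ge0.
  - by apply: measurableT_comp => //; apply: measurable_funM => //; exact: measurable_array_sum.
  - by move=> w; exact: expR_ge0.
  - apply: (@le_lt_trans _ _ (expR (`|t| * K * (N%:R / delta)))%:E); last by rewrite ltry.
    apply: le_trans (EY n).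
    have mS : measurable_fun [set: Omega] (fun w => (expR (t * array_sum X (wt delta) n w))%:E).
      apply/measurable_EFinP; apply: measurableT_comp => //; apply: measurable_funM => //.
      exact: measurable_array_sum.
    apply: (ge0_le_integral P measurableT _ mS (mEY n)) => w _.
      by rewrite lee_fin expR_ge0.
    by rewrite lee_fin.
rewrite (@expectation_expR_array_sum _ _ _ P _ _ (wt delta) n t iidX); last first.
  by move=> l m; rewrite (real_integrableE (Xe l _)) ltry.
congr EFin; rewrite expR_sum; apply: eq_bigr => m _.
rewrite expR_sum; apply: eq_bigr => l _.
exact: log_mgfK.
Qed.

(** The real-valued form of [Lambda_ave]. *)
Definition mean_log_mgf (t : R) : R := \sum_l Lambda l (p l * t).
Local Notation F := mean_log_mgf.

Lemma mean_log_mgf_convex : convex_on_line F.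
Proof.
apply: (convex_on_line_sum (F := fun l => Lambda l)) => l.
exact: log_mgf_convex.
Qed.

Lemma mean_log_mgf0 : F 0 = 0.
Proof. by rewrite /F big1 // => l _; rewrite mulr0 log_mgf0. Qed.

Lemma mean_log_mgf_ge_mean t :
  t * (\sum_l p l * \int[P]_w X l 0%N w) <= F t.
Proof.
rewrite mulr_sumr; apply: ler_sum => l _; rewrite mulrCA mulrA.
exact: log_mgf_ge_mean.
Qed.

Variable phi : R -> R.
Hypothesis phi_slope : forall s u, s < u -> u < 0 ->
  F s / s * (u - s) <= phi u - phi s <= F u / u * (u - s).
Hypothesis phi_small : forall t, t < 0 ->
  exists C, forall s, t <= s < 0 -> `|phi s| <= C * `|s|.

(** Two replacements: the weights [a m l] by their limits [p l], at a cost that is the Abel mean of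
    a null sequence times a Lipschitz constant; then the resulting geometric Riemann sum by [phi t].
    [phi] stands for the antiderivative of [F s / s] vanishing at 0 from the left, known only
    through the two preceding hypotheses. *)
Lemma geometric_array_mgf_asymptotics t eps : t < 0 -> 0 < eps ->
  \forall delta \near (0 : R)^'+,
    expR ((phi t - eps) / delta) <=
      \int[P]_w expR (t * array_lim X (wt delta) w) <=
    expR ((phi t + eps) / delta).
Proof.
(* Here [x] is the scaled logarithm of the truncated transform, [y] the Riemann sum, [z] the value
   of [phi] at the last grid point, [q] the Riemann error and [u] the target [phi t]. *)
have aux (x y z q u : R) : - (eps / 4) <= z -> z <= eps / 4 ->
    - (eps / 4) <= x - y -> x - y <= eps / 4 -> u - z <= y -> y <= u - z + q ->
    q <= eps / 4 -> u - eps <= x <= u + eps.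
  by move=> *; apply/andP; split; lra.
move=> t0 eps0; have aa := a01; have pp := p01.
have T0 : 0 < - t by rewrite oppr_gt0.
have [Cl hCl] : exists2 Cl, 0 <= Cl & forall l s u, - - t <= s <= - t -> - - t <= u <= - t ->
    `|Lambda l s - Lambda l u| <= Cl * `|s - u|.
  have key l := convex_lipschitz (log_mgf_convex (Xi l) (Xe l)) T0.
  pose k l := projT1 (cid2 (key l)).
  have hk l : 0 <= k l /\ forall s u, - - t <= s <= - t -> - - t <= u <= - t ->
    `|Lambda l s - Lambda l u| <= k l * `|s - u| by rewrite /k; case: cid2.
  exists (\sum_l k l); first by apply: sumr_ge0 => l _; exact: (hk l).1.
  move=> l s u hs hu; have [k0 h] := hk l; apply: (le_trans (h _ _ hs hu)).
  apply: ler_wpM2r; first exact: normr_ge0.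
  rewrite (bigD1 l isT) /= lerDl; apply: sumr_ge0 => j _; exact: (hk j).1.
rewrite opprK => hLip.
have [C C0 hC] := convex_lipschitz mean_log_mgf_convex T0.
have [C' hC'] := phi_small t0.
pose e m := \sum_l `|a m l - p l|.
have e0 m : 0 <= e m <= \sum_(l < N) 1.
  rewrite sumr_ge0 //=; apply: ler_sum => l _.
  have /andP[? ?] := aa m l; have /andP[? ?] := pp l.
  by rewrite ler_norml; apply/andP; split; lra.
have ecvg : e @ \oo --> 0.
  rewrite (_ : 0 = \sum_(l < N) `|p l - p l|); last first.
    by rewrite big1 // => l _; rewrite subrr normr0.
  apply: cvg_big => [|l _]; first exact: add_continuous.
  apply: cvg_norm; apply: cvgB; first exact: acvg.
  exact: cvg_cst.
pose eps1 := eps / (4 * (Cl * - t + 1)).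
have CT : 0 < Cl * - t + 1 by rewrite ltr_wpDl // mulr_ge0 // ltW.
have eps10 : 0 < eps1 by rewrite divr_gt0 // mulr_gt0.
have eps1E : Cl * - t * eps1 <= eps / 4.
  have : (Cl * - t + 1) * eps1 = eps / 4 by rewrite /eps1; field; rewrite gt_eqF.
  nra.
have abel := abel_mean_small e0 ecvg eps10.
have CC : 0 < 8 * (C * - t + 1) by rewrite mulr_gt0 // ltr_wpDl // mulr_ge0 // ltW.
near=> delta.
have d0 : 0 < delta by near: delta; exact: nbhs_right_gt.
have d1 : delta < 1 by near: delta; exact: nbhs_right_lt.
have dC : delta <= eps / (8 * (C * - t + 1)).
  by near: delta; apply: nbhs_right_le; rewrite divr_gt0.
have hab n : delta * \sum_(m < n) (1 - delta) ^+ m * e m <= eps1.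
  by move: n; near: delta; exact: abel.
have pw n : 0 < (1 - delta) ^+ n <= 1.
  by rewrite exprn_gt0 ?exprn_ile1 //; lra.
have Fle s : t <= s < 0 -> `|F s| <= C * `|s|.
  move=> /andP[ts s0]; have := hC s 0; rewrite mean_log_mgf0 !subr0; apply.
    by apply/andP; split; lra.
  by apply/andP; split; lra.
have riem n := abel_riemann_sum mean_log_mgf_convex mean_log_mgf0 t0 Fle phi_slope n d0 d1.
have close n : `|delta * \sum_(m < n) \sum_l Lambda l (t * wt delta m l) -
    delta * \sum_(m < n) F ((1 - delta) ^+ m * t)| <= eps / 4.
  rewrite -mulrBr -sumrB normrM (gtr0_norm d0).
  apply: (@le_trans _ _ (Cl * - t * (delta * \sum_(m < n) (1 - delta) ^+ m * e m))); last first.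
    apply: le_trans eps1E; apply: ler_wpM2l => //.
    by rewrite mulr_ge0 // ltW.
  rewrite mulrCA ler_pM2l // mulr_sumr; apply: (le_trans (ler_norm_sum _ _ _)).
  apply: ler_sum => m _; rewrite /F -sumrB; apply: (le_trans (ler_norm_sum _ _ _)).
  rewrite /e !mulr_sumr; apply: ler_sum => l _.
  have /andP[q0 q1] := pw m; have /andP[x0 x1] := aa m l; have /andP[y0 y1] := pp l.
  have in1 (z : R) : 0 <= z -> z <= 1 -> t <= t * ((1 - delta) ^+ m * z) <= - t.
    move=> z0 z1; set y := _ * z.
    have yy0 : 0 <= y by rewrite mulr_ge0 // ltW.
    have yy1 : y <= 1 by rewrite mulr_ile1 // ltW.
    by apply/andP; split; nra.
  apply: (le_trans (hLip l _ _ _ _)).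
  - exact: in1.
  - by rewrite (_ : p l * _ = t * ((1 - delta) ^+ m * p l)); [exact: in1|ring].
  rewrite -mulrA ler_wpM2l // /geometric_weight.
  rewrite (_ : t * _ - _ = t * ((1 - delta) ^+ m * (a m l - p l))); last by ring.
  by rewrite !normrM (ltr0_norm t0) (ger0_norm (ltW q0)).
have dC8 : delta * (2 * C * `|t|) <= eps / 4.
  rewrite (ltr0_norm t0); move: dC; rewrite ler_pdivlMr // => dC.
  have h : 0 <= delta by exact: ltW.
  have : delta * (8 * (C * - t)) <= delta * (8 * (C * - t + 1)).
    by rewrite ler_wpM2l //; lra.
  lra.
have [_ cL] := geometric_array_mgf t d0 d1.
(* The part of the integral between the last grid point and 0 vanishes as [n] grows, by
   [phi_small]. *)
have [n0 hn0] : exists n0, forall n, (n0 <= n)%N -> `|phi ((1 - delta) ^+ n * t)| <= eps / 4.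
  have C1 : 0 < (`|C'| + 1) * - t by rewrite mulr_gt0 // ltr_wpDl.
  have e4 : 0 < eps / 4 / ((`|C'| + 1) * - t) by rewrite divr_gt0 // divr_gt0.
  have : (1 - delta) ^+ n @[n --> \oo] --> 0 by apply: cvg_expr; rewrite ger0_norm; lra.
  move=> /cvgrPdist_le /(_ _ e4) [n0 _ h]; exists n0 => n /h /=.
  have /andP[q0 q1] := pw n.
  rewrite sub0r normrN (gtr0_norm q0) ler_pdivlMr // => hq.
  have qt : t <= (1 - delta) ^+ n * t < 0 by apply/andP; split; nra.
  apply: (le_trans (hC' _ qt)); rewrite normrM (gtr0_norm q0) (ltr0_norm t0).
  apply: le_trans hq; rewrite mulrCA ler_wpM2l ?(ltW q0) //.
  rewrite ler_wpM2r ?(ltW T0) //; have := ler_norm C'; lra.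
have bounds n : (n0 <= n)%N ->
    phi t - eps <= delta * (\sum_(m < n) \sum_l Lambda l (t * wt delta m l)) <= phi t + eps.
  move=> nn; have := hn0 n nn; rewrite ler_norml => /andP[f1 f2].
  have := close n; rewrite ler_norml => /andP[g1 g2].
  have /andP[r1 r2] := riem n.
  exact: aux f1 f2 g1 g2 r1 r2 dC8.
rewrite -(cvg_lim (@Rhausdorff R) cL); apply/andP; split.
  apply: limr_ge; first by apply/cvg_ex; eexists; exact: cL.
  exists n0 => // n /= /bounds /andP[h _].
  by rewrite ler_expR ler_pdivrMr // mulrC.
apply: limr_le; first by apply/cvg_ex; eexists; exact: cL.
exists n0 => // n /= /bounds /andP[_ h].
by rewrite ler_expR ler_pdivlMr // mulrC.
Unshelve. all: end_near. Qed.

End GeometricArrayMgf.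

(** * The large deviation estimate *)

Section LargeDeviation.
Context {R : realType} d (Omega : measurableType d) (P : probability Omega R).

Lemma prob_nonpos_le (S : Omega -> R) t : measurable_fun [set: Omega] S -> t < 0 ->
  real_integrable P (fun w => expR (t * S w)) ->
  (P [set w | S w <= 0]%R <= (\int[P]_w expR (t * S w))%:E)%E.
Proof.
move=> mS t0 ie; rewrite -[in leRHS](mul1r (\int[P]_w _)) -[1 in leRHS]invr1.
apply: markov_real => //.
- rewrite -[X in measurable X]setTI.
  by apply: (measurable_fun_le (f := S) (g := cst 0)).
- by move=> w /= Sw; rewrite -expR0 ler_expR; have := ler_wnM2l (ltW t0) Sw; rewrite mulr0.
Qed.

(* If [S > 0], or if [S < b], then [exp (t S)] is dominated by the exponential
   with a slope shifted by [h], and otherwise it is at most [exp (t b)]. *)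
Lemma prob_nonpos_ge (S : Omega -> R) t h b : measurable_fun [set: Omega] S ->
  t < 0 -> 0 < h ->
  real_integrable P (fun w => expR (t * S w)) ->
  real_integrable P (fun w => expR ((t + h) * S w)) ->
  real_integrable P (fun w => expR ((t - h) * S w)) ->
  ((expR (- (t * b)) * (\int[P]_w expR (t * S w) - \int[P]_w expR ((t + h) * S w)
     - expR (h * b) * \int[P]_w expR ((t - h) * S w)))%:E <= P [set w | S w <= 0]%R)%E.
Proof.
move=> mS t0 h0 i0 i1 i2; set A := [set w | _].
have mA : measurable A.
  rewrite -[X in measurable X]setTI.
  by apply: (measurable_fun_le (f := S) (g := cst 0)).
have iA : real_integrable P (\1_A) by exact: integrable_indic.
have -> : P A = (\int[P]_w \1_A w)%:E.
  by rewrite -(real_integrableE iA) integral_indic // setIT.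
rewrite lee_fin expRN mulrC ler_pdivrMr ?expR_gt0 //.
have i2' := real_integrableZ (expR (h * b)) i2.
have i12 := real_integrableD i1 i2'.
have iA' := real_integrableZ (expR (t * b)) iA.
have H := @expectation_le_affine _ _ _ P 0 1 _
  (fun w => expR (t * b) * \1_A w + (expR ((t + h) * S w) + expR (h * b) * expR ((t - h) * S w)))
  i0 (real_integrableD iA' i12).
rewrite add0r mul1r in H.
rewrite (RintegralD measurableT iA' i12) (RintegralD measurableT i1 i2') in H.
rewrite (RintegralZl _ measurableT iA) (RintegralZl _ measurableT i2) in H.
rewrite [leRHS]mulrC.
suff pw w : expR (t * S w) <= 0 + 1 * (expR (t * b) * \1_A w +
    (expR ((t + h) * S w) + expR (h * b) * expR ((t - h) * S w))).
  by rewrite -addrA -opprD lerBlDr; exact: H pw.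
rewrite add0r mul1r indicE -expRD; have e1 := expR_ge0 ((t + h) * S w).
have e2 := expR_ge0 (h * b + (t - h) * S w).
have [Sw|Sw] := leP (S w) 0; last first.
  have le1 : expR (t * S w) <= expR ((t + h) * S w).
    by rewrite ler_expR ler_wpM2r ?(ltW Sw) // lerDl ltW.
  apply: (le_trans le1); rewrite addrCA lerDl.
  by rewrite addr_ge0 // mulr_ge0 ?expR_ge0 ?ler0n.
rewrite (_ : w \in A); last by rewrite inE.
rewrite mulr1; have e3 := expR_ge0 (t * b).
have [bS|Sb] := leP b (S w).
  apply: (@le_trans _ _ (expR (t * b))); first by rewrite ler_expR ler_wnM2l // ltW.
  by rewrite lerDl addr_ge0.
apply: (@le_trans _ _ (expR (h * b + (t - h) * S w))); last first.
  by rewrite addrA lerDr addr_ge0.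
rewrite ler_expR mulrBl addrCA lerDl -mulrBr.
by rewrite mulr_ge0 ?subr_ge0 // ltW.
Qed.

Context {N : nat}.
Variable X : 'I_N -> nat -> Omega -> R.
Hypothesis iidX : iid_rows P X.
Hypothesis Xi : forall l, real_integrable P (X l 0%N).
Hypothesis Xe : forall l t, real_integrable P (fun w => expR (t * X l 0%N w)).
Variables (a : nat -> 'I_N -> R) (p : 'I_N -> R).
Hypothesis a01 : forall m l, 0 <= a m l <= 1.
Hypothesis acvg : forall l, a m l @[m --> \oo] --> p l.
Hypothesis p01 : forall l, 0 < p l <= 1.
Local Notation wt := (geometric_weight a).
Local Notation F := (mean_log_mgf P X p).
Hypothesis mean_gt0 : 0 < \sum_l p l * \int[P]_w X l 0%N w.
Hypothesis Xneg : forall l, \int[P]_w X l 0%N w = 0 \/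
  0 < \int[P]_w Num.max (- X l 0%N w) 0.

(** The slope of [F] at 0 is the positive mean. One [u] is chosen for all rows, and [eps] is so
    small that the [N] errors use up at most half of the mean. *)
Lemma mean_log_mgf_neg : exists2 u, u < 0 & F u < 0.
Proof.
have m0 := mean_gt0; set m := \sum_l _ in m0.
have pp := p01.
have N1 : 0 < 2 * (N%:R + 1) :> R by rewrite mulr_gt0 // ltr_wpDl.
pose eps := m / (2 * (N%:R + 1)); have eps0 : 0 < eps by rewrite divr_gt0.
have key l := log_mgf_slope (Xi l) (Xe l) eps0.
pose f l := projT1 (cid2 (key l)).
have hf l : 0 < f l /\ forall u, 0 <= u -> u <= f l ->
    log_mgf P (X l 0%N) (- u) <= - u * (\int[P]_w X l 0%N w - eps).
  by rewrite /f; case: cid2.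
pose u := \big[Num.min/1]_l f l.
have u0 : 0 < u.
  apply: (big_ind (fun x : R => 0 < x)) => // [x y x0 y0|l _]; last exact: (hf l).1.
  by rewrite lt_min x0.
exists (- u); first by rewrite oppr_lt0.
apply: (@le_lt_trans _ _ (\sum_l - (p l * u) * (\int[P]_w X l 0%N w - eps))).
  apply: ler_sum => l _; rewrite mulrN; have /andP[p0 p1] := pp l.
  apply: (hf l).2; first by rewrite mulr_ge0 // ltW.
  apply: (@le_trans _ _ u); first by rewrite ler_piMl // ltW.
  exact: (bigmin_inf l).
rewrite (_ : \sum_l _ = - u * (m - \sum_l p l * eps)); last first.
  by rewrite /m -sumrB mulr_sumr; apply: eq_bigr => l _; ring.
rewrite mulNr oppr_lt0 mulr_gt0 // subr_gt0.
apply: (@le_lt_trans _ _ (\sum_(l < N) eps)).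
  by apply: ler_sum => l _; have /andP[p0 p1] := pp l; rewrite ler_piMl // ltW.
rewrite sumr_const card_ord -mulr_natl /eps mulrCA gtr_pMr // ltr_pdivrMr //.
have : 0 <= N%:R :> R by []; lra.
Qed.

(** A row with mean 0 contributes a nonnegative term by Jensen's inequality. Some row has a
    nontrivial negative part, since otherwise all the means would be 0, and its term is positive far
    enough to the left. *)
Lemma mean_log_mgf_pos : exists2 s, s < 0 & 0 < F s.
Proof.
have pp := p01; pose q l := \int[P]_w Num.max (- X l 0%N w) 0.
have ni l : real_integrable P (fun w => Num.max (- X l 0%N w) 0).
  have mX := real_integrable_measurable (Xi l).
  apply: le_real_integrable (Xi l).
    by apply: measurable_maxr => //; exact: measurable_funN.
  move=> w; rewrite ger0_norm ?le_max ?lexx ?orbT //.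
  by rewrite ge_max normr_ge0 -normrN ler_norm.
have q0 l : 0 <= q l.
  by apply: Rintegral_ge0 => w _; rewrite le_max lexx orbT.
(* This makes [- (p l * s) * q l] exceed 1 for all rows with [q l > 0] at once; the other rows add 0
   to the sum, as the inverse of 0 is 0. *)
pose s := - (1 + \sum_l (p l * q l)^-1).
have pq0 l : 0 <= p l * q l by have /andP[p0 _] := pp l; rewrite mulr_ge0 // ltW.
have sum0 : 0 <= \sum_l (p l * q l)^-1 by apply: sumr_ge0 => l _; rewrite invr_ge0.
have s0 : s < 0 by rewrite /s oppr_lt0; lra.
have big l : 0 < q l -> 0 < log_mgf P (X l 0%N) (p l * s).
  move=> ql; have /andP[p0 _] := pp l.
  apply: (log_mgf_gt0 (Xe l) (ni l)); first by rewrite pmulr_rlt0.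
  rewrite -/(q l) (_ : - _ * _ = p l * q l * (1 + \sum_l (p l * q l)^-1)); last first.
    by rewrite /s; move: (\sum_l _) => x; ring.
  have pq : 0 < p l * q l by rewrite mulr_gt0.
  rewrite -ltr_pdivrMl // mulr1 (bigD1 l) //=.
  have : 0 <= \sum_(i < N | i != l) (p i * q i)^-1 by apply: sumr_ge0 => i _; rewrite invr_ge0.
  by move: (_^-1) (\sum_(i < N | i != l) _) => x y; lra.
have nneg l : 0 <= log_mgf P (X l 0%N) (p l * s).
  have [e|/big/ltW//] := Xneg l.
  by have := log_mgf_ge_mean (Xi l) (Xe l) (p l * s); rewrite e mulr0.
exists s => //.
have [l hl] : exists l, 0 < q l.
  apply: contrapT => /forallNP h; have := mean_gt0.
  rewrite big1 ?ltxx // => l _.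
  by have [->|/h//] := Xneg l; rewrite mulr0.
rewrite /mean_log_mgf (bigD1 l) //=; apply: ltr_pwDl; first exact: big.
by apply: sumr_ge0 => i _; exact: nneg.
Qed.

Variable phi : R -> R.
Hypothesis phi_slope : forall s u, s < u -> u < 0 ->
  F s / s * (u - s) <= phi u - phi s <= F u / u * (u - s).
Hypothesis phi_small : forall t, t < 0 ->
  exists C, forall s, t <= s < 0 -> `|phi s| <= C * `|s|.

Lemma geometric_array_large_deviation : exists ts,
  [/\ ts < 0, phi ts <= 0, forall t, t < 0 -> phi ts <= phi t &
    forall eps, 0 < eps -> \forall delta \near (0 : R)^'+,
      ((expR ((phi ts - eps) / delta))%:E <=
         P [set w | delta * array_lim X (wt delta) w <= 0]%R <=
       (expR ((phi ts + eps) / delta))%:E)%E].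
Proof.
have aux1 (x k : R) : 2 * k <= x -> x <= k -> ~ 0 < x by lra.
have aux2 (x e : R) : e <= x / 4 -> 4 * e <= x by lra.
have aux3 (x y e : R) : 4 * e <= x - y -> y + e <= x - e + (- e + - e) by lra.
have aux4 (z y : R) : 0 < z -> 0 < y -> 2 * y <= 1 ->
  z * y <= z - z * (y * y) - z * (y * y).
  move=> z0 y0 y1; have h : y <= 1 - 2 * (y * y) by nra.
  by have := ler_wpM2l (ltW z0) h; lra.
have aux5 (x y z k r q : R) : k <= x -> y <= q -> z <= q -> r <= k - q - q ->
  r <= x - y - z by lra.
have aux6 (x y z e k : R) : x - k / 2 <= y - z -> 4 * e <= k ->
  x - k <= - z + (y - e + - e) by lra.
have p01' l : 0 <= p l <= 1 by have /andP[/ltW -> ->] := p01 l.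
have cF := mean_log_mgf_convex Xi Xe p; have F0 := mean_log_mgf0 P X p.
have [u u0 Fu] := mean_log_mgf_neg; have [s s0 Fs] := mean_log_mgf_pos.
have [ts [ts0 Fts Fpos _]] := convex_negative_root cF F0 u0 Fu s0 Fs.
have mints t : t < 0 -> phi ts <= phi t.
  exact: (slope_antiderivative_min phi_slope ts0 Fts).
have [mX _ _] := iidX.
have mS delta : measurable_fun [set: Omega] (array_lim X (wt delta)).
  exact: measurable_array_lim.
have evE delta : 0 < delta -> [set w | delta * array_lim X (wt delta) w <= 0] =
    [set w | array_lim X (wt delta) w <= 0].
  by move=> d0; apply/seteqP; split => w /=; rewrite pmulr_rle0.
exists ts; split => //.
  rewrite leNgt; apply/negP => pts.
  have [C hC] := phi_small ts0.
  have C1 : 0 < 2 * (`|C| + 1) by rewrite mulr_gt0 // ltr_wpDl.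
  (* If [phi ts] were positive, this [t] would be so close to 0 that [phi t <= phi ts / 2], against
     the minimality of [ts]. *)
  pose t := - Num.min (- ts) (phi ts / (2 * (`|C| + 1))).
  have t0 : t < 0 by rewrite oppr_lt0 lt_min oppr_gt0 ts0 divr_gt0.
  have tst : ts <= t by rewrite lerNr ge_min lexx.
  have := mints t t0; have := hC t; rewrite tst t0 => /(_ isT).
  have tC : - t * (2 * (`|C| + 1)) <= phi ts.
    by rewrite opprK -ler_pdivlMr // ge_min lexx orbT.
  rewrite (ltr0_norm t0) => h1 h2; have h3 := ler_norm (phi t).
  have h4 : C * - t <= (`|C| + 1) * - t.
    apply: ler_wpM2r; first by rewrite oppr_ge0 ltW.
    by apply: le_trans (ler_norm C) _; rewrite lerDl.
  apply: (aux1 _ ((`|C| + 1) * - t) _ _ pts).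
    by move: tC; rewrite (mulrC (- t)) mulrA.
  exact: le_trans h2 (le_trans h3 (le_trans h1 h4)).
move=> eps eps0.
have eps2 : 0 < eps / 2 by rewrite divr_gt0.
have [t [h [b [h0 th0 g1 g2 g3]]]] :=
  slope_antiderivative_tilt cF phi_slope ts0 Fts Fpos eps2.
have t0 : t < 0 by apply: lt_trans th0; rewrite ltrDl.
have tmh0 : t - h < 0 by rewrite subr_lt0 (lt_trans t0).
(* A quarter of each gap: two units absorb the errors of the two transforms compared, and two are
   left over as the factor [y * y] below. *)
pose e1 := Num.min (eps / 4) (Num.min ((phi t - phi (t + h)) / 4)
  ((phi t - (h * b + phi (t - h))) / 4)).
have e10 : 0 < e1 by rewrite !lt_min !divr_gt0 ?subr_gt0.
have e1a : 4 * e1 <= eps by apply: aux2; rewrite ge_min lexx.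
have e1b : 4 * e1 <= phi t - phi (t + h).
  by apply: aux2; rewrite !ge_min lexx orbT.
have e1c : 4 * e1 <= phi t - (h * b + phi (t - h)).
  by apply: aux2; rewrite !ge_min lexx !orbT.
have asym r e r0 er := @geometric_array_mgf_asymptotics _ _ _ P _ X iidX Xi Xe a p
  a01 acvg p01' phi phi_slope phi_small r e r0 er.
have h1 := asym ts eps ts0 eps0.
have h2 := asym t e1 t0 e10.
have h3 := asym (t + h) e1 th0 e10.
have h4 := asym (t - h) e1 tmh0 e10.
near=> delta.
have d0 : 0 < delta by near: delta; exact: nbhs_right_gt.
have d1 : delta < 1 by near: delta; exact: nbhs_right_lt.
have de1 : delta <= e1 by near: delta; exact: nbhs_right_le.
have /andP[_ k1] : expR ((phi ts - eps) / delta) <=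
      \int[P]_w expR (ts * array_lim X (wt delta) w) <=
    expR ((phi ts + eps) / delta) by near: delta; exact: h1.
have /andP[k2 _] : expR ((phi t - e1) / delta) <=
      \int[P]_w expR (t * array_lim X (wt delta) w) <=
    expR ((phi t + e1) / delta) by near: delta; exact: h2.
have /andP[_ k3] : expR ((phi (t + h) - e1) / delta) <=
      \int[P]_w expR ((t + h) * array_lim X (wt delta) w) <=
    expR ((phi (t + h) + e1) / delta) by near: delta; exact: h3.
have /andP[_ k4] : expR ((phi (t - h) - e1) / delta) <=
      \int[P]_w expR ((t - h) * array_lim X (wt delta) w) <=
    expR ((phi (t - h) + e1) / delta) by near: delta; exact: h4.
have ie r : real_integrable P (fun w => expR (r * array_lim X (wt delta) w)).
  by have [] := geometric_array_mgf iidX Xi Xe a01 r d0 d1.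
rewrite evE //; apply/andP; split; last first.
  by apply: (le_trans (prob_nonpos_le (mS delta) ts0 (ie ts))); rewrite lee_fin.
(* The event is written for the series without its factor [delta], so the threshold [b] becomes
   [b / delta]. *)
apply: le_trans (prob_nonpos_ge (b / delta) (mS delta) t0 h0 (ie _) (ie _) (ie _)).
rewrite lee_fin.
(* Both subtracted terms are at most [z * (y * y)], and [y <= 1 / 2] because [delta <= e1]; hence at
   least [z * y] of the transform at [t] remains. *)
pose y := expR (- (e1 / delta)).
pose z := expR ((phi t - e1) / delta).
have z0 : 0 < z by exact: expR_gt0.
have y0 : 0 < y by exact: expR_gt0.
have y1 : 2 * y <= 1.
  have e2 : (1 : R) + 1 <= expR (e1 / delta).
    by apply: le_trans (expR_ge1Dx _); rewrite lerD2l ler_pdivlMr // mul1r.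
  have ye : y * expR (e1 / delta) = 1 by rewrite -expRD addNr expR0.
  by rewrite -[leRHS]ye mulrC (ler_pM2l y0); exact: e2.
have q3 : \int[P]_w expR ((t + h) * array_lim X (wt delta) w) <= z * (y * y).
  apply: (le_trans k3); rewrite -!expRD ler_expR.
  by rewrite -!mulNr -!mulrDl ler_pM2r ?invr_gt0 //; exact: aux3.
have q4 : expR (h * (b / delta)) *
    \int[P]_w expR ((t - h) * array_lim X (wt delta) w) <= z * (y * y).
  apply: (@le_trans _ _ (expR (h * (b / delta)) * expR ((phi (t - h) + e1) / delta))).
    by rewrite ler_wpM2l ?expR_ge0.
  rewrite -!expRD ler_expR mulrA.
  by rewrite -!mulNr -!mulrDl ler_pM2r ?invr_gt0 // addrA; exact: aux3.
have q5 : z * y <= \int[P]_w expR (t * array_lim X (wt delta) w) -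
    \int[P]_w expR ((t + h) * array_lim X (wt delta) w) -
    expR (h * (b / delta)) * \int[P]_w expR ((t - h) * array_lim X (wt delta) w).
  exact: aux5 k2 q3 q4 (aux4 _ _ z0 y0 y1).
apply: (@le_trans _ _ (expR (- (t * (b / delta))) * (z * y))); last first.
  by rewrite ler_wpM2l ?expR_ge0.
rewrite -!expRD ler_expR mulrA -!mulNr -!mulrDl ler_pM2r ?invr_gt0 //.
by rewrite mulNr; exact: aux6 g3 e1a.
Unshelve. all: end_near. Qed.

End LargeDeviation.

(** * Log-likelihood ratios of densities *)

Section Densities.
Context {R : realType} d (T : measurableType d) (nu : {measure set T -> \bar R}).
Variable X : set T.
Implicit Types f g : T -> R.

Lemma density_gt0 f g s : density_with_support nu X f ->
  density_with_support nu X g -> 0 < f s -> 0 < g s.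
Proof.
case=> _ _ _ fX [_ g0 _ gX] fs; rewrite lt_neqAle g0 andbT eq_sym.
have : X s by rewrite -fX /= gt_eqF.
by rewrite -gX.
Qed.

Lemma density_eq0 f g s : density_with_support nu X f ->
  density_with_support nu X g -> f s = 0 -> g s = 0.
Proof.
move=> hf hg fs; have [_ g0 _ _] := hg; apply/eqP; rewrite eq_le g0 andbT leNgt.
by apply/negP => /(density_gt0 hg hf); rewrite fs ltxx.
Qed.

(** It holds at every point: off the common support both sides are 0, since [0 / 0 = 0] and
    [ln 0 = 0]. *)
Lemma ln_density_ratio f g s : density_with_support nu X f ->
  density_with_support nu X g -> ln (f s / g s) = ln (f s) - ln (g s).
Proof.
move=> hf hg; have [_ f0 _ _] := hf; have := f0 s; rewrite le_eqVlt => /predU1P[fs|fs].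
  by rewrite -fs (density_eq0 hf hg) // mul0r subrr ln0.
by rewrite ln_div // posrE // (density_gt0 hf hg).
Qed.

Lemma measurable_ln_density f : density_with_support nu X f ->
  measurable_fun [set: T] (fun s => ln (f s)).
Proof. by move=> [mf _ _ _]; apply: measurableT_comp => //; exact: measurable_ln. Qed.

Lemma KL_integrandE f g s : density_with_support nu X f ->
  density_with_support nu X g ->
  ((f s)%:E * (lne (f s)%:E - lne (g s)%:E))%E = (f s * (ln (f s) - ln (g s)))%:E.
Proof.
move=> hf hg; have [_ f0 _ _] := hf; have := f0 s; rewrite le_eqVlt => /predU1P[<-|fs].
  by rewrite mul0e mul0r.
by rewrite !lne_EFin // (density_gt0 hf hg).
Qed.

(** The negative part of the integrand is at most [g], because [f * ln (g / f) <= g - f]; it has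
    integral at most 1, so a finite divergence bounds the positive part too. *)
Lemma KL_integrable f g : density_with_support nu X f ->
  density_with_support nu X g -> (KL_divergence nu f g < +oo)%E ->
  nu.-integrable [set: T] (fun s => (f s * (ln (f s) - ln (g s)))%:E).
Proof.
move=> hf hg; have [mf f0 f1 _] := hf; have [mg g0 g1 _] := hg.
rewrite /KL_divergence; under eq_integral do rewrite (KL_integrandE _ hf hg).
pose k s : R := f s * (ln (f s) - ln (g s)).
have mk : measurable_fun [set: T] k.
  by apply: measurable_funM => //; apply: measurable_funB; exact: measurable_ln_density.
have mEk : measurable_fun [set: T] (EFin \o k) by exact/measurable_EFinP.
have kn s : ((EFin \o k)^\- s <= (g s)%:E)%E.
  rewrite funenegE /= -EFin_max lee_fin ge_max g0 andbT /k.
  have := f0 s; rewrite le_eqVlt => /predU1P[<-|fs]; first by rewrite mul0r oppr0.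
  have gs := density_gt0 hf hg fs.
  have : ln (g s / f s) <= g s / f s - 1.
    have q : 0 < g s / f s by rewrite divr_gt0.
    by have := expR_ge1Dx (ln (g s / f s)); rewrite lnK ?posrE //; lra.
  rewrite ln_div ?posrE // => /(ler_wpM2l (ltW fs)).
  rewrite (_ : f s * (_ / _ - 1) = g s - f s); last by field; rewrite gt_eqF.
  rewrite -mulrN opprB => h; apply: (le_trans h).
  by rewrite lerBlDr lerDl ltW.
have Ekn : (\int[nu]_s (EFin \o k)^\- s <= 1)%E.
  rewrite -g1; apply: ge0_le_integral => //.
  - exact: measurable_funeneg.
  - exact/measurable_EFinP.
move=> h; apply/integrableP; split => //.
have Ekp : (\int[nu]_s (EFin \o k)^\+ s < +oo)%E.
  move: h; rewrite [X in (X < _)%E](_ : _ = \int[nu]_s (EFin \o k) s)%E // integralE.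
  have : (0 <= \int[nu]_s (EFin \o k)^\- s)%E by apply: integral_ge0.
  move: Ekn; case: (\int[nu]_s (EFin \o k)^\- s)%E => [r| |] //= _ _.
  by case: (\int[nu]_s (EFin \o k)^\+ s)%E => [q| |] //= _; rewrite ltry.
rewrite [X in (X < _)%E](_ : _ = \int[nu]_s ((EFin \o k)^\+ s + (EFin \o k)^\- s))%E; last first.
  by apply: eq_integral => s _; exact: (congr1 (fun h => h s) (fune_abse (EFin \o k))).
rewrite ge0_integralD //; last 2 first.
- exact: measurable_funepos.
- exact: measurable_funeneg.
by rewrite lte_add_pinfty // (le_lt_trans Ekn) // ltry.
Qed.

(** The terms [f * ln f] cancel in the difference of the two divergence integrands. *)
Lemma log_likelihood_integrable f g1 g2 : density_with_support nu X f ->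
  density_with_support nu X g1 -> density_with_support nu X g2 ->
  (KL_divergence nu f g1 < +oo)%E -> (KL_divergence nu f g2 < +oo)%E ->
  (\int[nu]_s (`|ln (g1 s) - ln (g2 s)|%:E * (f s)%:E) < +oo)%E.
Proof.
move=> hf hg1 hg2 k1 k2.
have := integrableB measurableT (KL_integrable hf hg2 k2) (KL_integrable hf hg1 k1).
move=> /integrableP[_]; rewrite [X in (X < _)%E -> _](_ : _ =
  \int[nu]_s (`|ln (g1 s) - ln (g2 s)|%:E * (f s)%:E))%E //.
apply: eq_integral => s _ /=; congr EFin.
have [_ f0 _ _] := hf.
rewrite -mulrBr normrM ger0_norm // mulrC; congr (`|_| * _); ring.
Qed.

(* The hypothesis means that [g2 <= g1] almost everywhere; having the same mass,
   the two densities then coincide almost everywhere. *)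
Lemma log_likelihood_dichotomy f g1 g2 : density_with_support nu X f ->
  density_with_support nu X g1 -> density_with_support nu X g2 ->
  (\int[nu]_s ((Num.max (- (ln (g1 s) - ln (g2 s))) 0)%:E * (f s)%:E) = 0)%E ->
  (\int[nu]_s (`|ln (g1 s) - ln (g2 s)|%:E * (f s)%:E) = 0)%E.
Proof.
move=> hf hg1 hg2 h0; have [mf f0 _ _] := hf.
have [mg1 g10 g11 _] := hg1; have [mg2 g20 g21 _] := hg2.
pose r s : R := ln (g1 s) - ln (g2 s).
have mr : measurable_fun [set: T] r.
  by apply: measurable_funB; exact: measurable_ln_density.
pose rn s : R := Num.max (- r s) 0 * f s.
have mrn : measurable_fun [set: T] (EFin \o rn).
  apply/measurable_EFinP; apply: measurable_funM => //.
  by apply: measurable_maxr => //; exact: measurable_funN.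
have rn0 s : 0 <= rn s by rewrite mulr_ge0 // le_max lexx orbT.
have ae1 : ae_eq nu setT (EFin \o rn) (cst 0%E).
  apply/ae_eq_integral_abs => //; rewrite -h0; apply: eq_integral => s _ /=.
  by rewrite ger0_norm // -EFinM.
pose D s : R := g1 s - g2 s.
have mD : measurable_fun [set: T] D by exact: measurable_funB.
(* The hypothesis gives information only where [f > 0]; elsewhere [g1] and [g2] vanish along with
   [f], so [D] is nonnegative there too. *)
have ae2 : ae_eq nu setT (EFin \o (fun s => `|D s|)) (EFin \o D).
  apply: filterS ae1 => s /= hs _; have {}hs := EFin_inj (hs I).
  rewrite ger0_norm // subr_ge0.
  have := f0 s; rewrite le_eqVlt => /predU1P[fs|fs].
    by rewrite (density_eq0 hf hg1) // (density_eq0 hf hg2).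
  have s1 := density_gt0 hf hg1 fs; have s2 := density_gt0 hf hg2 fs.
  rewrite -ler_ln ?posrE // -subr_ge0 -oppr_le0.
  move/eqP: hs; rewrite /rn mulf_eq0 (gt_eqF fs) orbF => /eqP hs.
  by move: (lexx (0 : R)); rewrite -[X in X <= _ -> _]hs ge_max => /andP[].
have gi g : density_with_support nu X g -> nu.-integrable [set: T] (EFin \o g).
  move=> [mg g0 g1' _]; apply/integrableP; split; first exact/measurable_EFinP.
  by under eq_integral do rewrite /= ger0_norm //; rewrite g1' ltry.
have ID : (\int[nu]_s (D s)%:E = 0)%E.
  transitivity (\int[nu]_s ((g1 s)%:E - (g2 s)%:E))%E; first by [].
  rewrite (integralB_EFin measurableT (gi _ hg1) (gi _ hg2)) g11 g21.
  by rewrite subee.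
have ae3 : ae_eq nu setT (EFin \o D) (cst 0%E).
  apply/ae_eq_integral_abs => //; first exact/measurable_EFinP.
  rewrite -ID; apply: ae_eq_integral ae2 => //.
    by apply/measurable_EFinP; exact: measurableT_comp.
  exact/measurable_EFinP.
rewrite -(integral0 nu setT); apply: ae_eq_integral => //.
  apply: emeasurable_funM; apply/measurable_EFinP => //.
  exact: measurableT_comp.
apply: filterS ae3 => s hs _; have {}hs := EFin_inj (hs I).
by rewrite (_ : g1 s = g2 s) ?subrr ?normr0 ?mul0e //; apply/eqP; rewrite -subr_eq0; apply/eqP.
Qed.

End Densities.

(** * The integral of the slope of a convex function *)

Section SlopeIntegral.
Context {R : realType}.
Variable F : R -> R.
Hypotheses (cF : convex_on_line F) (F0 : F 0 = 0).
Local Notation mu := (@lebesgue_measure R).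

(** For [t < 0] this is the integral from 0 to [t] as a real number; the interval leaves out 0,
    where the quotient is a default value. *)
Definition slope_integral (t : R) : R :=
  - \int[mu]_(x in `[t, 0[) (F x / x).

Let mF : measurable_fun [set: R] F.
Proof. by apply: continuous_measurable_fun; exact: convex_continuous. Qed.

Lemma measurable_slope_neg (D : set R) : measurable D -> D `<=` `]-oo, 0[ ->
  measurable_fun D (fun x => F x / x).
Proof.
(* On the negative axis [1 / x = - exp (- ln (- x))], a composition of measurable functions. *)
move=> mD DN; apply: (eq_measurable_fun (fun x => F x * - expR (- ln (- x)))).
  move=> x; rewrite inE => /DN /=; rewrite in_itv /= => x0.
  by rewrite expRN lnK ?posrE ?oppr_gt0 // invrN opprK.
apply: measurable_funTS; apply: measurable_funM => //.
apply: measurable_funN; apply: measurableT_comp => //; apply: measurable_funN.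
by apply: measurableT_comp; [exact: measurable_ln|exact: measurable_funN].
Qed.

Lemma measurable_slope_pos (D : set R) : measurable D -> D `<=` `]0, +oo[ ->
  measurable_fun D (fun x => F x / x).
Proof.
move=> mD DN; apply: (eq_measurable_fun (fun x => F x * expR (- ln x))).
  move=> x; rewrite inE => /DN /=; rewrite in_itv /= andbT => x0.
  by rewrite expRN lnK ?posrE.
apply: measurable_funTS; apply: measurable_funM => //.
by apply: measurableT_comp => //; apply: measurable_funN; exact: measurable_ln.
Qed.

Lemma slope_bounded (t : R) : t < 0 -> exists C, forall x, t <= x < 0 -> `|F x / x| <= C.
Proof.
move=> t0; have T0 : 0 < - t by rewrite oppr_gt0.
have [C C0 hC] := convex_lipschitz cF T0.
exists C => x /andP[tx x0].
have := hC x 0; rewrite F0 !subr0 opprK tx (ltW t0) oppr_ge0 (ltW t0).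
rewrite (ltW (lt_trans x0 T0)) => /(_ isT isT) h.
by rewrite normrM normfV ler_pdivrMr // normr_gt0 lt_eqF.
Qed.

Let itv_neg (s u : R) : u <= 0 -> [set` `[s, u[] `<=` [set` `]-oo, (0 : R)[].
Proof.
by move=> u0 x /=; rewrite !in_itv /= => /andP[_ xu]; exact: lt_le_trans xu u0.
Qed.

Lemma slope_integrable (s u : R) : s < 0 -> u <= 0 ->
  mu.-integrable `[s, u[ (EFin \o (fun x => F x / x)).
Proof.
move=> s0 u0; have [C hC] := slope_bounded s0.
apply: (@le_integrable _ _ _ mu _ (measurable_itv _) _ (EFin \o cst C)).
- by apply/measurable_EFinP; apply: measurable_slope_neg => //; exact: itv_neg.
- move=> x /=; rewrite in_itv /= => /andP[sx xu].
  rewrite lee_fin; apply: le_trans (ler_norm _).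
  by apply: hC; rewrite sx (lt_le_trans xu u0).
apply/integrableP; split; first exact/measurable_EFinP.
rewrite [X in (X < _)%E](_ : _ = \int[mu]_(x in `[s, u[) cst `|C|%:E x)%E //.
rewrite integral_cst // [X in (_ * X)%E]lebesgue_measure_itv /= lte_fin.
by case: ifP => _; rewrite ?mule0 ?ltry // -EFinD -EFinM ltry.
Qed.

Lemma slope_integral_diff (s u : R) : s < u -> u < 0 ->
  slope_integral u - slope_integral s = \int[mu]_(x in `[s, u[) (F x / x).
Proof.
move=> su u0; have s0 := lt_trans su u0.
rewrite /slope_integral opprK addrC.
have e : [set` `[s, 0[] = [set` `[s, u[] `|` [set` `[u, (0:R)[].
  by rewrite -itv_bndbnd_setU // bnd_simp ltW.
rewrite e Rintegral_setU //; first by rewrite addrK.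
- by rewrite -e; exact: slope_integrable.
- apply/disj_setPS => x [] /=; rewrite !in_itv /= => /andP[_ xu] /andP[ux _].
  by move: (lt_le_trans xu ux); rewrite ltxx.
Qed.

Lemma Rintegral_itv_cst (s u c : R) : s <= u -> \int[mu]_(x in `[s, u[) c = c * (u - s).
Proof.
move=> su; rewrite Rintegral_cst //; congr (_ * _).
rewrite [X in fine X]lebesgue_measure_itv /= lte_fin; case: ltP => // us.
by rewrite (le_anti (introT andP (conj su us))) subrr.
Qed.

Lemma integrable_itv_cst (s u c : R) : mu.-integrable `[s, u[ (EFin \o cst c).
Proof.
apply/integrableP; split; first exact/measurable_EFinP.
rewrite [X in (X < _)%E](_ : _ = \int[mu]_(x in `[s, u[) cst `|c|%:E x)%E //.
rewrite integral_cst // [X in (_ * X)%E]lebesgue_measure_itv /= lte_fin.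
by case: ifP => _; rewrite ?mule0 ?ltry // -EFinD -EFinM ltry.
Qed.

Lemma slope_integral_slope (s u : R) : s < u -> u < 0 ->
  F s / s * (u - s) <= slope_integral u - slope_integral s <= F u / u * (u - s).
Proof.
move=> su u0; have s0 := lt_trans su u0; rewrite slope_integral_diff //.
have gi := slope_integrable s0 (ltW u0).
apply/andP; split.
- rewrite -(Rintegral_itv_cst _ (ltW su)); apply: le_Rintegral => //.
    exact: integrable_itv_cst.
  move=> x /=; rewrite in_itv /= => /andP[sx xu].
  by apply: convex_slope_nondecr => //; exact: lt_trans xu u0.
- rewrite -(Rintegral_itv_cst _ (ltW su)); apply: le_Rintegral => //.
    exact: integrable_itv_cst.
  move=> x /=; rewrite in_itv /= => /andP[sx xu].
  by apply: convex_slope_nondecr => //; exact: ltW.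
Qed.

Lemma slope_integral_small (t : R) : t < 0 ->
  exists C, forall s, t <= s < 0 -> `|slope_integral s| <= C * `|s|.
Proof.
move=> t0; have [C hC] := slope_bounded t0; exists C => s /andP[ts s0].
have gi := slope_integrable s0 (lexx 0).
rewrite /slope_integral normrN; apply: (le_trans (le_normr_Rintegral _ gi)) => //.
rewrite (ltr0_norm s0) -(sub0r s) -(Rintegral_itv_cst _ (ltW s0)).
apply: le_Rintegral => //.
- exact: (integrable_norm gi).
- exact: integrable_itv_cst.
move=> x /=; rewrite in_itv /= => /andP[sx x0]; apply: hC.
by rewrite x0 (le_trans ts sx).
Qed.

Variable H : R -> \bar R.
Hypothesis HE : forall x, x != 0 -> H x = (F x / x)%:E.

(** [H] is known only away from 0, so the endpoint 0, a null set, is removed first. *)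
Lemma oriented_integral_neg (t : R) : t < 0 ->
  oriented_integral 0 t H = (slope_integral t)%:E.
Proof.
move=> t0; rewrite /oriented_integral leNgt t0 /=.
have eqH : {in [set` `[t, 0[], H =1 EFin \o (fun x => F x / x)}.
  by move=> x; rewrite inE /= in_itv /= => /andP[_ x0]; rewrite HE ?lt_eqF.
have gi := slope_integrable t0 (lexx 0).
rewrite -integral_itv_bndo_bndc; last first.
  apply: (eq_measurable_fun (EFin \o (fun x => F x / x))).
    by move=> x /eqH ->.
  exact: measurable_int gi.
rewrite /slope_integral EFinN fineK; last exact: integrable_fin_num gi.
by congr (- _)%E; apply: eq_integral; exact: eqH.
Qed.

(** On this side the sign is enough, since the infimum of [phi] is a nonpositive value taken at a
    negative point. *)
Lemma oriented_integral_nonneg (t : R) : 0 <= t -> (forall x, 0 < x -> 0 <= F x) ->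
  (0 <= oriented_integral 0 t H)%E.
Proof.
move=> t0 Fp; rewrite /oriented_integral t0.
rewrite -integral_itv_obnd_cbnd; last first.
  apply: (eq_measurable_fun (EFin \o (fun x => F x / x))).
    by move=> x; rewrite inE /= in_itv /= => /andP[x0 _]; rewrite HE ?gt_eqF.
  apply/measurable_EFinP; apply: measurable_slope_pos => // x /=.
  by rewrite !in_itv /= andbT => /andP[].
apply: integral_ge0 => x /=; rewrite in_itv /= => /andP[x0 _].
by rewrite HE ?gt_eqF // lee_fin divr_ge0 ?Fp // ltW.
Qed.

End SlopeIntegral.

(** * Adaptive social learning *)

Section ProbabilityLimits.
Context {R : realType} d (Omega : measurableType d) (P : probability Omega R).

Lemma prob_exists_le (I : finType) (Q : pred I) (E : I -> set Omega) (b : R) :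
  0 <= b -> (forall i, Q i -> measurable (E i)) ->
  (forall i, Q i -> (P (E i) <= b%:E)%E) ->
  measurable [set w | exists i, Q i /\ E i w] /\
  (P [set w | exists i, Q i /\ E i w] <= (#|I|%:R * b)%:E)%E.
Proof.
move=> b0 mE PE.
pose U (s : seq I) := [set w | exists i, [/\ i \in s, Q i & E i w]].
suff H s : measurable (U s) /\ (P (U s) <= ((size s)%:R * b)%:E)%E.
  have -> : [set w | exists i, Q i /\ E i w] = U (enum I).
    apply/seteqP; split => w /= [i]; first by case=> ? ?; exists i; rewrite mem_enum.
    by case=> _ ? ?; exists i.
  by rewrite cardE; exact: H.
elim: s => [|i s [mU PU]].
  have -> : U [::] = set0 by apply/seteqP; split => // w [i []].
  by rewrite measure0 mul0r; split => //; exact: measurable0.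
have [Qi|nQi] := boolP (Q i).
  have -> : U (i :: s) = E i `|` U s.
    apply/seteqP; split => w /= => [[j []]|].
      by rewrite inE => /predU1P[->|js] Qj Ej; [left|right; exists j].
    case=> [Ei|[j [js Qj Ej]]]; first by exists i; rewrite mem_head.
    by exists j; rewrite inE js orbT.
  have mEi := mE i Qi.
  split; first exact: measurableU.
  apply: (le_trans (measureU2 P mEi mU)).
  by rewrite /= -natr1 mulrDl mul1r addrC EFinD leeD // PE.
have -> : U (i :: s) = U s.
  apply/seteqP; split => w [j [js Qj Ej]]; exists j; split => //; last first.
    by rewrite inE js orbT.
  by move: js; rewrite inE => /predU1P[ji|//]; move: nQi; rewrite -ji Qj.
split => //; apply: (le_trans PU); rewrite lee_fin ler_wpM2r // ler_nat.
exact: leqnSn.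
Qed.

Lemma cvge0_near (f : R -> \bar R) : (forall x, (0 <= f x)%E) ->
  (forall eta, 0 < eta -> \forall x \near (0 : R)^'+, (f x <= eta%:E)%E) ->
  f x @[x --> (0 : R)^'+] --> 0%E.
Proof.
move=> f0 fs; apply/(fine_cvgP f 0); split.
  have := fs 1 ltr01; apply: filterS => x fx.
  by rewrite ge0_fin_numE // (le_lt_trans fx) // ltry.
apply/cvgrPdist_le => eta eta0; have := fs eta eta0; apply: filterS => x fx.
rewrite sub0r normrN ger0_norm ?fine_ge0 //.
rewrite -lee_fin fineK // ge0_fin_numE // (le_lt_trans fx) // ltry //.
Qed.

(** The prefactor [H] comes from the union bound and contributes [x * ln H], which tends to 0. The
    lower bound makes [p x] positive, so that its logarithm is a real number. *)
Lemma cvg_log_scale (p : R -> \bar R) (ell H : R) : 0 < H ->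
  (forall eps, 0 < eps -> \forall x \near (0 : R)^'+,
    ((expR ((ell - eps) / x))%:E <= p x <= (H * expR ((ell + eps) / x))%:E)%E) ->
  (x%:E * lne (p x))%E @[x --> (0 : R)^'+] --> ell%:E.
Proof.
move=> H0 hp.
have key eps : 0 < eps -> \forall x \near (0 : R)^'+,
    (x%:E * lne (p x))%E \is a fin_num /\ `|ell - fine (x%:E * lne (p x))%E| <= eps.
  move=> eps0; have eps2 : 0 < eps / 2 by rewrite divr_gt0.
  have K0 : 0 < `|ln H| + 1 by rewrite ltr_wpDl.
  have h := hp _ eps2; near=> x.
  have x0 : 0 < x by near: x; exact: nbhs_right_gt.
  have xK : x <= eps / 2 / (`|ln H| + 1).
    by near: x; apply: nbhs_right_le; rewrite divr_gt0.
  have : ((expR ((ell - eps / 2) / x))%:E <= p x <= (H * expR ((ell + eps / 2) / x))%:E)%E.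
    by near: x; exact: h.
  case: (p x) => [r| |] => /andP[] //; rewrite !lee_fin => r1 r2.
  have r0 : 0 < r by apply: lt_le_trans r1; exact: expR_gt0.
  rewrite lne_EFin // -EFinM; split => //=.
  have l1 : ell - eps / 2 <= x * ln r.
    by rewrite (mulrC x) -ler_pdivrMr // -ler_expR lnK ?posrE.
  have l2 : x * ln r <= x * ln H + (ell + eps / 2).
    have : ln r <= ln (H * expR ((ell + eps / 2) / x)).
      by rewrite ler_ln ?posrE // mulr_gt0 // expR_gt0.
    rewrite lnM ?posrE ?expR_gt0 // expRK => /(ler_wpM2l (ltW x0)) hh.
    apply: (le_trans hh); rewrite mulrDr lerD2l mulrC divfK ?gt_eqF //.
  have l3 : x * ln H <= eps / 2.
    move: xK; rewrite ler_pdivlMr // => /(le_trans _); apply.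
    rewrite ler_wpM2l ?(ltW x0) // (le_trans (ler_norm _)) // lerDl //.
  rewrite ler_norml; apply/andP; move: l1 l2 l3; move: (x * ln r) (x * ln H) => y z.
  by move=> *; split; lra.
apply/fine_cvgP; split.
  by have := key 1 ltr01; apply: filterS => x [].
by apply/cvgrPdist_le => eps eps0; have := key _ eps0; apply: filterS => x [].
Unshelve. all: end_near. Qed.

End ProbabilityLimits.

(** * The log-likelihood ratios of the network *)

Section Model.
Context {R : realType} {N : nat} {Theta : finType} (theta1 : Theta).
Variables (nbr : 'I_N -> {set 'I_N}) (A : 'M[R]_N) (v : 'cV[R]_N).
Context (dT : 'I_N -> measure_display) (T : forall k : 'I_N, measurableType (dT k)).
Variable nu : forall k : 'I_N, {sigma_finite_measure set (T k) -> \bar R}.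
Variable X : forall k : 'I_N, set (T k).
Variables (f : forall k : 'I_N, T k -> R) (L : forall k : 'I_N, Theta -> T k -> R).
Context (dO : measure_display) (Omega : measurableType dO) (P : probability Omega R).
Variable xi : forall k : 'I_N, nat -> Omega -> T k.
Arguments X : clear implicits.
Arguments f : clear implicits.
Arguments L : clear implicits.
Arguments xi : clear implicits.
Hypotheses (hgraph : strongly_connected nbr) (hA : combination_matrix nbr A)
  (hv : perron_eigenvector A v).
Hypothesis hf : forall k : 'I_N, density_with_support (nu k) (X k) (f k).
Hypothesis hL : forall (k : 'I_N) (theta : Theta),
  density_with_support (nu k) (X k) (L k theta).
Hypothesis hxi : signal_model P nu f xi.
Hypothesis hKL : forall (k : 'I_N) (theta : Theta),
  (KL_divergence (nu k) (f k) (L k theta) < +oo)%E.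

Let Y theta (l : 'I_N) (m : nat) (w : Omega) : R := llr theta1 L xi l m.+1 theta w.
Let r theta (l : 'I_N) (s : T l) : R := ln (L l theta1 s) - ln (L l theta s).
Arguments r : clear implicits.
Let a (k : 'I_N) (m : nat) (l : 'I_N) : R := (A ^+ m.+1) l k.
Let p (l : 'I_N) : R := v l 0.

Let mr theta l : measurable_fun [set: T l] (r theta l).
Proof. by apply: measurable_funB; apply: measurable_ln_density (hL _ _). Qed.

Let YE theta : Y theta = fun l m w => r theta l (xi l m.+1 w).
Proof.
apply/funext => l; apply/funext => m; apply/funext => w.
exact: ln_density_ratio (hL _ _) (hL _ _).
Qed.

Lemma llr_iid_rows theta : iid_rows P (Y theta).
Proof.
case: hxi => mxi law ind; rewrite YE; apply: iid_rows_of_independent => //.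
by move=> l i B i0 mB; rewrite !law.
Qed.

Lemma expectation_llr (g : R -> R) theta l : measurable_fun [set: R] g ->
  (forall x, 0 <= g x) ->
  (\int[P]_w (g (Y theta l 0 w))%:E =
   \int[nu l]_s ((g (ln (L l theta1 s) - ln (L l theta s)))%:E * (f l s)%:E))%E.
Proof.
move=> mg g0; case: hxi => mxi law _; have [mf f0 _ _] := hf l.
have mgr : measurable_fun [set: T l] (EFin \o (g \o r theta l)).
  by apply/measurable_EFinP; apply: measurableT_comp.
have gr0 s : (0 <= (EFin \o (g \o r theta l)) s)%E by rewrite lee_fin; exact: g0.
have key B : measurable B -> (\int[P]_(w in xi l 1%N @^-1` B) (cst (1 : R) w)%:E =
    \int[nu l]_(s in id @^-1` B) (f l s)%:E)%E.
  move=> mB; rewrite -(law l 1%N isT B mB).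
  have mB' : measurable (xi l 1%N @^-1` B).
    by rewrite -[X in measurable X]setTI; exact: mxi.
  by rewrite -[RHS]mul1e -integral_cst.
have := ge0_integral_transfer (mxi l 1%N isT) (@measurable_id _ (T l) setT)
  (measurable_cst (1 : R)) mf (fun=> ler01) f0 key mgr gr0.
move=> <-; rewrite YE; apply: eq_integral => w _ /=; by rewrite mule1.
Qed.

Lemma llr_integrable theta l : real_integrable P (Y theta l 0%N).
Proof.
have [mY _ _] := llr_iid_rows theta.
apply: real_integrable_norm => //.
rewrite (expectation_llr theta l (@normr_measurable _ setT)) //.
exact: log_likelihood_integrable (hf l) (hL l theta1) (hL l theta) _ _.
Qed.

(** This is the input of [mean_log_mgf_pos], carried from the densities to the signals: if the
    negative part has mean 0, then so has the absolute value. *)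
Lemma llr_dichotomy theta l : \int[P]_w Y theta l 0%N w = 0 \/
  0 < \int[P]_w Num.max (- Y theta l 0%N w) 0.
Proof.
have mneg : measurable_fun [set: R] (fun x : R => Num.max (- x) 0).
  by apply: measurable_maxr => //; exact: measurable_funN.
have neg0 (x : R) : 0 <= Num.max (- x) 0 by rewrite le_max lexx orbT.
have Yi := llr_integrable theta l; have mY := real_integrable_measurable Yi.
have ni : real_integrable P (fun w => Num.max (- Y theta l 0%N w) 0).
  apply: le_real_integrable Yi; first exact: (measurableT_comp mneg mY).
  by move=> w; rewrite ger0_norm // ge_max normr_ge0 -normrN ler_norm.
have : 0 <= \int[P]_w Num.max (- Y theta l 0%N w) 0 by apply: Rintegral_ge0 => w _.
rewrite le_eqVlt => /predU1P[e|]; [left|by right].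
have eE := real_integrableE ni; rewrite -e (expectation_llr theta l mneg) // in eE.
have := log_likelihood_dichotomy (hf l) (hL l theta1) (hL l theta) eE.
rewrite -(expectation_llr theta l (@normr_measurable _ setT)) // => h.
apply/eqP; rewrite -normr_eq0 eq_le normr_ge0 andbT.
apply: (le_trans (le_normr_Rintegral measurableT Yi)).
by rewrite /Rintegral h.
Qed.

Let a01 k m l : 0 <= a k m l <= 1.
Proof.
by rewrite (combination_exp_ge0 hA) (combination_exp_le1 hA).
Qed.

Let acvg k l : a k m l @[m --> \oo] --> p l.
Proof.
have := @combination_exp_cvg _ _ _ _ _ hgraph hA hv l k.
by rewrite -(cvg_shiftS (fun n => (A ^+ n) l k)).
Qed.
Arguments acvg : clear implicits.

Let p01 l : 0 < p l <= 1.
Proof.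
case: hv => _ v1 v0; rewrite v0 /= -v1 (bigD1 l) //= lerDl.
by apply: sumr_ge0 => j _; exact: ltW.
Qed.

Let m_aveE theta : m_ave theta1 P L xi v theta = \sum_l p l * \int[P]_w Y theta l 0%N w.
Proof. by apply: eq_bigr => l _; rewrite /mean_llr unlock. Qed.

Lemma measurable_steady_state_llr delta k theta :
  measurable_fun [set: Omega] (steady_state_llr theta1 L xi A delta k theta).
Proof.
apply: measurable_funM => //.
have [mY _ _] := llr_iid_rows theta.
exact: (measurable_array_lim (geometric_weight (a k) delta) mY).
Qed.

Lemma measurable_llr_nonpos delta k theta :
  measurable [set w | steady_state_llr theta1 L xi A delta k theta w <= 0].
Proof.
rewrite -[X in measurable X]setTI.
apply: (measurable_fun_le (g := cst 0)) => //.
exact: measurable_steady_state_llr.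
Qed.

Lemma steady_state_llr_weak_law k theta eps eta : 0 < eps -> 0 < eta ->
  \forall delta \near (0 : R)^'+,
    (P [set w | (eps < `|steady_state_llr theta1 L xi A delta k theta w
                        - m_ave theta1 P L xi v theta|)%R] <= eta%:E)%E.
Proof.
move=> eps0 eta0; rewrite m_aveE.
exact: (weak_law (a01 k) (acvg k) (llr_iid_rows theta) (llr_integrable theta)).
Qed.

Lemma error_probability_small k eta :
  (forall theta, theta != theta1 -> 0 < m_ave theta1 P L xi v theta) -> 0 < eta ->
  \forall delta \near (0 : R)^'+,
    (error_probability theta1 P L xi A delta k <= eta%:E)%E.
Proof.
move=> hm eta0.
pose b := eta / (#|Theta|%:R + 1).
have T1 : 0 < #|Theta|%:R + 1 :> R by rewrite ltr_wpDl.
have b0 : 0 < b by rewrite divr_gt0.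
have bE : #|Theta|%:R * b <= eta.
  by rewrite /b mulrCA ler_piMr ?(ltW eta0) // ler_pdivrMr // mul1r lerDl.
have key theta : theta != theta1 -> \forall delta \near (0 : R)^'+,
    (P [set w | steady_state_llr theta1 L xi A delta k theta w <= 0]%R <= b%:E)%E.
  move=> /hm m0; set m := m_ave _ _ _ _ _ _ in m0 *.
  (* A nonpositive ratio is at distance at least [m] from [m], hence more than [m / 2]. *)
  have m2 : 0 < m / 2 by rewrite divr_gt0.
  have := steady_state_llr_weak_law k theta m2 b0; apply: filterS => delta.
  apply: le_trans; apply: le_measure; rewrite ?inE.
  - exact: measurable_llr_nonpos.
  - by apply: measurable_set_dist_gt; exact: measurable_steady_state_llr.
  - move=> w /= h; rewrite -/m ltr0_norm; last by rewrite subr_lt0 (le_lt_trans h).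
    rewrite opprB; have : m / 2 < m by rewrite gtr_pMr // invf_lt1 // ltr1n.
    by move/lt_le_trans; apply; rewrite lerBrDl gerDr.
have {}key : \forall delta \near (0 : R)^'+, forall theta, theta != theta1 ->
    (P [set w | steady_state_llr theta1 L xi A delta k theta w <= 0]%R <= b%:E)%E.
  apply: filter_forall => theta; have [->|/key] := eqVneq theta theta1.
    by apply: nearW => delta; rewrite ?eqxx.
  by apply: filterS => delta h _.
apply: filterS key => delta key.
have [_ h] := prob_exists_le (ltW b0) (fun theta _ => measurable_llr_nonpos delta k theta) key.
by apply: (le_trans h); rewrite lee_fin.
Qed.

Section ErrorExponent.
Variable theta : Theta.
Hypothesis hLambda : forall (k : 'I_N) (t : R), (Lambda theta1 P L xi k t theta < +oo)%E.
Hypothesis hmean : 0 < m_ave theta1 P L xi v theta.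

Lemma llr_expR_integrable l t : real_integrable P (fun w => expR (t * Y theta l 0%N w)).
Proof.
have [mY _ _] := llr_iid_rows theta.
apply: real_integrable_ge0.
- by apply: measurableT_comp => //; exact: measurable_funM.
- by move=> w; exact: expR_ge0.
have := hLambda l t; rewrite /Lambda /mmt_gen_fun unlock.
rewrite [X in lne X](_ : _ = \int[P]_w (expR (t * Y theta l 0%N w))%:E)%E; last first.
  by apply: eq_integral => w _; congr (expR _)%:E; rewrite /= mulrC.
by case: (\int[P]_w _)%E => //= s; rewrite ltry.
Qed.

Let F := mean_log_mgf P (Y theta) p.

Let Lambda_aveE t : Lambda_ave theta1 P L xi v t theta = (F t)%:E.
Proof.
rewrite /Lambda_ave /F /mean_log_mgf -sumEFin; apply: eq_bigr => l _.
rewrite /Lambda /mmt_gen_fun unlock.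
rewrite [X in lne X](_ : _ = \int[P]_w (expR (v l 0 * t * Y theta l 0%N w))%:E)%E; last first.
  by apply: eq_integral => w _; congr (expR _)%:E; rewrite /= mulrC.
rewrite (real_integrableE (llr_expR_integrable _ _)) lne_EFin //.
exact: mgf_gt0 (llr_integrable _ _) (llr_expR_integrable _) _.
Qed.

Let phi_integrandE x : x != 0 -> phi_integrand theta1 P L xi v theta x = (F x / x)%:E.
Proof. by move=> x0; rewrite /phi_integrand (negPf x0) Lambda_aveE. Qed.

Lemma error_exponent_llr k : exists2 ell : R,
  Phi_theta theta1 P L xi v theta = (- ell)%:E &
  forall eps, 0 < eps -> \forall delta \near (0 : R)^'+,
    ((expR ((ell - eps) / delta))%:E <=
       P [set w | steady_state_llr theta1 L xi A delta k theta w <= 0]%R <=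
     (expR ((ell + eps) / delta))%:E)%E.
Proof.
have Yi := llr_integrable theta; have Ye := llr_expR_integrable.
have cF : convex_on_line F by exact: mean_log_mgf_convex.
have F0 : F 0 = 0 by exact: mean_log_mgf0.
have mean0 : 0 < \sum_l p l * \int[P]_w Y theta l 0%N w by rewrite -m_aveE.
have [ts [ts0 phits phimin bnd]] := geometric_array_large_deviation
  (llr_iid_rows theta) Yi Ye (a01 k) (acvg k) p01 mean0 (llr_dichotomy theta)
  (slope_integral_slope cF F0) (slope_integral_small cF F0).
exists (slope_integral F ts); last exact: bnd.
rewrite /Phi_theta EFinN; congr (- _)%E.
have phin t : t < 0 -> phi theta1 P L xi v t theta = (slope_integral F t)%:E.
  by move=> t0; exact: (oriented_integral_neg cF F0 phi_integrandE).
apply/eqP; rewrite eq_le; apply/andP; split.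
  by apply: ereal_inf_lbound; exists ts => //; exact: phin.
(* For [t >= 0], Jensen's inequality gives [F x >= x * mean >= 0] on the interval, so
   [phi t >= 0 >= phi ts] and only negative [t] compete. *)
apply/ereal_infP => _ [t _ <-]; have [t0|t0] := ltP t 0.
  by rewrite phin // lee_fin phimin.
apply: (@le_trans _ _ 0%E); first by rewrite lee_fin.
apply: (oriented_integral_nonneg cF phi_integrandE) => // x x0.
apply: le_trans (mean_log_mgf_ge_mean Yi Ye p x).
by rewrite mulr_ge0 // ltW.
Qed.

End ErrorExponent.

Lemma error_exponent k :
  (forall theta, theta != theta1 -> 0 < m_ave theta1 P L xi v theta) ->
  (forall (k' : 'I_N) (theta : Theta) (t : R), theta != theta1 ->
     (Lambda theta1 P L xi k' t theta < +oo)%E) ->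
  (delta%:E * lne (error_probability theta1 P L xi A delta k))%E
    @[delta --> (0 : R)^'+] --> (- Phi theta1 P L xi v)%E.
Proof.
move=> hm hLam.
(* With a single hypothesis the minimum is over the empty set: [Phi] is [+oo], the error probability
   is 0, and [delta] times its logarithm is [-oo]. *)
have [[th0 th01]|noth] := pselect (exists theta, theta != theta1); last first.
  have Phioo : Phi theta1 P L xi v = +oo%E.
    by rewrite /Phi big_pred0 // => theta; apply/negbTE/negP => h; apply: noth; exists theta.
  rewrite Phioo /=; apply: cvg_near_cst; near=> delta.
  have d0 : 0 < delta by near: delta; exact: nbhs_right_gt.
  rewrite (_ : error_probability _ _ _ _ _ _ _ = 0%E); last first.
    rewrite /error_probability (_ : [set w | _] = set0) ?measure0 //.
    by apply/seteqP; split => // w [theta [h _]]; apply: noth; exists theta.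
  by rewrite le0_lneNy // gt0_muleNy.
have ex theta : exists ell : R, theta != theta1 ->
    Phi_theta theta1 P L xi v theta = (- ell)%:E /\
    forall eps, 0 < eps -> \forall delta \near (0 : R)^'+,
    ((expR ((ell - eps) / delta))%:E <=
       P [set w | steady_state_llr theta1 L xi A delta k theta w <= 0]%R <=
     (expR ((ell + eps) / delta))%:E)%E.
  have [->|h] := eqVneq theta theta1; first by exists 0.
  have [ell e1 e2] := error_exponent_llr (fun k' t => hLam k' theta t h) (hm _ h) k.
  by exists ell.
pose ell theta := projT1 (cid (ex theta)).
have hell theta : theta != theta1 ->
    Phi_theta theta1 P L xi v theta = (- ell theta)%:E /\
    forall eps, 0 < eps -> \forall delta \near (0 : R)^'+,
    ((expR ((ell theta - eps) / delta))%:E <=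
       P [set w | steady_state_llr theta1 L xi A delta k theta w <= 0]%R <=
     (expR ((ell theta + eps) / delta))%:E)%E.
  by rewrite /ell; case: cid.
(* The largest [ell], that is the smallest exponent, governs the union: its own event gives the
   lower bound, and the union bound costs only a factor [#|Theta|]. *)
have [th2 th21 maxth] := @arg_maxP _ _ _ th0 (fun theta => theta != theta1) ell th01.
have PhiE : (- Phi theta1 P L xi v = (ell th2)%:E)%E.
  rewrite -[RHS]oppeK; congr (- _)%E; apply/eqP; rewrite eq_le; apply/andP; split.
    have := @bigmin_le_cond _ _ Theta +oo%E th2 (fun theta => theta != theta1)
      (Phi_theta theta1 P L xi v) th21.
    by have [-> _] := hell _ th21.
  apply/bigmin_geP; split; first by rewrite leey.
  by move=> theta h; have [-> _] := hell _ h; rewrite -EFinN lee_fin lerN2; exact: maxth.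
rewrite PhiE; apply: (cvg_log_scale (H := #|Theta|%:R)).
  by rewrite ltr0n; apply/card_gt0P; exists th0.
move=> eps eps0.
have {}hell : \forall delta \near (0 : R)^'+, forall theta, theta != theta1 ->
    ((expR ((ell theta - eps) / delta))%:E <=
       P [set w | steady_state_llr theta1 L xi A delta k theta w <= 0]%R <=
     (expR ((ell theta + eps) / delta))%:E)%E.
  apply: filter_forall => theta; have [->|/hell[_ /(_ _ eps0)]] := eqVneq theta theta1.
    by apply: nearW => delta; rewrite ?eqxx.
  by apply: filterS => delta h _.
near=> delta.
have d0 : 0 < delta by near: delta; exact: nbhs_right_gt.
have h : forall theta, theta != theta1 ->
    ((expR ((ell theta - eps) / delta))%:E <=
       P [set w | steady_state_llr theta1 L xi A delta k theta w <= 0]%R <=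
     (expR ((ell theta + eps) / delta))%:E)%E by near: delta; exact: hell.
have h' theta : theta != theta1 ->
    (P [set w | steady_state_llr theta1 L xi A delta k theta w <= 0]%R <=
     (expR ((ell th2 + eps) / delta))%:E)%E.
  move=> th; have /andP[_ h2] := h _ th; apply: (le_trans h2).
  by rewrite lee_fin ler_expR ler_pM2r ?invr_gt0 // lerD2r; exact: maxth.
have [mU PU] := prob_exists_le (expR_ge0 _)
  (fun theta _ => measurable_llr_nonpos delta k theta) h'.
apply/andP; split.
  have /andP[h1 _] := h _ th21; apply: (le_trans h1).
  apply: le_measure; rewrite ?inE //; first exact: measurable_llr_nonpos.
  by move=> w /= hw; exists th2.
exact: PU.
Unshelve. all: end_near. Qed.

End Model.

Theorem theorem1
  (R : realType) (N : nat) (Theta : finType) (theta1 : Theta)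
  (nbr : 'I_N -> {set 'I_N}) (A : 'M[R]_N) (v : 'cV[R]_N)
  (dT : 'I_N -> measure_display) (T : forall k : 'I_N, measurableType (dT k))
  (nu : forall k : 'I_N, {sigma_finite_measure set (T k) -> \bar R})
  (X : forall k : 'I_N, set (T k))
  (f : forall k : 'I_N, T k -> R) (L : forall k : 'I_N, Theta -> T k -> R)
  (dO : measure_display) (Omega : measurableType dO) (P : probability Omega R)
  (xi : forall k : 'I_N, nat -> Omega -> T k)
  (mu0 : 'I_N -> Theta -> R) (mu : R -> 'I_N -> nat -> Omega -> Theta -> R)
  (hgraph : strongly_connected nbr)
  (hA : combination_matrix nbr A)
  (hv : perron_eigenvector A v)
  (hf : forall k : 'I_N, density_with_support (nu k) (X k) (f k))
  (hL : forall (k : 'I_N) (theta : Theta),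
    density_with_support (nu k) (X k) (L k theta))
  (hxi : signal_model P nu f xi)
  (hKL : forall (k : 'I_N) (theta : Theta),
    (KL_divergence (nu k) (f k) (L k theta) < +oo)%E)
  (hid : identifiable theta1 nu f L)
  (hmu0_pmf : forall k : 'I_N, \sum_theta mu0 k theta = 1)
  (hmu0_pos : forall (k : 'I_N) (theta : Theta), 0 < mu0 k theta)
  (hmu : forall delta : R, 0 < delta < 1 ->
    asl_beliefs L xi nbr A delta mu0 (mu delta)) :
  (forall (k : 'I_N) (theta : Theta) (eps : R), 0 < eps ->
     P [set w | eps < `|steady_state_llr theta1 L xi A delta k theta w
                        - m_ave theta1 P L xi v theta|]
       @[delta --> 0^'+] --> 0%E) /\
  ((forall theta : Theta, theta != theta1 -> 0 < m_ave theta1 P L xi v theta) ->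
     forall k : 'I_N,
       (error_probability theta1 P L xi A delta k @[delta --> 0^'+] --> 0%E) /\
       ((forall (k' : 'I_N) (theta : Theta) (t : R), theta != theta1 ->
           (Lambda theta1 P L xi k' t theta < +oo)%E) ->
        ((delta%:E * lne (error_probability theta1 P L xi A delta k))%E
           @[delta --> 0^'+] --> (- Phi theta1 P L xi v)%E))).
Proof.
split=> [k theta eps eps0|hm k].
  apply: cvge0_near => [delta|eta eta0]; first exact: measure_ge0.
  exact: (steady_state_llr_weak_law theta1 hgraph hA hv hf hL hxi hKL k theta eps0 eta0).
split=> [|hLam].
  apply: cvge0_near => [delta|eta eta0]; first exact: measure_ge0.
  exact: (error_probability_small hgraph hA hv hf hL hxi hKL k hm eta0).
exact: (error_exponent hgraph hA hv hf hL hxi hKL k hm hLam).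
Qed.
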